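(* Let $q\in(0,1)$ be given and set $\lambda=-\log q>0$. Let $m=m_n$ be a sequence of positive integers with $m_n\to\infty$ and $m_n=o(n^{1/3})$ as $n\to\infty$. For each $n$ let $\kappa=(k_1,\ldots,k_m)\in\mathcal{P}_n(m)$ be chosen with probability $P(\kappa)=c\cdot q^{k_1}$, where $c=c_{n,m}$ is the normalizing constant such that $\sum_{\kappa\in\mathcal{P}_n(m)}P(\kappa)=1$. Then $$\frac{1}{\sqrt{m}}\Big(k_1-\Big\lceil\frac{n}{m}\Big\rceil-\gamma m\Big)$$ converges weakly to the normal distribution $N(0,\sigma^2)$ as $n\to\infty$, where $$\gamma=\frac{1}{\lambda^{2}}\int_0^{\lambda}\frac{t}{e^t-1}\,dt\qquad\text{and}\qquad\sigma^2=\frac{2}{\lambda^{3}}\int_0^{\lambda}\frac{t}{e^t-1}\,dt-\frac{1}{\lambda(e^{\lambda}-1)}>0.$$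
   Context: For integers $n,m\ge 1$, $\mathcal{P}_n(m)$ denotes the set of partitions of $n$ with at most $m$ parts; its elements are written as $\kappa=(k_1,\ldots,k_m)$ with integers $k_1\ge k_2\ge\cdots\ge k_m\ge 0$ and $\sum_{i=1}^m k_i=n$ (shorter partitions are padded with zeros). $\lceil x\rceil$ is the smallest integer $\ge x$. *)

(* Defs.v *)
From HB Require Import structures.
From mathcomp Require Import all_boot all_order all_algebra.
From mathcomp Require Import all_classical all_reals all_analysis.

Set Implicit Arguments.
Unset Strict Implicit.
Unset Printing Implicit Defensive.

Import Order.TTheory GRing.Theory Num.Theory.
Import numFieldNormedType.Exports.

Local Open Scope classical_set_scope.
Local Open Scope ring_scope.

Definition partitions (n m : nat) : set (m.-tuple nat) :=
  [set k : m.-tuple nat | sorted geq k /\ (\sum_(i < m) tnth k i)%N = n].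
Arguments partitions n m : clear implicits.

Definition first_part (m : nat) (k : m.-tuple nat) : nat := head 0%N k.

Definition norm_const (R : realType) (q : R) (n m : nat) : R :=
  (\sum_(k \in partitions n m) q ^+ first_part k)^-1.

Definition partition_pmf (R : realType) (q : R) (n m : nat)
    (k : m.-tuple nat) : R :=
  norm_const q n m * q ^+ first_part k.

(* For 0 < q and 0 < m this is the law of the random partition: the finitely
   supported sums are genuine by [finite_partitions], and the total weight is
   positive by [partitions_neq0]. The [else] branch is a junk value making
   [partition_prob] a probability measure for all parameters (for instance,
   [partitions n 0] is empty when 0 < n). *)
Definition partition_prob (R : realType) (q : R) (n m : nat) :
    set (m.-tuple nat) -> \bar R := fun A =>
  if (0 < q) && (0 < m)%N
  then (\sum_(k \in partitions n m `&` A) (partition_pmf q n k)%:E)%E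
  else \d_([tuple of nseq m 0%N]) A.
Arguments partition_prob {R} q n m A.

Lemma finite_partitions (n m : nat) : finite_set (partitions n m).
Proof.
apply: (@sub_finite_set _ _
  ((fun t : m.-tuple 'I_n.+1 => [tuple of map val t]) @` setT)).
  move=> k [_ kn]; exists [tuple inord (tnth k i) | i < m] => //.
  apply: eq_from_tnth => i; rewrite tnth_map tnth_mktuple /= inordK// ltnS -kn.
  by rewrite (bigD1 i)//= leq_addr.
exact/finite_image/finite_finset.
Qed.

Lemma partitions_neq0 (n m : nat) : (0 < m)%N -> exists k, partitions n m k.
Proof.
case: m => // m _; exists [tuple of n :: nseq m 0%N]; split => /=.
  by case: m => //= m; elim: m => //= m; rewrite /geq /=.
rewrite big_ord_recl /= big1 ?addn0// => i _.
by rewrite (tnth_nth 0%N) /= nth_nseq if_same.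
Qed.

Section partition_prob.
Context {R : realType} (q : R) (n m : nat).

Local Notation P := (partition_prob q n m).

Let sum_gt0 : (0 < q) && (0 < m)%N ->
  0 < \sum_(k \in partitions n m) q ^+ first_part k.
Proof.
move=> /andP[q0 m0]; have [k kP] := partitions_neq0 n m0.
rewrite (fsbigD1 k)//=; last exact: finite_partitions.
by rewrite ltr_pwDl ?exprn_gt0// fsumr_ge0// => i _; rewrite exprn_ge0// ltW.
Qed.

Let pmf_ge0 (k : m.-tuple nat) : (0 < q) && (0 < m)%N -> 0 <= partition_pmf q n k.
Proof.
move=> qm; rewrite mulr_ge0 ?invr_ge0 ?(ltW (sum_gt0 qm))//.
by case/andP : qm => q0 _; rewrite exprn_ge0// ltW.
Qed.

Let partition_prob_esum (A : set (m.-tuple nat)) : (0 < q) && (0 < m)%N ->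
  P A = (\esum_(k in partitions n m `&` A) (partition_pmf q n k)%:E)%E.
Proof.
move=> qm; rewrite /partition_prob qm esum_fset//.
  exact: (sub_finite_set (@subIsetl _ _ _) (finite_partitions n m)).
by move=> k _; rewrite lee_fin pmf_ge0.
Qed.

Let partition_prob0 : P set0 = 0%E.
Proof.
by rewrite /partition_prob; case: ifPn => // _; rewrite setI0 fsbig_set0.
Qed.

Let partition_prob_ge0 A : (0 <= P A)%E.
Proof.
have [qm|qm] := boolP ((0 < q) && (0 < m)%N).
  by rewrite partition_prob_esum// esum_ge0// => k _; rewrite lee_fin pmf_ge0.
by rewrite /partition_prob (negbTE qm).
Qed.

Let partition_prob_sigma_additive : semi_sigma_additive P.
Proof.
move=> F mF tF mUF; have [qm|qm] := boolP ((0 < q) && (0 < m)%N); last first.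
  by rewrite /partition_prob (negbTE qm); exact: measure_semi_sigma_additive.
apply: cvg_toP.
  apply: ereal_nondecreasing_is_cvgn => a b ab.
  by apply: lee_sum_nneg_natr => // i _ _; exact: partition_prob_ge0.
rewrite partition_prob_esum// setI_bigcupr.
under eq_eseriesr do rewrite partition_prob_esum//.
rewrite nneseries_sum_bigcup//; first exact: trivIset_setIl.
by move=> k; rewrite lee_fin pmf_ge0.
Qed.

HB.instance Definition _ := isMeasure.Build _ _ _ P
  partition_prob0 partition_prob_ge0 partition_prob_sigma_additive.

Let partition_prob_setT : P [set: _] = 1%E.
Proof.
rewrite /partition_prob; case: ifPn => [qm|_]; last exact: diracT.
rewrite setIT fsbig_finite/=; last exact: finite_partitions.
rewrite sumEFin -mulr_sumr /norm_const fsbig_finite/=; last first.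
  exact: finite_partitions.
rewrite mulVf//; have := sum_gt0 qm.
by rewrite fsbig_finite/= => [/lt0r_neq0//|]; exact: finite_partitions.
Qed.

HB.instance Definition _ :=
  @Measure_isProbability.Build _ _ R P partition_prob_setT.

End partition_prob.

(* The codomain is [measurableTypeR R], the copy of [R] with its Borel sets on
   which [normal_prob] lives. *)
Definition scaled_first_part (R : realType) (gamma : R) (n m : nat)
    (k : m.-tuple nat) : measurableTypeR R :=
  (Num.sqrt m%:R)^-1 *
    ((first_part k)%:R - (Num.ceil (n%:R / m%:R : R))%:~R - gamma * m%:R).

Lemma measurable_scaled_first_part (R : realType) (gamma : R) (n m : nat) :
  measurable_fun [set: m.-tuple nat] (@scaled_first_part R gamma n m).
Proof.
apply: (measurableT_comp (f := fun j : nat => (Num.sqrt m%:R)^-1 *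
    (j%:R - (Num.ceil (n%:R / m%:R : R))%:~R - gamma * m%:R))) => //.
case: m => [|m].
  rewrite (_ : @first_part 0 = cst 0%N)//.
  by apply/funext => k; rewrite tuple0.
rewrite (_ : @first_part m.+1 = (@tnth _ nat ^~ ord0)).
  exact: measurable_tnth.
by apply/funext => k; rewrite (tnth_nth 0%N) nth0.
Qed.

HB.instance Definition _ (R : realType) (gamma : R) (n m : nat) :=
  isMeasurableFun.Build _ _ _ _ (@scaled_first_part R gamma n m)
    (@measurable_scaled_first_part R gamma n m).

Definition weak_cvg (R : realType)
    (mu : nat -> probability (measurableTypeR R) R)
    (nu : probability (measurableTypeR R) R) : Prop :=
  forall f : R -> R, continuous f -> bounded_fun f ->
    \int[mu n]_x f x @[n --> \oo] --> \int[nu]_x f x.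

(* Main.v *)
(* Put d = m_n and N = d k_1 - n.  Subtracting every part from k_1 turns a
   partition of n into at most d parts into a partition of N into at most
   d - 1 parts, and every partition of N arises when d divides n + N and
   d N <= n.  With r = q^(1/d) the weight q^(k_1) is r^n r^N, so, up to a tail
   that is O(d^3 / n), N has the law of S = sum_{j < d} j X_j with independent
   geometric X_j, P(X_j = k) = (1 - r^j) r^(j k), conditioned on S = -n mod d.

   A fixed number L of the terms j X_j makes the residue of S mod d nearly
   uniform (each term contracts the deviation from uniformity by a constant
   factor), while it moves S by O(L d) = o(d^(3/2)); hence the conditioning is
   asymptotically irrelevant.  Lindeberg replacement of the j X_j by Gaussians,
   together with Riemann sums for the mean and the variance of S, gives the
   limit law of S on smooth test functions, and tightness of the limit extends
   it to bounded continuous functions. *)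

Require Import Defs.
From mathcomp Require Import all_boot all_order all_algebra.
From mathcomp Require Import finmap.
From mathcomp Require Import all_classical all_reals all_analysis.
From mathcomp Require Import measurable_realfun.
From mathcomp Require Import ring lra zify.
Import Order.TTheory GRing.Theory Num.Theory.
Import numFieldNormedType.Exports.
Local Open Scope classical_set_scope.
Local Open Scope ring_scope.
Set Implicit Arguments.
Unset Strict Implicit.
Unset Printing Implicit Defensive.

(** * Means under geometric laws *)

(** Independence is encoded by iterated one-variable means, and every partial mean stays a function
    of the starting value [b]. Small indices are innermost: a bound on the first [L] terms that is
    uniform in [b] survives averaging over the remaining ones by monotonicity, which takes the place
    of conditioning on the large terms. The obstacle is arithmetic. The residue event has
    probability about [1 / d], so a limit law for S alone does not decide the conditional law. What
    helps is that [r ^ d = q] stays fixed: a step of size [j] runs through a whole period of [d]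
    while its weights change by a bounded factor, which gives a contraction rate depending on [q]
    only. The smallest indices are used because the error of one contraction is proportional to
    [j / d], and [X_1], [X_2] first make the hitting probabilities Lipschitz. [L] is fixed while [n]
    grows and is chosen large beforehand. The normalizing constant is never computed: it is the same
    weighted sum for the test function [1], and the common scale cancels in a quotient. *)

Section geometric_mean.
Context {R : realType}.
Implicit Types (x : R) (f g Phi : nat -> R).

Definition geo_partial x f (n : nat) : R := \sum_(k < n) (1 - x) * x ^+ k * f k.

(* The mean of [f] under the geometric law of parameter [x]; meaningful only
   for [geo_summable x f]. *)
Definition geo x f : R := limn (geo_partial x f).

Definition geo_summable x f : Prop :=
  exists B, forall n, geo_partial x (fun k => `|f k|) n <= B.

Lemma geo_partialS x f n :
  geo_partial x f n.+1 = (1 - x) * f 0%N + x * geo_partial x (f \o S) n.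
Proof.
rewrite /geo_partial big_ord_recl expr0 mulr1; congr (_ + _).
by rewrite mulr_sumr; apply: eq_bigr => i _ /=; rewrite exprS; ring.
Qed.

(* Discounted superharmonic functions [Phi] dominate the mean: this evaluates
   and bounds moments without manipulating series. *)
Lemma geo_partial_super x f Phi n : 0 <= x ->
  (forall k, 0 <= Phi k) ->
  (forall k, (1 - x) * f k + x * Phi k.+1 <= Phi k) ->
  geo_partial x f n <= Phi 0%N.
Proof.
move=> x0; elim: n f Phi => [|n IH] f Phi Phi0 H; first by rewrite /geo_partial big_ord0.
rewrite geo_partialS (le_trans _ (H 0%N))// lerD2l ler_wpM2l//.
by apply: (IH (f \o S) (Phi \o S)) => k /=; [exact: Phi0|exact: H].
Qed.

Lemma geo_summable_super x f Phi : 0 <= x ->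
  (forall k, 0 <= Phi k) ->
  (forall k, (1 - x) * `|f k| + x * Phi k.+1 <= Phi k) -> geo_summable x f.
Proof. by move=> x0 P0 H; exists (Phi 0%N) => n; exact: (geo_partial_super n x0 P0 H). Qed.

Lemma geo_cvg x f : 0 <= x <= 1 -> geo_summable x f ->
  geo_partial x f n @[n --> \oo] --> geo x f.
Proof.
move=> /andP[x0 x1] [B HB].
pose u k := (1 - x) * x ^+ k * f k.
rewrite /geo; have -> : geo_partial x f = series u.
  by apply/funext => n; rewrite /geo_partial /series/= big_mkord.
apply: normed_cvg.
apply: nondecreasing_is_cvgn.
  by apply: nondecreasing_series => n _ _; exact: normr_ge0.
exists B => _ [n _ <-]; apply: le_trans (HB n).
change (\sum_(0 <= k < n) `|u k| <= geo_partial x (fun k => `|f k|) n).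
rewrite big_mkord; apply: ler_sum => k _.
by rewrite /u normrM ger0_norm// mulr_ge0 ?exprn_ge0 ?subr_ge0.
Qed.

Lemma geo_unique x f l : 0 <= x <= 1 -> geo_summable x f ->
  geo_partial x f n @[n --> \oo] --> l -> geo x f = l.
Proof.
move=> x01 sf fl; have := geo_cvg x01 sf => fg.
by rewrite -(cvg_lim _ fl)//; apply/esym/cvg_lim.
Qed.

Lemma geo_summable_le x f g : 0 <= x <= 1 ->
  (forall k, `|f k| <= g k) -> geo_summable x g -> geo_summable x f.
Proof.
move=> /andP[x0 x1] fg [B HB]; exists B => n; apply: le_trans (HB n).
apply: ler_sum => k _; apply: ler_wpM2l.
  by rewrite mulr_ge0 ?exprn_ge0 ?subr_ge0.
by rewrite (le_trans (fg k))// ler_norm.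
Qed.

Lemma geo_summableD x f g : 0 <= x <= 1 ->
  geo_summable x f -> geo_summable x g -> geo_summable x (fun k => f k + g k).
Proof.
move=> /andP[x0 x1] [B HB] [C HC]; exists (B + C) => n.
apply: le_trans (lerD (HB n) (HC n)).
rewrite -big_split; apply: ler_sum => k _ /=; rewrite -mulrDr.
by apply: ler_wpM2l; rewrite ?ler_normD// mulr_ge0 ?exprn_ge0 ?subr_ge0.
Qed.

Lemma geo_summableZ x f c : 0 <= x <= 1 ->
  geo_summable x f -> geo_summable x (fun k => c * f k).
Proof.
move=> /andP[x0 x1] [B HB]; exists (`|c| * B) => n.
apply: le_trans (ler_wpM2l (normr_ge0 c) (HB n)).
rewrite mulr_sumr; apply: ler_sum => k _ /=; rewrite normrM.
by rewrite le_eqVlt; apply/orP; left; apply/eqP; ring.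
Qed.

Lemma geo_summable_cst x c : 0 <= x <= 1 -> geo_summable x (fun=> c).
Proof.
move=> /andP[x0 x1]; apply: (@geo_summable_super _ _ (fun=> `|c|)) => // k.
by rewrite -mulrDl subrK mul1r.
Qed.

Lemma geo_summable_shift x f : 0 < x <= 1 ->
  geo_summable x f -> geo_summable x (f \o S).
Proof.
move=> /andP[x0 x1] [B HB]; exists (B / x) => n.
rewrite ler_pdivlMr// (le_trans _ (HB n.+1))// geo_partialS mulrC lerDr.
by rewrite mulr_ge0 ?subr_ge0.
Qed.

Lemma geoD x f g : 0 <= x <= 1 -> geo_summable x f -> geo_summable x g ->
  geo x (fun k => f k + g k) = geo x f + geo x g.
Proof.
move=> x01 sf sg; apply: geo_unique => //; first exact: geo_summableD.
have -> : geo_partial x (fun k => f k + g k) =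
    (fun n => geo_partial x f n + geo_partial x g n).
  by apply/funext => n; rewrite -big_split; apply: eq_bigr => k _ /=; rewrite mulrDr.
by apply: cvgD; exact: geo_cvg.
Qed.

Lemma geoZ x f c : 0 <= x <= 1 -> geo_summable x f ->
  geo x (fun k => c * f k) = c * geo x f.
Proof.
move=> x01 sf; apply: geo_unique => //; first exact: geo_summableZ.
have -> : geo_partial x (fun k => c * f k) = (fun n => c * geo_partial x f n).
  by apply/funext => n; rewrite mulr_sumr; apply: eq_bigr => k _ /=; ring.
by apply: cvgMr; exact: geo_cvg.
Qed.

Lemma geo_summableB x f g : 0 <= x <= 1 ->
  geo_summable x f -> geo_summable x g -> geo_summable x (fun k => f k - g k).
Proof.
move=> x01 sf sg; have := geo_summableD x01 sf (geo_summableZ (-1) x01 sg).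
by congr geo_summable; apply/funext => k; rewrite mulN1r.
Qed.

Lemma geoB x f g : 0 <= x <= 1 -> geo_summable x f -> geo_summable x g ->
  geo x (fun k => f k - g k) = geo x f - geo x g.
Proof.
move=> x01 sf sg; rewrite -[in RHS]mulN1r -geoZ// -geoD//; last exact: geo_summableZ.
by congr geo; apply/funext => k; rewrite mulN1r.
Qed.

Lemma geo_le x f g : 0 <= x <= 1 -> geo_summable x f -> geo_summable x g ->
  (forall k, f k <= g k) -> geo x f <= geo x g.
Proof.
move=> x01 sf sg fg; have cf := geo_cvg x01 sf; have cg := geo_cvg x01 sg.
rewrite -(cvg_lim _ cf)// -(cvg_lim _ cg)//; apply: ler_lim.
- by apply/cvg_ex; exists (geo x f).
- by apply/cvg_ex; exists (geo x g).
apply: nearW => n; apply: ler_sum => k _; apply: ler_wpM2l => //.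
by case/andP: x01 => x0 x1; rewrite mulr_ge0 ?exprn_ge0 ?subr_ge0.
Qed.

(** Memorylessness: a geometric variable is [0] with probability [1 - x] and otherwise one plus a
    copy of itself. Applied to powers this is a triangular system for the moments. *)
Lemma geo_rec x f : 0 < x <= 1 -> geo_summable x f ->
  geo x f = (1 - x) * f 0%N + x * geo x (f \o S).
Proof.
move=> x01 sf.
have x01' : 0 <= x <= 1 by case/andP: x01 => /ltW -> ->.
have sS := geo_summable_shift x01 sf.
apply: geo_unique => //; rewrite -cvg_shiftS/=.
have -> : (fun n => geo_partial x f n.+1) =
   (fun n => (1 - x) * f 0%N + x * geo_partial x (f \o S) n).
  by apply/funext => n; rewrite geo_partialS.
by apply: cvgD; [exact: cvg_cst|apply: cvgMr; exact: geo_cvg].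
Qed.

Lemma geo_cst x c : 0 < x < 1 -> geo x (fun=> c) = c.
Proof.
move=> /andP[x0 x1].
have H := @geo_rec x (fun=> c).
have := H _ (geo_summable_cst _ _); rewrite x0 (ltW x1) (ltW x0) /=.
move=> /(_ isT isT); rewrite (_ : (_ \o S) = (fun=> c))//.
move=> /eqP; rewrite -subr_eq -{1}(mul1r (geo _ _)) -mulrBl => /eqP.
by apply: mulfI; rewrite subr_eq0 gt_eqF.
Qed.

Lemma geo_normr_le x f g : 0 <= x <= 1 -> geo_summable x f -> geo_summable x g ->
  (forall k, `|f k| <= g k) -> `|geo x f| <= geo x g.
Proof.
move=> x01 sf sg fg; rewrite ler_norml; apply/andP; split.
  rewrite -mulN1r -geoZ//; apply: geo_le => //; first exact: geo_summableZ.
  by move=> k; rewrite mulN1r; move: (fg k); rewrite ler_norml => /andP[].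
by apply: geo_le => // k; rewrite (le_trans _ (fg k))// ler_norm.
Qed.

Lemma geo_partial_le x f n : 0 <= x <= 1 -> geo_summable x f ->
  (forall k, 0 <= f k) -> geo_partial x f n <= geo x f.
Proof.
move=> x01 sf f0; have cf := geo_cvg x01 sf.
rewrite -[leRHS](cvg_lim _ cf)//; apply: nondecreasing_cvgn_le.
  apply/nondecreasing_seqP => k; rewrite /geo_partial big_ord_recr /= lerDl.
  by case/andP: x01 => x0 x1; rewrite !mulr_ge0 ?exprn_ge0 ?subr_ge0.
by apply/cvg_ex; exists (geo x f).
Qed.

Lemma geo_super x f Phi : 0 <= x <= 1 -> geo_summable x f ->
  (forall k, 0 <= Phi k) ->
  (forall k, (1 - x) * f k + x * Phi k.+1 <= Phi k) -> geo x f <= Phi 0%N.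
Proof.
move=> x01 sf P0 H; have cf := geo_cvg x01 sf.
rewrite -(cvg_lim _ cf)//; apply: limr_le.
  by apply/cvg_ex; exists (geo x f).
by apply: nearW => n; case/andP: x01 => x0 _; exact: (geo_partial_super n x0 P0 H).
Qed.

End geometric_mean.

Section geometric_moments.
Context {R : realType}.
Variable x : R.
Hypothesis x01 : 0 < x < 1.

Let x01' : 0 <= x <= 1. Proof. by case/andP: x01 => /ltW -> /ltW ->. Qed.
Let x01'' : 0 < x <= 1. Proof. by case/andP: x01 => -> /ltW ->. Qed.

Lemma geo_summable_cube : geo_summable x (fun k => k%:R ^+ 3).
Proof.
case/andP: x01 => x0 x1.
(* [g1], [g2], [g3] are the first three moments of [X], so the potential below is the mean of
   [(k + X) ^ 3] and satisfies the inequality with equality. *)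
pose g1 := x / (1 - x).
pose g2 := x * (1 + 2 * g1) / (1 - x).
pose g3 := x * (1 + 3 * g1 + 3 * g2) / (1 - x).
have x1' : 0 < 1 - x by rewrite subr_gt0.
have g10 : 0 <= g1 by rewrite divr_ge0 ?ltW.
have g20 : 0 <= g2 by rewrite divr_ge0 ?(ltW x1')// mulr_ge0 ?(ltW x0)//; lra.
have g30 : 0 <= g3 by rewrite divr_ge0 ?(ltW x1')// mulr_ge0 ?(ltW x0)//; lra.
apply: (@geo_summable_super _ _ _ (fun k : nat =>
  k%:R ^+ 3 + 3 * k%:R ^+ 2 * g1 + 3 * k%:R * g2 + g3)) => [|k|k]; first exact: ltW.
  by do ![apply: addr_ge0 => //|apply: mulr_ge0 => //|apply: exprn_ge0 => //].
rewrite ger0_norm ?exprn_ge0// -natr1 le_eqVlt; apply/orP; left; apply/eqP.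
rewrite /g3 /g2 /g1; field; lra.
Qed.

Lemma geo_summable_poly (f : nat -> R) (C : R) :
  (forall k, `|f k| <= C * (1 + k%:R ^+ 3)) -> geo_summable x f.
Proof.
move=> H; apply: (geo_summable_le x01' H); apply: geo_summableZ => //.
apply: geo_summableD => //; first exact: geo_summable_cst.
exact: geo_summable_cube.
Qed.

Lemma geo_summable_bounded (f : nat -> R) (C : R) :
  (forall k, `|f k| <= C) -> geo_summable x f.
Proof.
by move=> H; apply: (geo_summable_le x01' H); exact: geo_summable_cst.
Qed.

Lemma geo_summable_id : geo_summable x (fun k => k%:R).
Proof.
apply: (@geo_summable_poly _ 1) => k; rewrite mul1r ger0_norm//.
case: k => [|k]; first by rewrite expr0n addr0.
by rewrite (@le_trans _ _ (k.+1%:R ^+ 3))// ?lerDr// -[leLHS]expr1 ler_weXn2l// ler1n.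
Qed.

Lemma geo_summable_sqr : geo_summable x (fun k => k%:R ^+ 2).
Proof.
apply: (@geo_summable_poly _ 1) => k; rewrite mul1r ger0_norm ?exprn_ge0//.
case: k => [|k]; first by rewrite !expr0n addr0.
by rewrite (@le_trans _ _ (k.+1%:R ^+ 3))// ?lerDr// ler_weXn2l// ler1n.
Qed.

Lemma geo_id : geo x (fun k => k%:R) = x / (1 - x).
Proof.
have x1' : 1 - x != 0 by rewrite subr_eq0 gt_eqF//; case/andP: x01.
have := geo_rec x01'' geo_summable_id.
have -> : (fun k : nat => k%:R : R) \o S = (fun k => k%:R + 1).
  by apply/funext => k /=; rewrite natr1.
rewrite geoD//; [|exact: geo_summable_id|exact: geo_summable_cst].
rewrite geo_cst// mulr0 add0r => H.
by apply: (mulfI x1'); rewrite mulrC mulrBr mulr1 {1}H; field.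
Qed.

Lemma geo_sqr : geo x (fun k => k%:R ^+ 2) = x * (1 + x) / (1 - x) ^+ 2.
Proof.
have x1' : 1 - x != 0 by rewrite subr_eq0 gt_eqF//; case/andP: x01.
have := geo_rec x01'' geo_summable_sqr.
have -> : (fun k : nat => k%:R ^+ 2 : R) \o S =
    (fun k => k%:R ^+ 2 + (2 * k%:R + 1)).
  by apply/funext => k /=; rewrite -natr1; ring.
have s1 := geo_summable_id; have s2 := geo_summable_sqr.
have s0 := geo_summable_cst 1 x01'; have s3 := geo_summableZ 2 x01' s1.
rewrite geoD//; last exact: geo_summableD.
rewrite geoD// geoZ// geo_cst// geo_id expr0n mulr0 add0r => H.
by apply: (mulfI x1'); rewrite mulrC mulrBr mulr1 {1}H; field.
Qed.

Lemma geo_cube_le : geo x (fun k => k%:R ^+ 3) <= 6 / (1 - x) ^+ 3.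
Proof.
have /andP[x0 x1] := x01.
have x1' : 1 - x != 0 by rewrite subr_eq0 gt_eqF//; case/andP: x01.
have := geo_rec x01'' geo_summable_cube.
have -> : (fun k : nat => k%:R ^+ 3 : R) \o S =
    (fun k => k%:R ^+ 3 + (3 * k%:R ^+ 2 + (3 * k%:R + 1))).
  by apply/funext => k /=; rewrite -natr1; ring.
have s1 := geo_summable_id; have s2 := geo_summable_sqr.
have s3 := geo_summable_cube.
have s0 := geo_summable_cst 1 x01'; have s4 := geo_summableZ 3 x01' s1.
have s5 := geo_summableZ 3 x01' s2.
have s6 := geo_summableD x01' s4 s0.
have s7 := geo_summableD x01' s5 s6.
rewrite geoD// geoD// geoD// geoZ// geoZ// geo_cst// geo_id geo_sqr expr0n mulr0 add0r => H.
have -> : geo x (fun k => k%:R ^+ 3) = x * (1 + 4 * x + x ^+ 2) / (1 - x) ^+ 3.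
  by apply: (mulfI x1'); rewrite mulrC mulrBr mulr1 {1}H; field.
rewrite ler_pM2r ?invr_gt0 ?exprn_gt0 ?subr_gt0//.
have : x ^+ 2 <= 1 by rewrite expr_le1// ltW.
nra.
Qed.

End geometric_moments.

(** * Partitions and the Boltzmann law *)

Section boltzmann.
Context {R : realType}.
Variable r : R.
Hypothesis r01 : 0 < r < 1.
Implicit Types (f g : nat -> R) (j b : nat).

(* The mean of [g (b + 1 * X_1 + ... + j * X_j)] for independent geometric
   [X_i] of parameter [r ^+ i]. *)
Fixpoint boltzmann j g b : R :=
  if j is i.+1 then geo (r ^+ i.+1) (fun k => boltzmann i g (b + i.+1 * k)%N)
  else g b.

(** This class contains the bounded functions and the identity, and it is stable under [boltzmann],
    which keeps every nested mean summable. *)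
Definition affine_growth g := exists C, forall N, `|g N| <= C * (1 + N%:R).

Lemma affine_growth_bounded g C : (forall N, `|g N| <= C) -> affine_growth g.
Proof.
move=> H; exists C => N; apply: (le_trans (H N)).
by rewrite ler_peMr// ?lerDl// (le_trans _ (H N)).
Qed.

Lemma affine_growth_id : affine_growth (fun N => N%:R).
Proof. by exists 1 => N; rewrite mul1r ger0_norm// lerDr. Qed.

Lemma affine_growthD f g : affine_growth f -> affine_growth g ->
  affine_growth (fun N => f N + g N).
Proof.
move=> [C HC] [D HD]; exists (C + D) => N; rewrite mulrDl.
by rewrite (le_trans (ler_normD _ _))// lerD.
Qed.

Lemma affine_growthZ g c : affine_growth g -> affine_growth (fun N => c * g N).
Proof.
by move=> [C HC]; exists (`|c| * C) => N; rewrite normrM -mulrA ler_wpM2l.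
Qed.

Lemma affine_growthB f g : affine_growth f -> affine_growth g ->
  affine_growth (fun N => f N - g N).
Proof.
move=> gf [C HC]; apply: affine_growthD => //; exists C => N.
by rewrite normrN.
Qed.

Lemma affine_growth_le f g : (forall N, `|f N| <= `|g N|) -> affine_growth g ->
  affine_growth f.
Proof. by move=> fg [C HC]; exists C => N; rewrite (le_trans (fg N)). Qed.

Lemma affine_growth_shift g b : affine_growth g ->
  affine_growth (fun N => g (b + N)%N).
Proof.
move=> [C HC]; have C0 : 0 <= C.
  by have := HC 0%N; rewrite addr0 mulr1; exact: le_trans.
exists (C * (1 + b%:R)) => N; rewrite (le_trans (HC _))// -mulrA ler_wpM2l//.
rewrite natrD; have := ler0n R b; have := ler0n R N; nra.
Qed.

Lemma expr_itv01 j : 0 < r ^+ j.+1 < 1.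
Proof. by case/andP: r01 => r0 r1; rewrite exprn_gt0// exprn_ilt1// ltW. Qed.

Lemma expr_itv01W j : 0 <= r ^+ j.+1 <= 1.
Proof. by case/andP: (expr_itv01 j) => /ltW -> /ltW ->. Qed.

Lemma affine_growth_summable g x b j : 0 < x < 1 -> affine_growth g ->
  geo_summable x (fun k => g (b + j * k)%N).
Proof.
move=> x01 [C HC]; have C0 : 0 <= C.
  by have := HC 0%N; rewrite addr0 mulr1; exact: le_trans.
apply: (@geo_summable_le _ _ _ (fun k => C * (1 + b%:R) + (C * j%:R) * k%:R)).
- by case/andP: x01 => /ltW -> /ltW ->.
- by move=> k; rewrite (le_trans (HC _))// natrD natrM; lra.
- have x01' : 0 <= x <= 1 by case/andP: x01 => /ltW -> /ltW ->.
  apply: geo_summableD => //; first exact: geo_summable_cst.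
  by apply: geo_summableZ => //; exact: geo_summable_id.
Qed.

Lemma boltzmann_growth j g : affine_growth g -> affine_growth (boltzmann j g).
Proof.
elim: j => // j IH /IH gj; have [C HC] := gj; have C0 : 0 <= C.
  by have := HC 0%N; rewrite addr0 mulr1; exact: le_trans.
have x01 := expr_itv01 j; have x01' := expr_itv01W j.
exists (C * (1 + j.+1%:R * (r ^+ j.+1 / (1 - r ^+ j.+1)))) => b /=.
have s1 := geo_summable_id x01.
apply: (@le_trans _ _ (geo (r ^+ j.+1)
    (fun k => C * (1 + b%:R) + (C * j.+1%:R) * k%:R))).
  apply: geo_normr_le => //.
  - exact: affine_growth_summable.
  - by apply: geo_summableD => //; [exact: geo_summable_cst|exact: geo_summableZ].
  - by move=> k; rewrite (le_trans (HC _))// natrD natrM; lra.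
rewrite geoD//; [|exact: geo_summable_cst|exact: geo_summableZ].
rewrite geo_cst// geoZ// geo_id//.
set y := _ / (1 - _); have y0 : 0 <= y.
  by case/andP: x01' => *; rewrite /y divr_ge0// subr_ge0.
rewrite -subr_ge0 (_ : _ - _ = C * j.+1%:R * y * b%:R); last by ring.
by do ![apply: mulr_ge0 => //].
Qed.

Lemma boltzmann_summable j i g b : affine_growth g ->
  geo_summable (r ^+ j.+1) (fun k => boltzmann i g (b + j.+1 * k)%N).
Proof.
move=> gg; apply: affine_growth_summable; first exact: expr_itv01.
exact: boltzmann_growth.
Qed.

(** An inequality between the means over the first [i] terms, uniform in the start, is preserved by
    averaging over the later terms. This plays the role of conditioning on the terms of index above
    [i]. *)
Lemma boltzmann_from i j f g b : affine_growth f -> affine_growth g ->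
  (i <= j)%N -> (forall b, boltzmann i f b <= boltzmann i g b) ->
  boltzmann j f b <= boltzmann j g b.
Proof.
move=> gf gg; elim: j b => [|j IH] b; first by rewrite leqn0 => /eqP ->.
rewrite leq_eqVlt => /orP[/eqP -> //|]; rewrite ltnS => ij H /=.
apply: geo_le; [exact: expr_itv01W|exact: boltzmann_summable|
  exact: boltzmann_summable|].
by move=> k; exact: IH.
Qed.

Lemma boltzmann_le j f g b : affine_growth f -> affine_growth g ->
  (forall b, f b <= g b) -> boltzmann j f b <= boltzmann j g b.
Proof. by move=> *; exact: (@boltzmann_from 0). Qed.

Lemma boltzmann_cst j c b : boltzmann j (fun=> c) b = c.
Proof.
elim: j b => //= j IH b; rewrite -[RHS](geo_cst c (expr_itv01 j)).
by congr geo; apply/funext => k; rewrite IH.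
Qed.

Lemma boltzmannD j f g b : affine_growth f -> affine_growth g ->
  boltzmann j (fun N => f N + g N) b = boltzmann j f b + boltzmann j g b.
Proof.
move=> gf gg; elim: j b => //= j IH b.
rewrite -geoD ?expr_itv01W//; [|exact: boltzmann_summable..].
by congr geo; apply/funext => k; rewrite IH.
Qed.

Lemma boltzmannZ j f c b : affine_growth f ->
  boltzmann j (fun N => c * f N) b = c * boltzmann j f b.
Proof.
move=> gf; elim: j b => //= j IH b.
rewrite -geoZ ?expr_itv01W//; last exact: boltzmann_summable.
by congr geo; apply/funext => k; rewrite IH.
Qed.

Lemma boltzmannB j f g b : affine_growth f -> affine_growth g ->
  boltzmann j (fun N => f N - g N) b = boltzmann j f b - boltzmann j g b.
Proof.
move=> gf gg; rewrite -mulN1r -boltzmannZ// -boltzmannD//; last exact: affine_growthZ.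
by congr (boltzmann j _ b); apply/funext => N; rewrite mulN1r.
Qed.

Lemma boltzmann_normr_le j f g b : affine_growth f -> affine_growth g ->
  (forall b, `|f b| <= g b) -> `|boltzmann j f b| <= boltzmann j g b.
Proof.
move=> gf gg fg; rewrite ler_norml; apply/andP; split.
  rewrite -mulN1r -boltzmannZ//; apply: boltzmann_le => //; first exact: affine_growthZ.
  by move=> N; rewrite mulN1r; move: (fg N); rewrite ler_norml => /andP[].
by apply: boltzmann_le => // N; rewrite (le_trans _ (fg N))// ler_norm.
Qed.

Lemma boltzmann_shift j g b c :
  boltzmann j g (b + c) = boltzmann j (fun N => g (b + N)%N) c.
Proof.
elim: j c => //= j IH c; congr geo; apply/funext => k.
by rewrite -addnA IH.
Qed.

Lemma boltzmann_shift0 j g b :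
  boltzmann j g b = boltzmann j (fun N => g (b + N)%N) 0.
Proof. by rewrite -boltzmann_shift addn0. Qed.

(** Memorylessness of the outermost variable. The weighted partition counts obey the same recursion,
    which is how the two get identified. *)
Lemma boltzmann_rec j g b : affine_growth g ->
  boltzmann j.+1 g b =
    (1 - r ^+ j.+1) * boltzmann j g b + r ^+ j.+1 * boltzmann j.+1 g (b + j.+1).
Proof.
move=> gg /=; rewrite geo_rec; [|by case/andP: (expr_itv01 j) => -> /ltW ->|
  exact: boltzmann_summable].
rewrite muln0 addn0; congr (_ + _ * geo _ _); apply/funext => k /=.
by rewrite mulnS addnA.
Qed.

Definition boltzmann_mean j : R :=
  \sum_(i < j) i.+1%:R * (r ^+ i.+1 / (1 - r ^+ i.+1)).

Lemma boltzmann_id j b : boltzmann j (fun N => N%:R) b = b%:R + boltzmann_mean j.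
Proof.
elim: j b => [|j IH] b; rewrite /boltzmann_mean /=; first by rewrite big_ord0 addr0.
have x01 := expr_itv01 j; have x01' := expr_itv01W j.
have s1 := geo_summable_id x01.
rewrite (_ : (fun _ => _) = (fun k : nat => (b%:R + boltzmann_mean j) + j.+1%:R * k%:R)).
  rewrite geoD//; [|exact: geo_summable_cst|exact: geo_summableZ].
  by rewrite geo_cst// geoZ// geo_id// big_ord_recr/= addrA.
by apply/funext => k; rewrite IH natrD natrM addrAC.
Qed.

End boltzmann.

(** * Counting partitions with a bounded number of parts *)

Section partition_counts.

(** The order is increasing, with zeros included: subtracting decreasing parts from the largest one
    reverses their order, and the recursion on the counts inspects the smallest part, which is the
    head. *)
Definition is_partition (j N : nat) (s : seq nat) : bool :=
  [&& size s == j, sorted leq s & sumn s == N].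

Definition partition_list (j N : nat) : seq (seq nat) :=
  [seq s <- [seq map val (tval t) | t <- enum {: j.-tuple 'I_N.+1}] | is_partition j N s].

Lemma sumn_mem_leq (s : seq nat) x : x \in s -> (x <= sumn s)%N.
Proof.
elim: s => //= y s IH; rewrite inE => /orP[/eqP ->|/IH xs]; first exact: leq_addr.
exact: leq_trans xs (leq_addl _ _).
Qed.

Lemma mem_partition_list j N s : (s \in partition_list j N) = is_partition j N s.
Proof.
rewrite mem_filter; case: (boolP (is_partition j N s)) => //= /and3P[/eqP sj _ /eqP sN].
have sz : size [seq (inord x : 'I_N.+1) | x <- s] == j by rewrite size_map sj.
apply/mapP; exists (Tuple sz) => /=; first by rewrite mem_enum.
rewrite -map_comp map_id_in// => x /sumn_mem_leq xs /=.
by rewrite inordK// ltnS -sN.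
Qed.

Lemma uniq_partition_list j N : uniq (partition_list j N).
Proof.
apply: filter_uniq; rewrite map_inj_uniq ?enum_uniq// => s t st.
exact/val_inj/(inj_map val_inj).
Qed.

Lemma sumn_mapS (s : seq nat) : sumn (map S s) = (sumn s + size s)%N.
Proof. by elim: s => //= x s ->; lia. Qed.

Lemma size_partition_list0 N : size (partition_list 0 N) = (N == 0%N).
Proof.
have [->|N0] := eqVneq N 0%N.
  apply/eqP; rewrite eqn_leq; apply/andP; split; last first.
    have : [::] \in partition_list 0 0 by rewrite mem_partition_list.
    by case: partition_list.
  rewrite (@uniq_leq_size _ _ [:: [::]])// ?uniq_partition_list// => s.
  by rewrite mem_partition_list => /and3P[/nilP -> _ _]; rewrite inE.
apply/eqP; rewrite size_eq0; apply/eqP.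
case E : partition_list => [//|s l].
have : s \in partition_list 0 N by rewrite E mem_head.
by rewrite mem_partition_list => /and3P[/nilP -> _ /=]; rewrite eq_sym (negbTE N0).
Qed.

(** Either the smallest part is zero and is dropped ([l1]), or all [j + 1] parts are positive and
    each loses one ([l2]). The test [j < N] guards the truncated subtraction. *)
Lemma size_partition_listS j N : size (partition_list j.+1 N) =
  (size (partition_list j N) +
    (if (j < N)%N then size (partition_list j.+1 (N - j.+1)) else 0))%N.
Proof.
pose l1 := map (cons 0%N) (partition_list j N).
pose l2 := if (j < N)%N then map (map S) (partition_list j.+1 (N - j.+1)) else [::].
have -> : (if (j < N)%N then size (partition_list j.+1 (N - j.+1)) else 0%N) = size l2.
  by rewrite /l2; case: ifP => // _; rewrite size_map.
have <- : size l1 = size (partition_list j N) by rewrite size_map.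
rewrite -size_cat; apply: perm_size; apply: uniq_perm.
- exact: uniq_partition_list.
- rewrite cat_uniq; apply/and3P; split.
  + by rewrite map_inj_uniq ?uniq_partition_list// => ? ? [].
  + apply/hasPn => s; rewrite /l2; case: ifP => // _ /mapP[t].
    rewrite mem_partition_list => /and3P[/eqP].
    by case: t => // x t _ _ _ ->; apply/mapP => -[? _ []].
  + rewrite /l2; case: ifP => // _.
    by rewrite map_inj_uniq ?uniq_partition_list//; exact/inj_map/succn_inj.
move=> s; rewrite mem_cat mem_partition_list; apply/idP/orP.
- case: s => [/andP[]//|[|x] s] /and3P[] /=; rewrite eqSS.
    move=> sj ps sN; left; apply/mapP; exists s => //.
    by rewrite mem_partition_list /is_partition sj sN (path_sorted ps).
  move=> /eqP sj ps /eqP sN; right.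
  have xs : all (leq x.+1) s by exact: (order_path_min leq_trans ps).
  have sE : x.+1 :: s = map S (x :: map predn s).
    rewrite /= -map_comp map_id_in// => y ys /=.
    by rewrite prednK//; move/allP: xs => /(_ _ ys); exact: leq_trans.
  have sN' : sumn (x.+1 :: s) = N by [].
  move: (sN'); rewrite sE sumn_mapS /= size_map sj => sN2.
  rewrite /l2 ifT; last by rewrite -sN2; lia.
  rewrite -/(map S (x :: map predn s)).
  apply/mapP; exists (x :: map predn s); last by [].
  rewrite mem_partition_list /is_partition /= size_map sj eqxx /=.
  apply/andP; split; last by apply/eqP; lia.
  have : sorted leq (map S (x :: map predn s)) by rewrite -sE.
  by rewrite sorted_map.
- case=> [/mapP[t]|].
    rewrite mem_partition_list => /and3P[sj st sN] ->.
    by rewrite /is_partition /= eqSS sj sN path_min_sorted ?st//; apply/allP.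
  rewrite /l2; case: ifP => // jN /mapP[t]; rewrite mem_partition_list.
  move=> /and3P[/eqP sj st /eqP sN] ->.
  rewrite /is_partition size_map sj eqxx sumn_mapS sN sj subnK// eqxx andbT /=.
  by rewrite sorted_map.
Qed.

End partition_counts.

(** * The law of the weighted sum of geometric variables *)

Section boltzmann_law.
Context {R : realType}.
Variable r : R.
Hypothesis r01 : 0 < r < 1.

(** The probability that [X_1 + 2 X_2 + ... + j X_j] equals [N]: each choice of multiplicities with
    sum [N] has weight [r ^ N] up to the normalizing product, as in Euler's generating function. *)
Definition boltzmann_weight (j N : nat) : R :=
  (\prod_(i < j) (1 - r ^+ i.+1)) * r ^+ N * (size (partition_list j N))%:R.

Lemma boltzmann_weightS j N : boltzmann_weight j.+1 N =
  (1 - r ^+ j.+1) * boltzmann_weight j N +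
  r ^+ j.+1 * (if (j < N)%N then boltzmann_weight j.+1 (N - j.+1) else 0).
Proof.
rewrite /boltzmann_weight size_partition_listS natrD big_ord_recr /=.
case: ifP => jN; last by rewrite !(mulr0, addr0); ring.
have -> : r ^+ N = r ^+ j.+1 * r ^+ (N - j.+1) by rewrite -exprD subnKC.
by ring.
Qed.

(** For finitely supported [g] the nested series collapses to a finite sum, the form in which it can
    be compared with a sum over partitions. *)
Lemma boltzmann_finite j g M b : (forall N, (M <= N)%N -> g N = 0) ->
  boltzmann r j g b = \sum_(N < M) boltzmann_weight j N * g (b + N)%N.
Proof.
move=> gM.
have gg : affine_growth g.
  apply: (@affine_growth_bounded _ _ (\sum_(N < M) `|g N|)) => N.
  have [NM|/gM ->] := ltnP N M; last by rewrite normr0 sumr_ge0.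
  by rewrite (bigD1 (Ordinal NM))//= lerDl sumr_ge0.
elim: j b => [|j IH] b.
  rewrite /=; have [bM|Mb] := ltnP b M; last first.
    rewrite gM// big1// => i _; rewrite gM ?mulr0//.
    exact: leq_trans Mb (leq_addr _ _).
  have M0 : (0 < M)%N by exact: leq_ltn_trans bM.
  rewrite (bigD1 (Ordinal M0))//= big1 => [|[i iM] /=].
    rewrite /boltzmann_weight size_partition_list0 big_ord0.
    by rewrite expr0 addn0 addr0 !mul1r.
  rewrite -val_eqE/= => i0.
  by rewrite /boltzmann_weight size_partition_list0 (negbTE i0) mulr0 mul0r.
(* Inner induction on [M - b]: memorylessness raises the start by [j + 1], and from [M] on the test
   function vanishes. *)
have [n] := ubnP (M - b); elim: n b => // n IHn b Mbn.
have [Mb|bM] := leqP M b.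
  rewrite big1 => [|i _]; last first.
    by rewrite gM ?mulr0//; exact: leq_trans Mb (leq_addr _ _).
  rewrite boltzmann_shift0 -[RHS](boltzmann_cst r01 j.+1 0 0).
  congr (boltzmann _ _ _ _); apply/funext => N.
  by rewrite gM//; exact: leq_trans Mb (leq_addr _ _).
rewrite boltzmann_rec// IH IHn; last by lia.
under [RHS]eq_bigr do rewrite boltzmann_weightS mulrDl.
rewrite big_split/=; congr (_ + _).
  by rewrite mulr_sumr; apply: eq_bigr => i _; rewrite mulrA.
(* [F (N + j.+1) = G N]: after the shift of index the sums differ only by the values of [F] below
   [j.+1] and of [G] from [M - j.+1] on, all of which vanish. *)
rewrite mulr_sumr; pose F N := r ^+ j.+1 *
  (if (j < N)%N then boltzmann_weight j.+1 (N - j.+1) else 0) * g (b + N)%N.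
pose G N := r ^+ j.+1 * (boltzmann_weight j.+1 N * g (b + j.+1 + N)%N).
rewrite -(big_mkord xpredT F) -(big_mkord xpredT G) /=.
have FG N : F (N + j.+1)%N = G N.
  rewrite /F /G ifT; last by lia.
  by rewrite addnK -addnA (addnC N) mulrA.
have [jM|Mj] := leqP j.+1 M; last first.
  rewrite !big_nat !big1// => i /andP[_ iM]; rewrite /F/G.
    by rewrite ifF ?mulr0 ?mul0r//; apply/negbTE; lia.
  by rewrite gM ?mulr0//; lia.
have F0 : \sum_(0 <= i < j.+1) F i = 0.
  rewrite big_nat big1// => i /andP[_ ij].
  by rewrite /F ifF ?mulr0 ?mul0r//; apply/negbTE; lia.
have G0 : \sum_(M - j.+1 <= i < M) G i = 0.
  by rewrite big_nat big1// => i /andP[ij _]; rewrite /G gM ?mulr0//; lia.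
rewrite [RHS](@big_cat_nat _ _ _ j.+1)//= F0 add0r.
rewrite -{1}(add0n j.+1) big_addn.
rewrite (@big_cat_nat _ _ _ (M - j.+1)%N)//=; last by lia.
rewrite G0 addr0.
by apply: eq_bigr => i _; rewrite FG.
Qed.

End boltzmann_law.

(** * Partitions sorted by deficit *)

Section partitions_by_deficit.
Variables (n m : nat).

Definition deficit_partitions (N : nat) : seq (m.+1.-tuple nat) :=
  [seq k <- finmap.enum_fset (fset_set (partitions n m.+1)) | (m.+1 * first_part k == n + N)%N].

Lemma partitionsE (k : m.+1.-tuple nat) :
  k \in finmap.enum_fset (fset_set (partitions n m.+1)) <->
  sorted geq k /\ sumn k = n.
Proof.
rewrite -[k \in _]/(k \in fset_set (partitions n m.+1)) in_fset_set; last exact: finite_partitions.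
have E : (\sum_(i < m.+1) tnth k i)%N = sumn k by rewrite sumnE big_tuple.
by split=> [/set_mem[sk <-]|[sk kn]]; [rewrite E|apply/mem_set; split => //; rewrite E].
Qed.

Lemma first_part_max (k : m.+1.-tuple nat) x :
  sorted geq k -> x \in val k -> (x <= first_part k)%N.
Proof.
rewrite /first_part; case: k => -[//|y s] /= _ ps; rewrite inE => /orP[/eqP -> //|xs].
have geq_trans : transitive geq by move=> a b c ba ca; exact: leq_trans ca ba.
by have /allP := order_path_min geq_trans ps; apply.
Qed.

Lemma first_part_le (k : m.+1.-tuple nat) :
  k \in finmap.enum_fset (fset_set (partitions n m.+1)) -> (first_part k <= n)%N.
Proof.
move=> /partitionsE[_ <-]; rewrite /first_part; apply: sumn_mem_leq.
by case: k => -[|y s] //= _; rewrite mem_head.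
Qed.

Lemma first_part_ge (k : m.+1.-tuple nat) :
  k \in finmap.enum_fset (fset_set (partitions n m.+1)) -> (n <= m.+1 * first_part k)%N.
Proof.
move=> /partitionsE[sk <-].
have : all (fun x => x <= first_part k)%N k by apply/allP => x; exact: first_part_max.
have szk := size_tuple k.
suff H (s : seq nat) K : all (fun x => x <= K)%N s -> (sumn s <= size s * K)%N.
  by move=> /H; rewrite szk.
elim: s => //= x s IH /andP[xk /IH]; rewrite mulSn => H.
exact: leq_add.
Qed.

Lemma sumn_subn K (s : seq nat) : all (fun x => x <= K)%N s ->
  (sumn (map (subn K) s) + sumn s = size s * K)%N.
Proof. by elim: s => //= x s IH /andP[xK /IH]; lia. Qed.

Lemma sorted_subn K (s : seq nat) : sorted geq s -> sorted leq (map (subn K) s).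
Proof. by apply: homo_sorted => x y /= xy; apply: leq_sub2l. Qed.

Lemma subn_map_partition N K k : (m.+1 * K = n + N)%N ->
  k \in deficit_partitions N -> first_part k = K /\
  is_partition m N (map (subn K) (behead k)).
Proof.
move=> KN; rewrite mem_filter => /andP[/eqP kN /partitionsE[sk kn]].
have kK : first_part k = K.
  by apply/eqP; rewrite -(eqn_pmul2l (ltn0Sn m)) kN KN.
split=> //; rewrite /is_partition size_map size_behead size_tuple eqxx /=.
have ak : all (fun x => x <= K)%N k.
  by apply/allP => x xk; rewrite -kK; exact: first_part_max.
move: ak sk kn kK; rewrite /first_part.
case: k {kN} => -[//|y s] /= sz /andP[yK sK] ps kn yE; subst y.
apply/andP; split; first exact/sorted_subn/(path_sorted ps).
have := sumn_subn sK; move/eqP: sz => -[sz]; rewrite sz => E.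
by apply/eqP; nia.
Qed.

(** The deficit determines the largest part [K], so the other parts can be recovered from their
    differences to [K]: the subtraction map is injective. *)
Lemma size_deficit_partitions_le N :
  (size (deficit_partitions N) <= size (partition_list m N))%N.
Proof.
have [dv|ndv] := boolP (m.+1 %| n + N)%N; last first.
  rewrite (_ : deficit_partitions N = [::])//; apply/eqP.
  rewrite -[_ == _]negbK -has_filter; apply/hasPn => k _.
  by apply: contra ndv => /eqP <-; exact: dvdn_mulr.
have [K KN] : exists K, (m.+1 * K = n + N)%N.
  by exists ((n + N) %/ m.+1)%N; rewrite mulnC divnK.
rewrite -(size_map (fun k : m.+1.-tuple nat => map (subn K) (behead k))).
apply: uniq_leq_size.
  rewrite map_inj_in_uniq ?filter_uniq ?finmap.fset_uniq// => k l kD lD kl.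
  have [kK _] := subn_map_partition KN kD.
  have [lK _] := subn_map_partition KN lD.
  move: kD lD; rewrite !mem_filter => /andP[_ /partitionsE[sk _]] /andP[_ /partitionsE[sl _]].
  have ak : all (fun x => x <= K)%N k.
    by apply/allP => x xk; rewrite -kK; exact: first_part_max.
  have al : all (fun x => x <= K)%N l.
    by apply/allP => x xl; rewrite -lK; exact: first_part_max.
  apply: val_inj; move: kl kK lK ak al; rewrite /first_part.
  case: k {sk} => -[//|y s] /= _; case: l {sl} => -[//|z t] /= _.
  move=> st -> -> /andP[_ sK] /andP[_ tK]; congr (_ :: _).
  have subK u : all (fun x => x <= K)%N u -> map (subn K) (map (subn K) u) = u.
    move=> uK; rewrite -map_comp map_id_in// => x xu /=.
    by rewrite subKn//; move/allP: uK; exact.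
  by rewrite -(subK _ sK) st subK.
move=> s /mapP[k kD ->]; rewrite mem_partition_list.
by have [] := subn_map_partition KN kD.
Qed.

(** For small [N] the subtraction map is onto: prepending [K] to the differences [K - x] inverts
    it. *)
Lemma size_deficit_partitions_eq N : (m.+1 %| n + N)%N -> (m.+1 * N <= n)%N ->
  size (deficit_partitions N) = size (partition_list m N).
Proof.
move=> dv Nn; apply/eqP; rewrite eqn_leq size_deficit_partitions_le /=.
have [K KN] : exists K, (m.+1 * K = n + N)%N.
  by exists ((n + N) %/ m.+1)%N; rewrite mulnC divnK.
(* Hence no part of a partition of [N] exceeds [K], and the truncated subtraction from [K] is a
   genuine one. *)
have NK : (N <= K)%N by nia.
(* The default of [insubd] is never reached for a sequence of size [m], see [psiE]. *)
pose psi s : m.+1.-tuple nat := insubd [tuple of nseq m.+1 0%N] (K :: map (subn K) s).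
have psiE s : size s = m -> val (psi s) = K :: map (subn K) s.
  by move=> sm; rewrite /psi insubdK// -topredE /= size_map sm.
rewrite -(size_map psi); apply: uniq_leq_size.
  rewrite map_inj_in_uniq ?uniq_partition_list// => s t.
  rewrite !mem_partition_list => /and3P[/eqP sm _ /eqP sN] /and3P[/eqP tm _ /eqP tN].
  move=> /(congr1 val); rewrite !psiE// => -[st].
  have subK u : sumn u = N -> map (subn K) (map (subn K) u) = u.
    move=> uN; rewrite -map_comp map_id_in// => x xu /=.
    by rewrite subKn// (leq_trans (sumn_mem_leq xu))// uN.
  by rewrite -(subK _ sN) st subK.
move=> k /mapP[s]; rewrite mem_partition_list => /and3P[/eqP sm ss /eqP sN] ->.
have sK : all (fun x => x <= K)%N s.
  by apply/allP => x xs; rewrite (leq_trans (sumn_mem_leq xs))// sN.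
rewrite mem_filter /first_part psiE//= KN eqxx /=; apply/partitionsE.
rewrite psiE//; split.
  rewrite /= path_min_sorted; last first.
    by apply/allP => y /mapP[x xs ->]; exact: leq_subr.
  by move: ss; apply: homo_sorted => x y xy; apply: leq_sub2l.
by have := sumn_subn sK; rewrite /= sm; nia.
Qed.

Lemma size_deficit_partitions0 N : ~~ (m.+1 %| n + N)%N ->
  size (deficit_partitions N) = 0%N.
Proof.
move=> ndv; rewrite (_ : deficit_partitions N = [::])//; apply/eqP.
rewrite -[_ == _]negbK -has_filter; apply/hasPn => k _.
by apply: contra ndv => /eqP <-; exact: dvdn_mulr.
Qed.

End partitions_by_deficit.

(** * Comparison of the partition sum with the Boltzmann law *)

Section partition_sum.
Context {R : realType}.
Variables (r : R) (n m : nat).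
Hypotheses (r01 : 0 < r < 1) (n_gt0 : (0 < n)%N).

Definition deficit (k : m.+1.-tuple nat) : nat := (m.+1 * first_part k - n)%N.

Lemma sum_partitions_deficit (H : nat -> R) :
  \sum_(k \in partitions n m.+1) (r ^+ m.+1) ^+ first_part k * H (deficit k) =
  \sum_(N < (m.+1 * n).+1)
     r ^+ (n + N) * H N * (size (deficit_partitions n m N))%:R.
Proof.
rewrite fsbig_finite/=; last exact: finite_partitions.
rewrite big_seq.
(* The largest part is at most [n], so every deficit lies below the bound and [inord] does not alter
   it. *)
rewrite (partition_big (fun k => inord (deficit k) : 'I_(m.+1 * n).+1) xpredT)//=.
apply: eq_bigr => N _.
have E k : k \in finmap.enum_fset (fset_set (partitions n m.+1)) ->
    (inord (deficit k) == N) = (m.+1 * first_part k == n + N)%N.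
  move=> kP; have h1 := first_part_le kP; have h2 := first_part_ge kP.
  have dk : (deficit k < (m.+1 * n).+1)%N by rewrite /deficit; nia.
  by rewrite -val_eqE /= inordK// /deficit; apply/eqP/eqP; lia.
rewrite (eq_bigl (fun k => (k \in finmap.enum_fset (fset_set (partitions n m.+1))) &&
    (m.+1 * first_part k == n + N)%N)); last first.
  by move=> k; case: (boolP (k \in _)) => //= kP; rewrite E.
rewrite -big_seq_cond -big_filter -/(deficit_partitions n m N).
rewrite big_seq_cond (eq_bigr (fun=> r ^+ (n + N) * H N)); last first.
  move=> k /andP[]; rewrite mem_filter => /andP[/eqP kN _] _.
  by rewrite -exprM kN /deficit kN addKn.
by rewrite -big_seq_cond big_const_seq count_predT iter_addr_0 mulr_natr.
Qed.

Definition residue (N : nat) : R := (m.+1 %| n + N)%N%:R.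

Lemma residue_ge0 N : 0 <= residue N. Proof. exact: ler0n. Qed.
Lemma residue_le1 N : residue N <= 1. Proof. by rewrite /residue; case: (_ %| _)%N. Qed.

(* Only deficits [N] with [m.+1 * N > n] are miscounted; Markov's inequality
   bounds their mass. *)
Lemma sum_partitions_boltzmann (H : nat -> R) (B : R) : (forall N, `|H N| <= B) ->
  `| (\prod_(i < m) (1 - r ^+ i.+1)) / r ^+ n *
     (\sum_(k \in partitions n m.+1) (r ^+ m.+1) ^+ first_part k * H (deficit k))
     - boltzmann r m (fun N => H N * residue N) 0 |
  <= 2 * B * (m.+1%:R / n%:R) * boltzmann r m (fun N => N%:R * residue N) 0.
Proof.
move=> HB; have B0 : 0 <= B by exact: le_trans (HB 0%N).
have /andP[r0 r1] := r01.
have gNr : affine_growth (fun N => N%:R * residue N).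
  apply: (affine_growth_le _ (@affine_growth_id R)) => N.
  by rewrite normrM ler_piMr// ger0_norm ?residue_le1 ?residue_ge0.
have gHr : affine_growth (fun N => H N * residue N).
  apply: (@affine_growth_bounded _ _ B) => N.
  rewrite normrM (@le_trans _ _ `|H N|)// ler_piMr// ger0_norm ?residue_le1 ?residue_ge0//.
pose small N : R := (m.+1 * N <= n)%N%:R.
have large N : 1 - small N <= m.+1%:R / n%:R * N%:R.
  rewrite /small; case: leqP => mN; rewrite ?subrr ?subr0.
    by rewrite mulr_ge0 ?divr_ge0.
  rewrite mulrAC ler_pdivlMr ?ltr0n// mul1r -natrM ler_nat; exact: ltnW.
have small1 N : 0 <= 1 - small N by rewrite /small; case: leqP; rewrite ?subrr ?subr0.
pose M := (m.+1 * n).+1.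
(* [V] keeps the deficits counted exactly. Each of the two sides differs from it by at most the mass
   of the other deficits, whence the factor [2]. *)
pose V := boltzmann r m (fun N => H N * residue N * small N) 0.
have -> : 2 * B * (m.+1%:R / n%:R) = B * (m.+1%:R / n%:R) + B * (m.+1%:R / n%:R) by ring.
rewrite mulrDl -(subrK V (_ * \sum_(k \in _) _)) -addrA.
apply: le_trans (ler_normD _ _) _; apply: lerD; last first.
  have gs : affine_growth (fun N => H N * residue N * small N).
    apply: (affine_growth_le _ gHr) => N.
    by rewrite [leLHS]normrM ler_piMr// /small; case: leqP; rewrite ?normr1 ?normr0.
  rewrite /V -boltzmannB// -boltzmannZ//.
  apply: boltzmann_normr_le => //; [exact: affine_growthB|exact: affine_growthZ|].
  move=> N; rewrite -[X in _ - X]mulr1 -mulrBr -opprB mulrN normrN normrM.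
  rewrite (ger0_norm (small1 N)) normrM (ger0_norm (residue_ge0 N)).
  rewrite [leRHS](_ : _ = B * residue N * (m.+1%:R / n%:R * N%:R)); last by ring.
  by apply: ler_pM => //; [rewrite mulr_ge0 ?residue_ge0|rewrite ler_wpM2r ?residue_ge0].
have gt_small N : (M <= N)%N -> small N = 0.
  by move=> MN; rewrite /small leqNgt; suff -> : (n < m.+1 * N)%N by []; rewrite /M in MN; nia.
rewrite /V (@boltzmann_finite _ _ r01 m _ M); last first.
  by move=> N MN; rewrite gt_small ?mulr0.
rewrite sum_partitions_deficit mulr_sumr -sumrB.
apply: (le_trans (ler_norm_sum _ _ _)).
pose gM N := B * (m.+1%:R / n%:R) * (N%:R * residue N) * (N < M)%N%:R.
have gMle N : `|gM N| <= `|B * (m.+1%:R / n%:R) * (N%:R * residue N)|.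
  by rewrite [leLHS]normrM ler_piMr//; case: (_ < _)%N; rewrite ?normr1 ?normr0.
apply: (@le_trans _ _ (boltzmann r m gM 0)); last first.
  rewrite -boltzmannZ//; apply: boltzmann_le => //.
  - by apply: (affine_growth_le gMle); exact: affine_growthZ.
  - exact: affine_growthZ.
  - move=> N; rewrite /gM ler_piMr//; last by case: (_ < _)%N.
    by rewrite !mulr_ge0// ?residue_ge0// invr_ge0.
rewrite (@boltzmann_finite _ _ r01 m _ M); last first.
  by move=> N MN; rewrite /gM ltnNge MN mulr0.
apply: ler_sum => -[N NM] _ /=; rewrite add0n /gM NM mulr1 /boltzmann_weight.
set P := \prod_(_ < _) _; have P0 : 0 <= P.
  by apply: prodr_ge0 => i _; rewrite subr_ge0; case/andP: (expr_itv01W r01 i).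
set p := size (partition_list m N); set c := size (deficit_partitions n m N).
rewrite [X in `|X|](_ : _ = (P * r ^+ N) * (H N * (c%:R - p%:R * (residue N * small N)))); last first.
  by rewrite exprD; field; rewrite expf_neq0// gt_eqF.
have Pr : 0 <= P * r ^+ N by rewrite mulr_ge0// exprn_ge0// ltW.
rewrite normrM (ger0_norm Pr) -!(mulrA (P * r ^+ N)); apply: ler_wpM2l => //.
rewrite normrM [leRHS](_ : _ = B * (p%:R * (m.+1%:R / n%:R * N%:R) * residue N)); last by ring.
apply: ler_pM => //.
rewrite /residue; have [dv|ndv] := boolP (m.+1 %| n + N)%N; last first.
  by rewrite /c size_deficit_partitions0// mul0r mulr0 subr0 mulr0 normr0.
rewrite mul1r mulr1; have := large N; rewrite /small.
have [Nn|nN] := boolP (m.+1 * N <= n)%N => lN.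
  rewrite /c size_deficit_partitions_eq// mulr1 subrr normr0.
  by rewrite !mulr_ge0// invr_ge0.
rewrite subr0 in lN.
rewrite mulr0 subr0 ger0_norm// (@le_trans _ _ p%:R)//.
  by rewrite ler_nat size_deficit_partitions_le.
by rewrite ler_peMr.
Qed.

End partition_sum.

(** * Equidistribution of residues *)

Section power_bounds.
Context {R : realType}.
Variable r : R.
Hypothesis r01 : 0 < r < 1.

(** [1 - r ^ j] is [1 - r] times a geometric sum of [j] terms, each between [r ^ j] and [1]. With
    the matching lower bound it is of order [j / d] for [j <= d], with constants depending on [q]
    only. *)
Lemma onem_expr_le j : 1 - r ^+ j <= j%:R * (1 - r).
Proof.
have /andP[r0 r1] := r01.
elim: j => [|j IH]; first by rewrite expr0 subrr mul0r.
rewrite exprS -natr1 mulrDl mul1r.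
have : 0 <= 1 - r ^+ j by rewrite subr_ge0 exprn_ile1// ltW.
nra.
Qed.

Lemma onem_expr_ge j : j%:R * r ^+ j * (1 - r) <= 1 - r ^+ j.
Proof.
have /andP[r0 r1] := r01.
elim: j => [|j IH]; first by rewrite expr0 subrr !mul0r.
have yr : r ^+ j.+1 <= 1 by rewrite exprn_ile1// ltW.
have := ler_wpM2l (ltW r0) IH.
have : r ^+ j.+1 * (1 - r) <= 1 - r by rewrite ler_piMl// subr_ge0 ltW.
by rewrite exprS -natr1; lra.
Qed.

End power_bounds.

Section equidistribution.
Context {R : realType}.
Variables (r q : R) (m : nat).
Local Notation d := m.+1.
Hypotheses (r01 : 0 < r < 1) (rq : r ^+ d = q).
Local Notation res := (@residue R).

Let r_gt0 : 0 < r. Proof. by case/andP: r01. Qed.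
Let r_lt1 : r < 1. Proof. by case/andP: r01. Qed.
Let q_gt0 : 0 < q. Proof. by rewrite -rq exprn_gt0. Qed.
Let q_lt1 : q < 1. Proof. by rewrite -rq exprn_ilt1// ltW. Qed.
Let q1_gt0 : 0 < 1 - q. Proof. by rewrite subr_gt0. Qed.
Let r1_gt0 : 0 < 1 - r. Proof. by rewrite subr_gt0. Qed.

Let q1_neq0 : 1 - q != 0. Proof. by rewrite gt_eqF. Qed.
Let q_neq0 : q != 0. Proof. by rewrite gt_eqF. Qed.

Lemma onem_base_le : d%:R * (1 - r) <= (1 - q) / q.
Proof. by rewrite ler_pdivlMr// mulrAC -rq onem_expr_ge. Qed.

Lemma onem_base_ge : 1 - q <= d%:R * (1 - r).
Proof. by rewrite -rq onem_expr_le. Qed.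

(** Each [j X_j] has mean at most [d / (1 - q)] whatever [j], because the factor [j r ^ j] cancels
    against the lower bound of [1 - r ^ j]. *)
Lemma boltzmann_mean_le L : boltzmann_mean r L <= L%:R * (d%:R / (1 - q)).
Proof.
apply: (@le_trans _ _ (\sum_(i < L) d%:R / (1 - q))); last first.
  by rewrite sumr_const card_ord [leRHS]mulr_natl.
apply: ler_sum => i _; have /andP[x0 x1] := expr_itv01 r01 i.
rewrite mulrA ler_pdivrMr ?subr_gt0// mulrAC ler_pdivlMr//.
apply: (@le_trans _ _ (i.+1%:R * r ^+ i.+1 * (d%:R * (1 - r)))).
  by rewrite ler_wpM2l ?onem_base_ge// mulr_ge0// ltW.
by rewrite mulrCA ler_wpM2l// onem_expr_ge.
Qed.

Lemma boltzmann_mean_ge0 L : 0 <= boltzmann_mean r L.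
Proof.
apply: sumr_ge0 => i _; have /andP[x0 x1] := expr_itv01 r01 i.
by rewrite mulr_ge0// divr_ge0 ?subr_ge0 ?ltW.
Qed.

(* Since [m = -1 %[mod m.+1]], this is the distance from [N] to the next point
   of the residue class. *)
Definition hit_dist n N := ((m * (n + N)) %% d)%N.

Lemma hit_dist_lt n N : (hit_dist n N < d)%N.
Proof. by rewrite ltn_mod. Qed.

Lemma dvdn_hit_dist n N : (d %| n + N + hit_dist n N)%N.
Proof. by rewrite /dvdn modnDmr -mulSn modnMr. Qed.

Lemma residue_hit_dist n N : res n m N = (hit_dist n N == 0%N)%:R.
Proof.
rewrite /residue; congr (nat_of_bool _)%:R.
apply/idP/eqP => [dv|h0]; last by have := dvdn_hit_dist n N; rewrite h0 addn0.
by apply/eqP; rewrite -[_ == _]/(d %| m * (n + N))%N dvdn_mull.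
Qed.

Lemma hit_distD n N j : (hit_dist n N <= j + hit_dist n (N + j))%N.
Proof.
have h1 := dvdn_hit_dist n N; have h2 := dvdn_hit_dist n (N + j).
have lt1 := hit_dist_lt n N.
rewrite leqNgt; apply/negP => lt.
have : (d %| hit_dist n N - (j + hit_dist n (N + j)))%N.
  have h3 : (d %| n + N + (j + hit_dist n (N + j)))%N by rewrite !addnA in h2 *.
  by rewrite -(dvdn_addr _ h3) -addnA subnKC// ltnW.
by move=> /dvdn_leq; rewrite subn_gt0 lt => /(_ isT); lia.
Qed.

Lemma hit_dist0D n N j : (0 < j)%N -> hit_dist n N = 0%N ->
  (d <= j + hit_dist n (N + j))%N.
Proof.
move=> j0 h0; have h1 := dvdn_hit_dist n N; have h2 := dvdn_hit_dist n (N + j).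
rewrite h0 addn0 in h1; apply: dvdn_leq; first by lia.
by rewrite -(dvdn_addr _ h1); rewrite !addnA in h2 *.
Qed.

Lemma residue_growth n b : affine_growth (fun N => res n m (b + N)%N).
Proof.
apply: (@affine_growth_bounded _ _ 1) => N.
by rewrite ger0_norm ?residue_ge0 ?residue_le1.
Qed.

Lemma residue_growth0 n : affine_growth (res n m).
Proof. exact: (residue_growth n 0). Qed.

(** The potential is [r] to the distance from the next hit. A step of size [j] shortens this
    distance by at most [j], which the discount [r ^ j] pays for. After a hit a whole period must be
    crossed, at the price [q]; the factor [1 / (1 - q)] sums over successive hits. *)
Lemma geo_residue_le n b j : (0 < j)%N ->
  geo (r ^+ j) (fun k => res n m (b + j * k)%N) <= (1 - r ^+ j) / (1 - q).
Proof.
case: j => // j _; set x := r ^+ _.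
have x01 := expr_itv01 r01 j; have x01' := expr_itv01W r01 j.
have /andP[x0 x1] := x01.
pose Phi k := (1 - x) / (1 - q) * r ^+ hit_dist n (b + j.+1 * k).
apply: (@le_trans _ _ (Phi 0%N)); last first.
  rewrite /Phi ler_piMr ?divr_ge0 ?subr_ge0 ?(ltW x1) ?(ltW q_lt1)//.
  by rewrite exprn_ile1// ltW.
apply: geo_super => //.
- by apply: affine_growth_summable => //; exact: residue_growth0.
- by move=> k; rewrite /Phi mulr_ge0 ?divr_ge0 ?subr_ge0 ?(ltW x1) ?(ltW q_lt1)// exprn_ge0// ltW.
move=> k; rewrite /Phi residue_hit_dist mulnS (addnC j.+1) addnA.
set N := (b + _)%N; rewrite mulrCA -exprD.
have [h0|h0] := eqVneq (hit_dist n N) 0%N.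
  rewrite mulr1 h0 expr0 mulr1.
  have : r ^+ (j.+1 + hit_dist n (N + j.+1)) <= q.
    by rewrite -rq ler_wiXn2l ?(ltW r_gt0) ?(ltW r_lt1)// hit_dist0D.
  move=> H; apply: (@le_trans _ _ ((1 - x) + (1 - x) / (1 - q) * q)).
    by rewrite lerD2l ler_wpM2l// divr_ge0 ?subr_ge0 ?(ltW x1) ?(ltW q_lt1).
  by rewrite le_eqVlt; apply/orP; left; apply/eqP; by field.
rewrite mulr0 add0r ler_wpM2l ?divr_ge0 ?subr_ge0 ?(ltW x1) ?(ltW q_lt1)//.
by rewrite ler_wiXn2l ?(ltW r_gt0) ?(ltW r_lt1)// hit_distD.
Qed.

Lemma id_residue_growth n : affine_growth (fun N => N%:R * res n m N).
Proof.
apply: (affine_growth_le _ (@affine_growth_id R)) => N.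
by rewrite normrM ler_piMr// ger0_norm ?residue_le1 ?residue_ge0.
Qed.

Lemma boltzmann1_id_residue_le n b :
  boltzmann r 1 (fun N => N%:R * res n m N) b <=
  (1 - r) / (1 - q) ^+ 2 * (b%:R + d%:R).
Proof.
(* [Phi] is the exact mean: with unit steps the hits recur every [d] after the first one, and the
   series of ratio [r ^ d = q] are summed in closed form. *)
pose Phi k := (1 - r) * r ^+ hit_dist n (b + k) *
  ((b + k + hit_dist n (b + k))%N%:R / (1 - q) + d%:R * q / (1 - q) ^+ 2).
have Phi0 k : 0 <= Phi k.
  rewrite /Phi; apply: mulr_ge0.
    by rewrite mulr_ge0 ?exprn_ge0 ?(ltW r_gt0) ?(ltW r1_gt0).
  by rewrite addr_ge0// divr_ge0 ?exprn_ge0 ?(ltW q1_gt0)// mulr_ge0// ltW.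
apply: (@le_trans _ _ (Phi 0%N)); last first.
  rewrite /Phi addn0.
  apply: (@le_trans _ _ ((1 - r) * ((b%:R + d%:R) / (1 - q) + d%:R * q / (1 - q) ^+ 2))).
    apply: ler_pM.
    - by rewrite mulr_ge0 ?exprn_ge0 ?(ltW r_gt0) ?(ltW r1_gt0).
    - by rewrite addr_ge0// divr_ge0 ?exprn_ge0 ?(ltW q1_gt0)// mulr_ge0// ltW.
    - by rewrite ler_piMr ?(ltW r1_gt0)// exprn_ile1// ltW.
    - rewrite lerD2r ler_pM2r ?invr_gt0// natrD lerD2l ler_nat ltnW//.
      exact: hit_dist_lt.
  rewrite -subr_ge0 [leRHS](_ : _ = (1 - r) * q / (1 - q) ^+ 2 * b%:R); last first.
    by field.
  do ![apply: mulr_ge0]; rewrite ?invr_ge0 ?exprn_ge0 ?(ltW r1_gt0) ?(ltW q1_gt0) ?(ltW q_gt0)//.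
rewrite /= (_ : (fun k => _) = (fun k => (b + k)%N%:R * res n m (b + k)%N)); last first.
  by apply/funext => k; rewrite mul1n.
rewrite expr1; apply: geo_super => //; first by rewrite !ltW.
  have := affine_growth_summable b 1 r01 (id_residue_growth n).
  by congr geo_summable; apply/funext => k; rewrite mul1n.
move=> k; rewrite /Phi addnS; set N := (b + k)%N.
have hD := hit_distD n N 1; have hl := hit_dist_lt n N.
have hl1 := hit_dist_lt n (N + 1).
rewrite residue_hit_dist; have [h0|h0] := eqVneq (hit_dist n N) 0%N.
  have := hit_dist0D (ltn0Sn 0) h0; rewrite addn1 in hl1 *.
  move=> hd; have -> : hit_dist n N.+1 = m by lia.
  rewrite h0 expr0 !mulr1 addn0 addSn -addnS natrD.
  rewrite le_eqVlt; apply/orP; left; apply/eqP.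
  have q1n := q1_neq0; rewrite -rq exprS in q1n *; by field.
have hE : (hit_dist n N.+1).+1 = hit_dist n N.
  have := hit_distD n N 1; rewrite addn1 in hl1 *.
  have h1 := dvdn_hit_dist n N; have h2 := dvdn_hit_dist n N.+1.
  rewrite add1n leq_eqVlt => /orP[/eqP -> //|lt].
  have : (d %| (hit_dist n N.+1).+1 - hit_dist n N)%N.
    by rewrite -(dvdn_addr _ h1) -addnA subnKC ?(ltnW lt)// addnS -addSn -addnS.
  by move=> /dvdn_leq; rewrite subn_gt0 lt => /(_ isT); lia.
rewrite -hE addnS addSn (exprS r) !mulr0 add0r.
by rewrite le_eqVlt; apply/orP; left; apply/eqP; ring.
Qed.

(** [X_1] alone makes the residue event of probability [O(1 / d)], whatever the other terms are;
    those enter through their mean. *)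
Lemma boltzmann_id_residue_le n L : (0 < L)%N ->
  boltzmann r L (fun N => N%:R * res n m N) 0 <=
  (1 - r) / (1 - q) ^+ 2 * (boltzmann_mean r L + d%:R).
Proof.
move=> L0; have gid := @affine_growth_id R.
have gc : affine_growth (fun=> d%:R : R) by apply: (@affine_growth_bounded _ _ d%:R) => N; rewrite ger0_norm.
have gD := affine_growthD gid gc.
have C0 : 0 <= (1 - r) / (1 - q) ^+ 2.
  by rewrite divr_ge0 ?exprn_ge0 ?(ltW r1_gt0) ?(ltW q1_gt0).
rewrite -[X in X + d%:R]add0r -(boltzmann_id r01 L 0) -(boltzmann_cst r01 L d%:R 0).
rewrite -boltzmannD// -boltzmannZ//.
apply: (@boltzmann_from _ _ r01 1) => //; [exact: id_residue_growth|exact: affine_growthZ|].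
move=> b; apply: (le_trans (boltzmann1_id_residue_le n b)).
rewrite boltzmannZ// boltzmannD// boltzmann_id// boltzmann_cst//.
by rewrite ler_wpM2l// lerD2r lerDl boltzmann_mean_ge0.
Qed.

Lemma boltzmann_residue_ge0 n j b : 0 <= boltzmann r j (res n m) b.
Proof.
rewrite -(boltzmann_cst r01 j 0 b); apply: boltzmann_le => //.
- by apply: (@affine_growth_bounded _ _ 0) => N; rewrite normr0.
- exact: residue_growth0.
Qed.

Lemma boltzmann_residue_le n j b : (0 < j)%N ->
  boltzmann r j (res n m) b <= (1 - r) / (1 - q).
Proof.
move=> j0; rewrite -[leRHS](boltzmann_cst r01 j _ b).
apply: (@boltzmann_from _ _ r01 1) => //.
- exact: residue_growth0.
- by apply: (@affine_growth_bounded _ _ `|(1 - r) / (1 - q)|) => N.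
- move=> c; rewrite (boltzmann_cst r01) /= -[X in 1 - X]expr1.
  exact: (geo_residue_le n c (ltn0Sn 0)).
Qed.

Definition smoothness : R := 3 * (1 - r) ^+ 2 / (1 - q).

(** Two terms provide the two factors [1 - r]. Memorylessness of [X_1] turns the increment into
    [1 - r] times a hitting probability minus an indicator; averaging over [X_2] makes both of these
    [O(1 - r)]. Further terms preserve the bound. *)
Lemma boltzmann_residue_lipschitz n j b : (1 < j)%N ->
  `|boltzmann r j (res n m) b.+1 - boltzmann r j (res n m) b| <= smoothness.
Proof.
have gr := residue_growth0 n.
have sm i j' b' := boltzmann_summable r01 j' i b' gr.
have x01 j' := expr_itv01 r01 j'; have x01W j' := expr_itv01W r01 j'.
elim: j b => // j IH b; rewrite ltnS leq_eqVlt => /orP[/eqP j1|j1]; last first.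
  rewrite /= -geoB// -[leRHS](geo_cst _ (x01 j)).
  apply: geo_normr_le => //; [exact: geo_summableB|exact: geo_summable_cst|].
  by move=> k; rewrite addSn; exact: IH.
have E c : boltzmann r j (res n m) c.+1 - boltzmann r j (res n m) c =
    (1 - r) * (boltzmann r j (res n m) c.+1 - res n m c).
  rewrite -j1 [X in _ - X](boltzmann_rec r01 0 c gr) expr1 addn1 /=; ring.
have s0 : geo_summable (r ^+ j.+1) (fun k => res n m (b + j.+1 * k)%N).
  exact: affine_growth_summable.
rewrite /= -geoB//.
rewrite (_ : (fun k => _) = (fun k => (1 - r) *
  (boltzmann r j (res n m) (b.+1 + j.+1 * k)%N - res n m (b + j.+1 * k)%N))); last first.
  by apply/funext => k; rewrite addSn E.
rewrite geoZ//; last exact: geo_summableB.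
rewrite geoB// normrM gtr0_norm//.
rewrite (_ : smoothness = (1 - r) * ((1 - r) / (1 - q) + 2%:R * (1 - r) / (1 - q))); last first.
  by rewrite /smoothness; field.
rewrite ler_pM2l// (le_trans (ler_normB _ _))//; apply: lerD.
  rewrite -[leRHS](geo_cst _ (x01 j)); apply: geo_normr_le => //.
    exact: geo_summable_cst.
  by move=> k; rewrite ger0_norm ?boltzmann_residue_ge0 ?boltzmann_residue_le// -j1.
rewrite -j1 in s0 *.
rewrite ger0_norm.
  rewrite (le_trans (geo_residue_le n b (ltn0Sn 1)))//.
  by rewrite ler_pM2r ?invr_gt0 ?onem_expr_le.
rewrite -(geo_cst 0 (x01 1)); apply: geo_le => //; exact: geo_summable_cst.
Qed.

(** Exactly one of [d] consecutive integers lies in the residue class, and averaging preserves the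
    total. *)
Lemma boltzmann_residue_sum n j b :
  \sum_(i < d) boltzmann r j (res n m) (b + i) = 1.
Proof.
have gr := residue_growth0 n.
elim: j b => [|j IH] b /=.
  have iP : (hit_dist n b < d)%N by exact: hit_dist_lt.
  rewrite (bigD1 (Ordinal iP))//= big1 ?addr0 => [|i].
    by rewrite /residue addnA dvdn_hit_dist.
  rewrite -val_eqE/= => ih; rewrite /residue.
  case: (boolP (_ %| _)%N) => // dv; exfalso; move: ih => /negP; apply.
  have h1 := dvdn_hit_dist n b; have ilt := ltn_ord i.
  rewrite addnA in dv; rewrite -(modn_small ilt) -(modn_small iP).
  by rewrite -(eqn_modDl (n + b)) -/(_ == _ %[mod _])%N; move: dv h1; rewrite /dvdn => /eqP -> /eqP ->.
have H : forall l : nat, geo (r ^+ j.+1) (fun k => \sum_(i < l) boltzmann r j (res n m) (b + i + j.+1 * k)) =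
   \sum_(i < l) geo (r ^+ j.+1) (fun k => boltzmann r j (res n m) (b + i + j.+1 * k)).
  suff H l : geo_summable (r ^+ j.+1) (fun k => \sum_(i < l) boltzmann r j (res n m) (b + i + j.+1 * k)) /\ geo (r ^+ j.+1) (fun k => \sum_(i < l) boltzmann r j (res n m) (b + i + j.+1 * k)) =
   \sum_(i < l) geo (r ^+ j.+1) (fun k => boltzmann r j (res n m) (b + i + j.+1 * k)).
    by move=> l; case: (H l).
  elim: l => [|l [IHs IHl]].
    rewrite big_ord0; under eq_fun do rewrite big_ord0.
    by rewrite geo_cst ?expr_itv01//; split=> //; exact/geo_summable_cst/expr_itv01W.
  rewrite big_ord_recr /=; under eq_fun do rewrite big_ord_recr /=.
  have sl := boltzmann_summable r01 j j (b + l) gr.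
  split; first by apply: geo_summableD => //; exact: expr_itv01W.
  by rewrite geoD ?expr_itv01W// IHl.
rewrite -H -[RHS](geo_cst 1 (expr_itv01 r01 j)); congr geo; apply/funext => k.
by rewrite -[RHS](IH (b + j.+1 * k)%N); apply: eq_bigr => i _; rewrite addnAC.
Qed.

(** For a step of size [j], the factor [1 - r ^ j] is at least [q (1 - q) j / d], and the weights
    stay above [q ^ 2] during a sweep of length at most [2 d]. The roughly [d / j] points of the
    sweep compensate the factor [j / d]. *)
Definition contraction : R := q ^+ 3 * (1 - q).

(* A step of size [j] visits about [d / j] equally spaced points of each
   period with comparable probabilities. *)
Lemma geo_contract_le (v : nat -> R) (D eta : R) j b : (0 < j <= d)%N -> 0 <= D -> 0 <= eta ->
  (forall c, `|v c - 1| <= eta) ->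
  (forall c, `|v c.+1 - v c| <= D / d%:R) ->
  (forall c, \sum_(i < d) v (c + i)%N = d%:R) ->
  geo (r ^+ j) (fun k => v (b + j * k)%N) <=
    1 + (1 - contraction) * eta + 2 * ((1 - q) / q) * D * (j%:R / d%:R).
Proof.
case: j => // j; rewrite ltnS /= => jm D0 eta0 veta vD vsum.
set x := r ^+ _; have x01 := expr_itv01 r01 j; have x01' := expr_itv01W r01 j.
have /andP[x0 x1] := x01.
have d0 : 0 < d%:R :> R by rewrite ltr0n.
have d_neq0 : d%:R != 0 :> R by rewrite gt_eqF.
have j_neq0 : j.+1%:R != 0 :> R by rewrite pnatr_eq0.
(* The gap below the upper bound is nonnegative with average [eta] over a period, so its mean is
   bounded below by any initial piece of the series. *)
pose w c := 1 + eta - v c.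
have w0 c : 0 <= w c by have := veta c; rewrite ler_norml /w => /andP[]; lra.
have wle c : `|w c| <= 2 * eta by rewrite ger0_norm//; have := veta c; rewrite ler_norml /w => /andP[]; lra.
have sw : geo_summable x (fun k => w (b + j.+1 * k)%N).
  exact: (geo_summable_bounded x01 (fun k => wle _)).
have gw : geo x (fun k => w (b + j.+1 * k)%N) =
    1 + eta - geo x (fun k => v (b + j.+1 * k)%N).
  have sv : geo_summable x (fun k => v (b + j.+1 * k)%N).
    apply: (geo_summable_bounded x01 (C := 1 + eta)) => k.
    by have := veta (b + j.+1 * k)%N; rewrite !ler_norml => /andP[]; lra.
  by rewrite -{1}(geo_cst (1 + eta) x01) -geoB//; exact: geo_summable_cst.
(* [t] steps cover a full period but at most two, so the weights of the sweep stay above [q ^ 2]. *)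
pose t := (d %/ j.+1).+1.
have td : (d <= j.+1 * t)%N by rewrite mulnC ltnW// ltn_ceil.
have td2 : (j.+1 * t <= 2 * d)%N.
  by rewrite /t mulnS mul2n -addnn leq_add// mulnC leq_divM.
have wlip c i : w (c + i)%N <= w c + i%:R * (D / d%:R).
  elim: i => [|i IHi]; first by rewrite addn0 mul0r addr0.
  rewrite addnS -natr1 mulrDl mul1r addrA; apply: le_trans (lerD IHi (lexx _)).
  have := vD (c + i)%N; rewrite ler_norml /w; move: (D / d%:R) => e /andP[].
  by lra.
(* Each visited point stands for the block of [j + 1] integers starting at it. The Lipschitz bound
   on [v] controls the variation inside a block, and the blocks together cover a period. *)
have blk : d%:R * eta - 2 * j.+1%:R * D <= j.+1%:R * \sum_(k < t) w (b + j.+1 * k)%N.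
  have s1 : \sum_(i < d) w (b + i)%N = d%:R * eta.
    by rewrite /w sumrB vsum sumr_const card_ord -mulr_natl; ring.
  have s2 : \sum_(i < d) w (b + i)%N <= \sum_(i < j.+1 * t) w (b + i)%N.
    rewrite -!(big_mkord xpredT (fun i => w (b + i)%N)) (@big_cat_nat _ _ _ d 0 (j.+1 * t))//=.
    by rewrite lerDl sumr_ge0.
  have s3 (l : nat) : \sum_(i < j.+1 * l) w (b + i)%N <=
      j.+1%:R * \sum_(k < l) w (b + j.+1 * k)%N + l%:R * (j.+1%:R * (j.+1%:R * (D / d%:R))).
    elim: l => [|l IHl]; first by rewrite muln0 !big_ord0 mulr0 mul0r addr0.
    rewrite mulnSr big_split_ord /= [X in _ <= _ * X + _]big_ord_recr /=.
    rewrite -(natr1 l) (mulrDl l%:R) mul1r mulrDr.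
    rewrite addrACA; apply: lerD => //.
    apply: (@le_trans _ _ (\sum_(i < j.+1) (w (b + j.+1 * l)%N + j.+1%:R * (D / d%:R)))).
      apply: ler_sum => i _; rewrite addnA (le_trans (wlip _ _))// lerD2l.
      by rewrite ler_wpM2r ?divr_ge0// ler_nat ltnW.
    by rewrite sumr_const card_ord -[leLHS]mulr_natl mulrDr.
  rewrite lerBlDr -s1 (le_trans s2)// (le_trans (s3 t))// lerD2l.
  rewrite !mulrA ler_pdivrMr//.
  have : (j.+1 * t)%:R <= (2 * d)%:R :> R by rewrite ler_nat.
  rewrite !natrM => H.
  have := ler_wpM2r (mulr_ge0 (ler0n R j.+1) D0) H; lra.
have xt : q ^+ 2 <= x ^+ t.
  rewrite -rq -!exprM ler_wiXn2l ?(ltW r_gt0) ?(ltW r_lt1)//.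
  by rewrite (leq_trans td2)// mulnC.
have part : (1 - x) * x ^+ t * \sum_(k < t) w (b + j.+1 * k)%N <= geo x (fun k => w (b + j.+1 * k)%N).
  apply: le_trans (geo_partial_le t x01' sw (fun k => w0 _)).
  rewrite /geo_partial mulr_sumr; apply: ler_sum => k _; apply: ler_wpM2r => //.
  by rewrite ler_wpM2l ?subr_ge0 ?(ltW x1)// ler_wiXn2l ?(ltW x0) ?(ltW x1)// ltnW.
have low : (1 - x) * x ^+ t * (d%:R * eta - 2 * j.+1%:R * D) / j.+1%:R <= geo x (fun k => w (b + j.+1 * k)%N).
  apply: le_trans part; rewrite ler_pdivrMr ?ltr0n// -[leRHS]mulrA.
  apply: ler_wpM2l; first by rewrite mulr_ge0 ?subr_ge0 ?exprn_ge0 ?ltW.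
  by rewrite [leRHS]mulrC.
have x1r : j.+1%:R * q * ((1 - q) / d%:R) <= 1 - x.
  apply: le_trans (onem_expr_ge r01 j.+1).
  apply: ler_pM; rewrite ?mulr_ge0 ?divr_ge0 ?(ltW q_gt0) ?(ltW q1_gt0)//.
    by rewrite -rq ler_wpM2l// ler_wiXn2l ?(ltW r_gt0) ?(ltW r_lt1).
  by rewrite ler_pdivrMr// mulrC onem_base_ge.
have x1l : 1 - x <= j.+1%:R * ((1 - q) / q / d%:R).
  apply: (le_trans (onem_expr_le r01 j.+1)); rewrite ler_wpM2l//.
  by rewrite ler_pdivlMr// mulrC onem_base_le.
have xt1 : x ^+ t <= 1 by rewrite exprn_ile1// ltW.
have xt0 : 0 <= x ^+ t by rewrite exprn_ge0// ltW.
have h1 : contraction * eta <= (1 - x) * x ^+ t * (d%:R * eta) / j.+1%:R.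
  rewrite ler_pdivlMr ?ltr0n// /contraction.
  have : (j.+1%:R * q * ((1 - q) / d%:R)) * q ^+ 2 <= (1 - x) * x ^+ t.
    by apply: ler_pM => //; rewrite ?exprn_ge0 ?mulr_ge0 ?divr_ge0 ?(ltW q_gt0) ?(ltW q1_gt0).
  move=> /(ler_wpM2r (mulr_ge0 (ltW d0) eta0)); apply: le_trans.
  by rewrite le_eqVlt; apply/orP; left; apply/eqP; by field.
have h2 : (1 - x) * x ^+ t * (2 * j.+1%:R * D) / j.+1%:R <= 2 * ((1 - q) / q) * D * (j.+1%:R / d%:R).
  have -> : (1 - x) * x ^+ t * (2 * j.+1%:R * D) / j.+1%:R = 2 * D * ((1 - x) * x ^+ t).
    by field.
  have -> : 2 * ((1 - q) / q) * D * (j.+1%:R / d%:R) = 2 * D * (j.+1%:R * ((1 - q) / q / d%:R)).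
    by field; rewrite addrC natr1 d_neq0 q_neq0.
  rewrite ler_wpM2l ?mulr_ge0//; apply: le_trans x1l.
  by rewrite ler_piMr// subr_ge0 ltW.
move: low h1 h2; rewrite gw; set A := (1 - x) * x ^+ t.
rewrite [A * (_ - _)]mulrBr mulrBl.
move: (A * (d%:R * eta) / _) (A * (2 * _ * D) / _) (2 * _ * D * _) => a1 a2 a3.
lra.
Qed.

(* [v] plays the role of [d] times the probability of hitting the residue
   class, which has mean [1] over a period: a term of size [j] contracts the
   deviation from [1] up to an error governed by the variation of [v]. *)
Lemma geo_contract (v : nat -> R) (D eta : R) j b : (0 < j <= d)%N -> 0 <= D -> 0 <= eta ->
  (forall c, `|v c - 1| <= eta) ->
  (forall c, `|v c.+1 - v c| <= D / d%:R) ->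
  (forall c, \sum_(i < d) v (c + i)%N = d%:R) ->
  `|geo (r ^+ j) (fun k => v (b + j * k)%N) - 1| <=
    (1 - contraction) * eta + 2 * ((1 - q) / q) * D * (j%:R / d%:R).
Proof.
move=> j0 D0 eta0 veta vD vsum.
have up := geo_contract_le b j0 D0 eta0 veta vD vsum.
(* The lower bound is the upper bound for the reflection [2 - v], which satisfies the same three
   hypotheses. *)
have veta' c : `|(2 - v c) - 1| <= eta.
  by have := veta c; rewrite !ler_norml => /andP[]; lra.
have vD' c : `|(2 - v c.+1) - (2 - v c)| <= D / d%:R.
  by have := vD c; move: (D / d%:R) => e; rewrite !ler_norml => /andP[]; lra.
have vsum' c : \sum_(i < d) (2 - v (c + i)%N) = d%:R.
  by rewrite sumrB vsum sumr_const card_ord -mulr_natl; ring.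
have := geo_contract_le b j0 D0 eta0 veta' vD' vsum'.
have -> : geo (r ^+ j) (fun k => 2 - v (b + j * k)%N) = 2 - geo (r ^+ j) (fun k => v (b + j * k)%N).
  case: j j0 {up} => // j _; have x01 := expr_itv01 r01 j; have x01' := expr_itv01W r01 j.
  have sv : geo_summable (r ^+ j.+1) (fun k => v (b + j.+1 * k)%N).
    apply: (geo_summable_bounded x01 (C := 1 + eta)) => k.
    by have := veta (b + j.+1 * k)%N; rewrite !ler_norml => /andP[]; lra.
  by rewrite -[X in X - geo _ _](geo_cst _ x01) -geoB//; exact: geo_summable_cst.
move: up; move: (2 * ((1 - q) / q) * D * _) => a up lo.
by rewrite ler_norml; apply/andP; split; lra.
Qed.

End equidistribution.

(** * Asymptotic irrelevance of the residue condition *)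

Section decoupling.
Context {R : realType}.
Variables (r q : R) (m : nat).
Local Notation d := m.+1.
Hypotheses (r01 : 0 < r < 1) (rq : r ^+ d = q).
Local Notation res := (@residue R).

Let r_gt0 : 0 < r. Proof. by case/andP: r01. Qed.
Let r_lt1 : r < 1. Proof. by case/andP: r01. Qed.
Let q_gt0 : 0 < q. Proof. by rewrite -rq exprn_gt0. Qed.
Let q_lt1 : q < 1. Proof. by rewrite -rq exprn_ilt1// ltW. Qed.
Let q1_gt0 : 0 < 1 - q. Proof. by rewrite subr_gt0. Qed.
Let r1_gt0 : 0 < 1 - r. Proof. by rewrite subr_gt0. Qed.
Let q1_neq0 : 1 - q != 0. Proof. by rewrite gt_eqF. Qed.
Let q_neq0 : q != 0. Proof. by rewrite gt_eqF. Qed.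
Let d_neq0 : 1 + m%:R != 0 :> R. Proof. by rewrite addrC natr1 pnatr_eq0. Qed.
Let d_gt0 : 0 < d%:R :> R. Proof. by rewrite ltr0n. Qed.

Lemma contraction_itv01 : 0 < contraction q < 1.
Proof.
rewrite /contraction mulr_gt0 ?exprn_gt0//=.
rewrite (@le_lt_trans _ _ (1 - q))//; last by rewrite ltrBlDr ltrDl.
by rewrite ler_piMl ?(ltW q1_gt0)// exprn_ile1// ltW.
Qed.

(** The first summand is the initial deviation, at most [1 / q], contracted by all terms after the
    second; the other collects the Lipschitz errors, proportional to [j / d] for the term [j]. For
    fixed [L] only the first survives as [d] grows. *)
Definition residue_error (L : nat) : R :=
  (1 - contraction q) ^+ (L - 2) / q + L%:R ^+ 2 * (6 * (1 - q) ^+ 2 / q ^+ 3) / d%:R.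

Lemma residue_error_ge0 L : 0 <= residue_error L.
Proof.
have /andP[c0 c1] := contraction_itv01.
by rewrite /residue_error addr_ge0// !(divr_ge0, mulr_ge0, exprn_ge0)// ?subr_ge0 ?ltW.
Qed.

(** The induction starts at [L = 2], the first stage at which the hitting probabilities are known to
    be Lipschitz; there the bound [d (1 - r) <= (1 - q) / q] gives a deviation of at most
    [1 / q]. *)
Lemma boltzmann_equidistribution n L b : (1 < L <= d)%N ->
  `|d%:R * boltzmann r L (res n m) b - 1| <= residue_error L.
Proof.
have /andP[c0 c1] := contraction_itv01.
have gr := @residue_growth0 R m n.
have q1 : 1 <= q^-1 by rewrite invf_ge1 ?ltW.
elim: L b => // L IH b /andP[]; rewrite ltnS leq_eqVlt => /orP[/eqP L1|L1] Ld.
  rewrite -L1 /residue_error subnn expr0 mul1r.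
  have h1 := boltzmann_residue_ge0 m r01 n 2 b.
  have h2 := boltzmann_residue_le r01 rq n b (ltn0Sn 1).
  have h3 : d%:R * boltzmann r 2 (res n m) b <= q^-1.
    apply: (le_trans (ler_wpM2l (ltW d_gt0) h2)).
    rewrite mulrA ler_pdivrMr// [leRHS]mulrC; exact: (onem_base_le r01 rq).
  have h4 : 0 <= d%:R * boltzmann r 2 (res n m) b by rewrite mulr_ge0// ltW.
  apply: (@le_trans _ _ q^-1); first by rewrite ler_norml; lra.
  by rewrite lerDl !(divr_ge0, mulr_ge0, exprn_ge0)// ltW.
have Ld' : (1 < L <= d)%N by rewrite L1 ltnW.
(* [D] bounds [d ^ 2] times [smoothness], by [d (1 - r) <= (1 - q) / q]. *)
pose D := 3 * (1 - q) / q ^+ 2.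
have D0 : 0 <= D by rewrite !(divr_ge0, mulr_ge0, exprn_ge0)// ltW.
pose v c := d%:R * boltzmann r L (res n m) c.
have vD c : `|v c.+1 - v c| <= D / d%:R.
  rewrite /v -mulrBr normrM gtr0_norm// ler_pdivlMr// mulrC.
  have hL := boltzmann_residue_lipschitz r01 rq n c L1.
  apply: (@le_trans _ _ (d%:R * (d%:R * smoothness r q))).
    by rewrite !ler_wpM2l// ltW.
  rewrite /smoothness /D.
  have -> : d%:R * (d%:R * (3 * (1 - r) ^+ 2 / (1 - q))) = 3 / (1 - q) * (d%:R * (1 - r)) ^+ 2.
    by field; rewrite ?q1_neq0 ?q_neq0 ?d_neq0.
  have -> : 3 * (1 - q) / q ^+ 2 = 3 / (1 - q) * ((1 - q) / q) ^+ 2 by field; rewrite ?q1_neq0 ?q_neq0 ?d_neq0.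
  rewrite ler_wpM2l ?divr_ge0 ?(ltW q1_gt0)// lerXn2r ?nnegrE ?(onem_base_le r01 rq)//.
    by rewrite mulr_ge0// ltW.
  by rewrite divr_ge0// ltW.
have vsum c : \sum_(i < d) v (c + i)%N = d%:R.
  by rewrite -mulr_sumr boltzmann_residue_sum// mulr1.
have Ld2 : (0 < L.+1 <= d)%N by [].
have := geo_contract r01 rq b Ld2 D0 (residue_error_ge0 L) (fun c => IH c Ld') vD vsum.
rewrite (_ : geo _ _ = d%:R * boltzmann r L.+1 (res n m) b); last first.
  rewrite /= -geoZ//; first exact: expr_itv01W.
  exact: boltzmann_summable.
move=> H; apply: (le_trans H).
rewrite /residue_error subSn//.
rewrite (exprS (1 - contraction q)) [(1 - contraction q) * (_ + _)]mulrDr.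
rewrite [(1 - contraction q) * (_ / q)]mulrA -addrA lerD2l.
set E := 6 * _ / _; have E0 : 0 <= E by rewrite /E !(divr_ge0, mulr_ge0, exprn_ge0)// ltW.
have -> : 2 * ((1 - q) / q) * D * (L.+1%:R / d%:R) = E * L.+1%:R / d%:R.
  by rewrite /D /E; field; rewrite q_neq0 gt_eqF.
rewrite [X in X + _](_ : _ = ((1 - contraction q) * (L%:R ^+ 2 * E)) / d%:R); last by ring.
rewrite -mulrDl ler_pM2r ?invr_gt0// -natr1.
have : (1 - contraction q) * (L%:R ^+ 2 * E) <= L%:R ^+ 2 * E.
  apply: ler_piMl; last by rewrite lerBlDr lerDl ltW.
  by rewrite mulr_ge0// exprn_ge0.
have : 0 <= E * L%:R by rewrite mulr_ge0.
lra.
Qed.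

(** In units of [L d]: the first summand bounds [d] times the mean displacement restricted to the
    residue class, the second the unrestricted mean displacement by the first [L] terms. *)
Definition decoupling_const : R :=
  (q * (1 - q))^-1 * ((1 - q)^-1 + 1) + (1 - q)^-1.

(* Conditionally on the terms of index above [L], the others equidistribute
   the residue but hardly change [H]. *)
Lemma boltzmann_decouple n H B delta L j : (1 < L <= d)%N -> (L <= j)%N ->
  (forall N, `|H N| <= B) -> 0 <= delta ->
  (forall b N, `|H (b + N)%N - H b| <= delta * N%:R) ->
  `|d%:R * boltzmann r j (fun N => H N * res n m N) 0 - boltzmann r j H 0| <=
  B * residue_error L + delta * d%:R * L%:R * decoupling_const.
Proof.
move=> /andP[L1 Ld] Lj HB delta0 Hlip.
have B0 : 0 <= B by exact: le_trans (HB 0%N).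
have gH : affine_growth H by exact: affine_growth_bounded HB.
have gHr : affine_growth (fun N => H N * res n m N).
  apply: (affine_growth_le _ gH) => N.
  by rewrite normrM ler_piMr// ger0_norm ?residue_le1 ?residue_ge0.
have gdHr := affine_growthZ d%:R gHr.
set eps := (X in _ <= X).
have geps : affine_growth (fun=> eps).
  by apply: (@affine_growth_bounded _ _ `|eps|).
(* A bound for the first [L] terms from an arbitrary start [b] is enough; [boltzmann_from] carries
   both of its sides over the remaining terms. *)
suff key b : `|boltzmann r L (fun N => d%:R * (H N * res n m N)) b - boltzmann r L H b| <= eps.
  rewrite -boltzmannZ// ler_distl -[eps](boltzmann_cst r01 j eps 0).
  rewrite -boltzmannB// -boltzmannD//; apply/andP; split.
    apply: (@boltzmann_from _ _ r01 L) => //; first exact: affine_growthB.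
    move=> b; rewrite boltzmannB// boltzmann_cst//.
    by have := key b; rewrite ler_distl => /andP[].
  apply: (@boltzmann_from _ _ r01 L) => //; first exact: affine_growthD.
  move=> b; rewrite boltzmannD// boltzmann_cst//.
  by have := key b; rewrite ler_distl => /andP[].
rewrite boltzmann_shift0 [X in _ - X]boltzmann_shift0.
have resE : (fun N => res n m (b + N)%N) = res (n + b)%N m.
  by apply/funext => N; rewrite /residue addnA.
pose G N := H (b + N)%N - H b.
have gHb := affine_growth_shift b gH.
have gc : affine_growth (fun=> H b) by apply: (@affine_growth_bounded _ _ B).
have gG : affine_growth G by exact: affine_growthB.
have gr := @residue_growth0 R m (n + b)%N.
have gGr : affine_growth (fun N => G N * res (n + b)%N m N).
  apply: (affine_growth_le _ gG) => N.
  by rewrite [leLHS]normrM ler_piMr// ger0_norm ?residue_le1 ?residue_ge0.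
rewrite (_ : (fun N => d%:R * _) = (fun N => d%:R * (G N * res (n + b)%N m N) +
   d%:R * H b * res (n + b)%N m N)); last first.
  by apply/funext => N; rewrite -resE /G; ring.
rewrite (_ : (fun N => H (b + N)%N) = (fun N => G N + H b)); last first.
  by apply/funext => N; rewrite /G subrK.
rewrite boltzmannD//; [|exact: affine_growthZ|exact: affine_growthZ].
rewrite boltzmannZ// boltzmannZ// boltzmannD// boltzmann_cst//.
have -> (x y z : R) : x + d%:R * H b * y - (z + H b) = x - z + H b * (d%:R * y - 1) by ring.
have gid := @affine_growth_id R.
have gidr := @id_residue_growth R m (n + b)%N.
have Gle1 : `|boltzmann r L (fun N => G N * res (n + b)%N m N) 0| <=
    delta * ((1 - r) / (1 - q) ^+ 2 * (boltzmann_mean r L + d%:R)).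
  apply: (@le_trans _ _ (boltzmann r L (fun N => delta * (N%:R * res (n + b)%N m N)) 0)).
    apply: boltzmann_normr_le => //; first exact: affine_growthZ.
    move=> N; rewrite normrM (ger0_norm (residue_ge0 _ _ _)) mulrA.
    by apply: ler_wpM2r; [exact: residue_ge0|exact: Hlip].
  by rewrite boltzmannZ// ler_wpM2l// boltzmann_id_residue_le// ltnW.
have Gle2 : `|boltzmann r L G 0| <= delta * boltzmann_mean r L.
  rewrite -[boltzmann_mean _ _]add0r -(boltzmann_id r01 L 0) -boltzmannZ//.
  apply: boltzmann_normr_le => //; first exact: affine_growthZ.
  by move=> N; exact: Hlip.
have mL := boltzmann_mean_le r01 rq L.
have mL0 := boltzmann_mean_ge0 r01 L.
have L1d : (1 < L <= d)%N by rewrite L1 Ld.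
have eqd := boltzmann_equidistribution (n + b)%N 0 L1d.
apply: (le_trans (ler_normD _ _)).
rewrite normrM /eps [leRHS]addrC; apply: lerD; last by apply: ler_pM.
apply: (le_trans (ler_normB _ _)); rewrite normrM gtr0_norm//.
have L1R : 1 <= L%:R :> R by rewrite ler1n ltnW.
have od := onem_base_le r01 rq.
have i1 : 0 <= (1 - q)^-1 by rewrite invr_ge0 ltW.
have -> : delta * d%:R * L%:R * decoupling_const =
   delta * ((1 - q) / q * ((1 - q) ^-1 ^+ 2 * (L%:R * (d%:R / (1 - q)) + L%:R * d%:R)))
   + delta * (L%:R * (d%:R / (1 - q))).
  by rewrite /decoupling_const; field; rewrite q1_neq0.
apply: lerD; last by apply: (le_trans Gle2); rewrite ler_wpM2l.
apply: (le_trans (ler_wpM2l (ltW d_gt0) Gle1)).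
rewrite mulrCA ler_wpM2l//.
rewrite (_ : d%:R * _ = (d%:R * (1 - r)) * ((1 - q)^-1 ^+ 2 * (boltzmann_mean r L + d%:R))); last first.
  by field; rewrite ?q1_neq0 ?q_neq0 ?d_neq0.
apply: ler_pM => //.
- by rewrite mulr_ge0// ltW.
- by rewrite mulr_ge0 ?exprn_ge0// addr_ge0// ltW.
- by rewrite ler_wpM2l ?exprn_ge0// lerD// ler_peMl// ltW.
Qed.

End decoupling.

(** * Gaussian means *)

Section normal_density.
Context {R : realType}.
Local Notation mu := (@lebesgue_measure R).

(** The Radon-Nikodym derivative and [normal_pdf] are densities of the same measure, hence equal
    almost everywhere. *)
Lemma ge0_integral_normal_prob (a s : R) (f : R -> \bar R) :
  measurable_fun setT f -> (forall x, (0 <= f x)%E) ->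
  (\int[normal_prob a s]_x f x = \int[mu]_x (f x * (normal_pdf a s x)%:E))%E.
Proof.
move=> mf f0.
have dom := normal_prob_dominates a s.
rewrite -(Radon_Nikodym_SigmaFinite.change_of_variables dom)//.
apply: ae_eq_integral => //.
- apply: emeasurable_funM => //; apply: (measurable_int mu).
  exact: Radon_Nikodym_SigmaFinite.f_integrable.
- apply: emeasurable_funM => //=; apply/measurableT_comp => //=.
  exact: measurable_normal_pdf.
- apply: ae_eqe_mul2l => /=.
  apply: integral_ae_eq => //=.
  + exact: Radon_Nikodym_SigmaFinite.f_integrable.
  + by apply/measurableT_comp => //; exact: measurable_normal_pdf.
  + by move=> E _ mE; rewrite -Radon_Nikodym_SigmaFinite.f_integral.
Qed.

Lemma normal_peakE (t : R) : 0 < t ->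
  normal_peak t = t^-1 * (Num.sqrt (pi *+ 2))^-1.
Proof.
move=> t0; rewrite /normal_peak -mulrnAr sqrtrM ?sqr_ge0// sqrtr_sqr gtr0_norm//.
by rewrite invfM.
Qed.

Lemma normal_pdf_affine (a s z : R) : 0 < s ->
  normal_pdf 0 1 ((z - a) / s) / s = normal_pdf a s z.
Proof.
move=> s0; rewrite !normal_pdfE ?gt_eqF ?oner_eq0// !normal_peakE//.
rewrite invr1 mul1r mulrC mulrA; congr (_ * expR _).
have sn0 : s != 0 by rewrite gt_eqF.
rewrite subr0 expr1n expr_div_n -(mulr_natr 1) -(mulr_natr (s ^+ 2)).
by field; rewrite ?sn0.
Qed.

Lemma integral_normal_affine (a s : R) (f : R -> R) : 0 < s ->
  continuous f -> (forall x, 0 <= f x) ->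
  (\int[normal_prob a s]_x (f x)%:E = \int[normal_prob 0 1]_z (f (a + s * z))%:E)%E.
Proof.
move=> s0 cf f0.
have mf : measurable_fun setT f by exact: continuous_measurable_fun.
have cG : continuous (fun z => f (a + s * z)).
  move=> z; apply: (@continuous_comp _ _ _ (fun z => a + s * z) f); last exact: cf.
  by apply: cvgD; [exact: cvg_cst|apply: cvgMr; exact: cvg_id].
have mfE : measurable_fun [set: R] (fun x => (f x)%:E) by exact/measurable_EFinP.
have mGE : measurable_fun [set: R] (fun z => (f (a + s * z))%:E).
  by apply/measurable_EFinP; exact: continuous_measurable_fun.
rewrite (ge0_integral_normal_prob _ _ mfE) => [|x]; last by rewrite lee_fin.
rewrite (ge0_integral_normal_prob _ _ mGE) => [|x]; last by rewrite lee_fin.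
pose F := fun w : R => (w - a) / s.
have F' : F^`()%classic = cst s^-1.
  apply/funext => x; rewrite derive1E /F deriveM// deriveB// derive_cst scaler0 add0r.
  by rewrite derive_id derive_cst subr0 scaler1.
pose G := fun z => f (a + s * z) * normal_pdf 0 1 z.
under [RHS]eq_integral do rewrite -EFinM -/(G _).
rewrite (increasing_ge0_integration_by_substitutionT (F := F) (G := G)).
- apply: eq_integral => w _; rewrite -EFinM; congr EFin.
  rewrite (_ : ((G \o F) * F^`()%classic) w = G (F w) * s^-1); last by rewrite F'.
  rewrite /G /F -mulrA normal_pdf_affine// mulrCA divff ?gt_eqF//.
  by rewrite mulr1 addrC subrK.
- by move=> x y xy; rewrite /F ltr_pM2r ?invr_gt0// ltrD2r.
- by rewrite F' => ?; exact: cvg_cst.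
- by rewrite F'; exact: is_cvg_cst.
- by rewrite F'; exact: is_cvg_cst.
- by move=> x; rewrite /F; exact: ex_derive.
- by apply/gt0_cvgMlNy; [rewrite invr_gt0|exact: cvg_addrr_Ny].
- by apply/gt0_cvgMly; [rewrite invr_gt0|exact: cvg_addrr].
- move=> z; apply: cvgM; first exact: cG.
  by apply: continuous_normal_pdf; rewrite oner_eq0.
- by move=> z; rewrite /G mulr_ge0// normal_pdf_ge0.
Qed.

(** Completing the square. The joint density of [y] and [w = x + a y + b z] factors into the
    marginal of [w] and the conditional law of [y] given [w], normal with mean [a (w - x) / c ^ 2]
    and deviation [b / c]. *)
Lemma normal_pdf_convolution (x a b y w : R) : 0 < a -> 0 < b ->
  let c := Num.sqrt (a ^+ 2 + b ^+ 2) in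
  normal_pdf (x + a * y) b w * normal_pdf 0 1 y =
  normal_pdf x c w * normal_pdf (a * (w - x) / c ^+ 2) (b / c) y.
Proof.
move=> a0 b0 c.
have c2 : c ^+ 2 = a ^+ 2 + b ^+ 2 by rewrite sqr_sqrtr// addr_ge0// sqr_ge0.
have c0 : 0 < c by rewrite sqrtr_gt0 addr_gt0// exprn_gt0.
have an0 : a != 0 by rewrite gt_eqF.
have bn0 : b != 0 by rewrite gt_eqF.
have cn0 : c != 0 by rewrite gt_eqF.
have bc0 : b / c != 0 by rewrite mulf_neq0// invr_eq0.
rewrite !normal_pdfE ?oner_eq0//.
rewrite !normal_peakE ?divr_gt0//.
rewrite [LHS]mulrACA [RHS]mulrACA -!expRD; congr (_ * expR _).
  by rewrite invf_div; move: ((Num.sqrt (pi *+ 2))^-1) => p; field; rewrite ?cn0 ?bn0.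
rewrite subr0 !expr_div_n -(mulr_natr (b ^+ 2)) -(mulr_natr (1 ^+ 2)) -(mulr_natr (c ^+ 2)) -(mulr_natr (b ^+ 2 / c ^+ 2)) c2.
have c2n0 : a ^+ 2 + b ^+ 2 != 0 by rewrite -c2 expf_neq0.
by field; rewrite c2n0 bn0.
Qed.

(** After Tonelli the inner integral is that of the conditional density of [y], which is [1]; the
    marginal of [w] remains. Nonnegativity of [f] allows the exchange without integrability. *)
Lemma integral_normal_semigroup (x a b : R) (f : R -> R) : 0 < a -> 0 < b ->
  continuous f -> (forall x, 0 <= f x) ->
  (\int[normal_prob 0 1]_y \int[normal_prob 0 1]_z (f (x + a * y + b * z))%:E =
   \int[normal_prob 0 1]_z (f (x + Num.sqrt (a ^+ 2 + b ^+ 2) * z))%:E)%E.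
Proof.
move=> a0 b0 cf f0; set c := Num.sqrt _.
have c0 : 0 < c by rewrite sqrtr_gt0 addr_gt0// exprn_gt0.
have mf : measurable_fun setT f by exact: continuous_measurable_fun.
have mfE : measurable_fun [set: R] (fun x => (f x)%:E) by exact/measurable_EFinP.
rewrite -(integral_normal_affine x c0 cf f0).
pose k (y w : R) := f w * normal_pdf (x + a * y) b w.
transitivity (\int[normal_prob 0 1]_y \int[mu]_w (k y w)%:E)%E.
  apply: eq_integral => y _.
  rewrite -(integral_normal_affine (x + a * y) b0 cf f0).
  by rewrite (ge0_integral_normal_prob _ _ mfE)// => w; rewrite lee_fin.
have bn0 : b != 0 by rewrite gt_eqF.
have mk : measurable_fun [set: R * R] (fun yw : R * R => k yw.1 yw.2).
  apply: measurable_funM; first exact: measurableT_comp.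
  rewrite (_ : (fun _ => _) = (fun yw : R * R => normal_peak b *
     expR (- (yw.2 - (x + a * yw.1)) ^+ 2 / (b ^+ 2 *+ 2)))); last first.
    by apply/funext => yw; rewrite normal_pdfE.
  apply: measurable_funM => //; apply: measurableT_comp => //.
  apply: measurable_funM => //; apply: measurableT_comp => //.
  apply: measurable_funX; apply: measurable_funB => //.
  by apply: measurable_funD => //; apply: measurable_funM.
have k0 (y w : R) : (0 <= (k y w)%:E)%E.
  by rewrite lee_fin mulr_ge0// normal_pdf_ge0.
rewrite ge0_integral_normal_prob; last 2 first.
- apply: (measurable_fun_fubini_tonelli_F (m2 := mu) (fun yw : R * R => (k yw.1 yw.2)%:E)) => //.
  exact/measurable_EFinP.
- by move=> y; apply: integral_ge0 => w _.
transitivity (\int[mu]_y \int[mu]_w (k y w * normal_pdf 0 1 y)%:E)%E.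
  apply: eq_integral => y _; rewrite -ge0_integralZr//.
  - apply/measurable_EFinP; apply: measurable_funM => //.
    exact: measurable_normal_pdf.
  - by rewrite lee_fin normal_pdf_ge0.
transitivity (\int[mu]_w \int[mu]_y (k y w * normal_pdf 0 1 y)%:E)%E.
  apply: (fubini_tonelli (m1 := mu) (m2 := mu)
    (fun yw : R * R => (k yw.1 yw.2 * normal_pdf 0 1 yw.1)%:E)).
    apply/measurable_EFinP; apply: measurable_funM => //.
    by apply: measurableT_comp => //; exact: measurable_normal_pdf.
  move=> yw; rewrite lee_fin mulr_ge0 ?normal_pdf_ge0//.
  by rewrite mulr_ge0// normal_pdf_ge0.
rewrite (ge0_integral_normal_prob _ _ mfE)//.
apply: eq_integral => w _.
transitivity (\int[mu]_y ((f w * normal_pdf x c w)%:E * (normal_pdf (a * (w - x) / c ^+ 2) (b / c) y)%:E))%E.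
  apply: eq_integral => y _; rewrite -EFinM; congr EFin.
  by rewrite /k -mulrA normal_pdf_convolution// mulrA.
rewrite ge0_integralZl//.
- by rewrite integral_normal_pdf mule1 EFinM.
- by apply/measurable_EFinP; exact: measurable_normal_pdf.
- by move=> y _; rewrite lee_fin normal_pdf_ge0.
- by rewrite lee_fin mulr_ge0// normal_pdf_ge0.
Qed.

End normal_density.

(** * Moments of the standard normal law *)

Section gaussian_mean.
Context {R : realType}.
Local Notation nu := (@normal_prob R 0 1).
Implicit Types f g : R -> R.

Lemma mean_value f (df : R -> R) a b :
  (forall x : R, is_derive x (1 : R) f (df x)) ->
  exists2 c, `|c - a| <= `|b - a| & f b - f a = df c * (b - a).
Proof.
move=> fdf.
have cf u v : {within `[u, v], continuous f}.
  apply: continuous_subspaceT => x; apply/differentiable_continuous/derivable1_diffP.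
  by have [] := fdf x.
have [ab|ba] := leP a b.
  have [c] := MVT_segment ab (fun x _ => fdf x) (@cf _ _).
  rewrite in_itv/= => /andP[ac cb] E; exists c => //.
  by rewrite !ger0_norm ?subr_ge0 ?lerD2r.
have [c] := MVT_segment (ltW ba) (fun x _ => fdf x) (@cf _ _).
rewrite in_itv/= => /andP[bc ca] E; exists c; last by rewrite -opprB E; ring.
by rewrite !ler0_norm ?subr_le0 ?(ltW ba)// lerN2 lerD2r.
Qed.

Lemma expR_taylor1 (x : R) : `|expR x - 1 - x| <= x ^+ 2 * expR `|x|.
Proof.
have h (y : R) : expR y - 1 <= y * expR y.
  have := expR_ge1Dx (- y); have := expR_gt0 y => y0 H.
  have : expR y * (1 - y) <= 1.
    by rewrite -[leRHS](expRxMexpNx_1 y) ler_wpM2l// ltW.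
  lra.
have l := expR_ge1Dx x; rewrite ger0_norm; last by lra.
apply: (@le_trans _ _ (x * (expR x - 1))); first by have := h x; lra.
have [x0|x0] := leP 0 x.
  rewrite ger0_norm// expr2 -mulrA ler_wpM2l//; exact: h.
rewrite ltr0_norm// expr2 -mulrA ler_wnM2l// ?(ltW x0)//.
have e1 : 1 <= expR (- x) by rewrite -expR0 ler_expR oppr_ge0 ltW.
apply: (@le_trans _ _ x); last by lra.
by rewrite ger_nMr.
Qed.

Lemma expR_taylor2 (x : R) :
  `|expR x - 1 - x - x ^+ 2 / 2| <= `|x| ^+ 3 * expR `|x|.
Proof.
pose f (y : R) := expR y - 1 - y - y ^+ 2 / 2.
have fdf (y : R) : is_derive y (1 : R) f (expR y - 1 - y).
  by apply: is_derive_eq; rewrite /GRing.scale/=; field.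
have [c cx E] := mean_value 0 x fdf.
have -> : expR x - 1 - x - x ^+ 2 / 2 = (expR c - 1 - c) * x.
  rewrite -[X in _ = _ * X](subr0 x) -E /f expR0; by field.
rewrite !subr0 in cx; rewrite normrM exprSr mulrAC ler_wpM2r//.
apply: (le_trans (expR_taylor1 c)); rewrite -normrX (ger0_norm (sqr_ge0 x)).
rewrite -(ger0_norm (sqr_ge0 c)) -(ger0_norm (sqr_ge0 x)) !normrX.
by apply: ler_pM; rewrite ?exprn_ge0 ?expR_ge0 ?ler_expR// lerXn2r ?nnegrE.
Qed.

Lemma continuous_expRM (t : R) : continuous (fun z : R => expR (t * z)).
Proof.
move=> z; apply: (@continuous_comp _ _ _ (fun z => t * z) expR); last exact: continuous_expR.
by apply: cvgMr; exact: cvg_id.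
Qed.

(** Completing the square: [expR (t * z)] times the standard density is [expR (t ^+ 2 / 2)] times
    the density centred at [t]. *)
Lemma gauss_exp (t : R) :
  (\int[nu]_z (expR (t * z))%:E = (expR (t ^+ 2 / 2))%:E)%E.
Proof.
have ce := @continuous_expRM t.
rewrite ge0_integral_normal_prob => [||z]; last by rewrite lee_fin expR_ge0.
  transitivity (\int[lebesgue_measure]_z ((expR (t ^+ 2 / 2))%:E * (normal_pdf t 1 z)%:E))%E.
    apply: eq_integral => z _; rewrite -!EFinM; congr EFin.
    rewrite !normal_pdfE ?oner_eq0// mulrCA [RHS]mulrCA; congr (_ * _).
    rewrite /normal_fun -!expRD; congr expR.
    by rewrite expr1n -(mulr_natr 1); field.
  rewrite ge0_integralZl//.
  - by rewrite integral_normal_pdf mule1.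
  - by apply/measurable_EFinP; exact: measurable_normal_pdf.
  - by move=> z _; rewrite lee_fin normal_pdf_ge0.
by apply/measurable_EFinP; exact: continuous_measurable_fun.
Qed.

(** An envelope whose Gaussian mean is known from [gauss_exp]. The exponent [2] leaves room for the
    product of two factors [expR |z|], one absorbing a cube and one from a Taylor remainder. *)
Definition exp_bound (z : R) := expR (2 * z) + expR (- 2 * z).

Definition gauss_tame f := continuous f /\ exists C, forall z, `|f z| <= C * exp_bound z.

Lemma exp_bound_ge z : expR (2 * `|z|) <= exp_bound z.
Proof.
rewrite /exp_bound; have [z0|z0] := leP 0 z.
  by rewrite ger0_norm// lerDl expR_ge0.
by rewrite ltr0_norm// mulrN mulNr lerDr expR_ge0.
Qed.

Lemma exp_bound_ge1 z : 1 <= exp_bound z.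
Proof.
by apply: le_trans (exp_bound_ge z); rewrite -expR0 ler_expR mulr_ge0.
Qed.

Lemma integrable_expR t : nu.-integrable setT (EFin \o (fun z => expR (t * z))).
Proof.
apply/integrableP; split.
  by apply/measurable_EFinP; apply: continuous_measurable_fun; exact: continuous_expRM.
rewrite (eq_integral (fun z : measurableTypeR R => (expR (t * z))%:E)).
  by rewrite gauss_exp ltry.
by move=> z _ /=; rewrite ger0_norm ?expR_ge0.
Qed.

Lemma gauss_tame_integrable f : gauss_tame f -> nu.-integrable setT (EFin \o f).
Proof.
move=> [cf [C HC]].
have i1 := integrableD measurableT (integrable_expR 2) (integrable_expR (- 2)).
have i2 := integrableZl measurableT C i1.
apply: le_integrable i2 => //.
  by apply/measurable_EFinP; exact: continuous_measurable_fun.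
move=> z _ /=; rewrite lee_fin; apply: (le_trans (HC z)).
by rewrite /exp_bound ler_norm.
Qed.

Lemma gauss_tameD f g : gauss_tame f -> gauss_tame g ->
  gauss_tame (fun z => f z + g z).
Proof.
move=> [cf [C HC]] [cg [D HD]]; split.
  by move=> z; apply: cvgD; [exact: cf|exact: cg].
exists (C + D) => z; rewrite mulrDl (le_trans (ler_normD _ _))//.
exact: lerD.
Qed.

Lemma gauss_tameZ f c : gauss_tame f -> gauss_tame (fun z => c * f z).
Proof.
move=> [cf [C HC]]; split.
  by move=> z; apply: cvgMr; exact: cf.
by exists (`|c| * C) => z; rewrite normrM -mulrA ler_wpM2l.
Qed.

Lemma gauss_tame_bounded f B : continuous f -> (forall z, `|f z| <= B) -> gauss_tame f.
Proof.
move=> cf HB; split => //; exists B => z; rewrite (le_trans (HB z))//.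
by rewrite ler_peMr ?exp_bound_ge1// (le_trans _ (HB 0)).
Qed.

Lemma gauss_tame_cst c : gauss_tame (fun=> c).
Proof. by apply: (@gauss_tame_bounded _ `|c|) => // z; exact: cvg_cst. Qed.

Lemma norm_le_expR (z : R) : `|z| <= expR `|z|.
Proof. by have := expR_ge1Dx `|z|; lra. Qed.

Lemma cube_le_expR (z : R) : `|z| ^+ 3 <= 27 * expR `|z|.
Proof.
have -> : expR `|z| = expR (`|z| / 3) ^+ 3.
  by rewrite -expRM_natl; congr expR; field.
have -> : 27 = 3 ^+ 3 :> R by ring.
rewrite -exprMn lerXn2r ?nnegrE ?mulr_ge0 ?expR_ge0//.
by have := expR_ge1Dx (`|z| / 3); lra.
Qed.

Lemma expR_le_bound (z : R) : expR `|z| <= exp_bound z.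
Proof.
apply: le_trans (exp_bound_ge z); rewrite ler_expR ler_peMl//.
by rewrite ler1n.
Qed.

Lemma gauss_tame_id : gauss_tame id.
Proof.
split; first by move=> z; exact: cvg_id.
exists 1 => z; rewrite mul1r (le_trans (norm_le_expR z))// expR_le_bound//.
Qed.

Lemma gauss_tame_cube : gauss_tame (fun z => `|z| ^+ 3).
Proof.
split.
  move=> z; apply: (@continuous_comp _ _ _ (fun z : R => `|z|) (fun z => z ^+ 3)).
    exact: norm_continuous.
  exact: exprn_continuous.
exists 27 => z; rewrite ger0_norm ?exprn_ge0//.
by rewrite (le_trans (cube_le_expR z))// ler_wpM2l// expR_le_bound.
Qed.

Lemma gauss_tame_sqr : gauss_tame (fun z => z ^+ 2).
Proof.
split; first by move=> z; exact: exprn_continuous.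
exists 28 => z; rewrite ger0_norm ?sqr_ge0//.
apply: (@le_trans _ _ (1 + `|z| ^+ 3)).
  have n0 := normr_ge0 z; rewrite -(ger0_norm (sqr_ge0 z)) normrX.
  have [z1|z1] := leP `|z| 1.
    by rewrite (@le_trans _ _ 1) ?exprn_ile1// lerDl exprn_ge0.
  by rewrite (@le_trans _ _ (`|z| ^+ 3)) ?lerDr// ler_weXn2l// ltW.
have := cube_le_expR z; have := expR_le_bound z; have := exp_bound_ge1 z.
lra.
Qed.

Lemma gauss_tame_norm : gauss_tame (fun z => `|z|).
Proof.
split; first exact: norm_continuous.
exists 1 => z; rewrite mul1r normr_id (le_trans (norm_le_expR z))// expR_le_bound//.
Qed.

Definition gauss_mean f := \int[nu]_z f z.

Lemma gauss_meanD f g : gauss_tame f -> gauss_tame g ->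
  gauss_mean (fun z => f z + g z) = gauss_mean f + gauss_mean g.
Proof.
by move=> /gauss_tame_integrable i1 /gauss_tame_integrable i2; exact: RintegralD.
Qed.

Lemma gauss_meanZ f c : gauss_tame f ->
  gauss_mean (fun z => c * f z) = c * gauss_mean f.
Proof. by move=> /gauss_tame_integrable i1; exact: RintegralZl. Qed.

Lemma gauss_mean_cst c : gauss_mean (fun=> c) = c.
Proof.
rewrite /gauss_mean Rintegral_cst//.
by rewrite [X in fine X](_ : _ = 1%E) ?mulr1//; exact: probability_setT.
Qed.

Lemma gauss_mean_le f g : gauss_tame f -> gauss_tame g -> (forall z, f z <= g z) ->
  gauss_mean f <= gauss_mean g.
Proof.
move=> /gauss_tame_integrable i1 /gauss_tame_integrable i2 fg.
by apply: le_Rintegral.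
Qed.

Lemma gauss_mean_normr_le f g : gauss_tame f -> gauss_tame g ->
  (forall z, `|f z| <= g z) -> `|gauss_mean f| <= gauss_mean g.
Proof.
move=> tf tg fg; rewrite ler_norml; apply/andP; split.
  rewrite -mulN1r -gauss_meanZ//; apply: gauss_mean_le => //; first exact: gauss_tameZ.
  by move=> z; rewrite mulN1r; have := fg z; rewrite ler_norml => /andP[].
by apply: gauss_mean_le => // z; rewrite (le_trans (ler_norm _)).
Qed.

Lemma gauss_mean_exp t : gauss_mean (fun z => expR (t * z)) = expR (t ^+ 2 / 2).
Proof. by rewrite /gauss_mean /Rintegral gauss_exp. Qed.

Lemma gauss_tame_exp t : `|t| <= 1 -> gauss_tame (fun z => expR (t * z)).
Proof.
move=> t1; split; first exact: continuous_expRM.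
exists 1 => z; rewrite mul1r ger0_norm ?expR_ge0//.
apply: le_trans (expR_le_bound z); rewrite ler_expR (le_trans (ler_norm _))//.
by rewrite normrM ler_piMl.
Qed.

(** The first two moments are read off from the moment generating function: both [expR (t * z)]
    under the mean and [expR (t ^+ 2 / 2)] are expanded at [t = 0] up to cubic error, and the
    coefficients are compared. *)
Lemma gauss_moment_expansion : exists K, forall t : R, `|t| <= 1 ->
  `|t * gauss_mean id + t ^+ 2 / 2 * (gauss_mean (fun z => z ^+ 2) - 1)|
    <= K * `|t| ^+ 3.
Proof.
have tB : gauss_tame exp_bound.
  split; last by exists 1 => z; rewrite mul1r ger0_norm// (le_trans _ (exp_bound_ge1 z)).
  by move=> z; apply: cvgD; exact: continuous_expRM.
exists (27 * gauss_mean exp_bound + expR 1) => t t1.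
have te := gauss_tame_exp t1; have tid := gauss_tame_id; have tsq := gauss_tame_sqr.
pose rem z := expR (t * z) - 1 - t * z - (t * z) ^+ 2 / 2.
have remE : rem = (fun z => (expR (t * z) + -1) + ((- t) * z + (- (t ^+ 2 / 2)) * z ^+ 2)).
  by apply/funext => z; rewrite /rem; field.
have ta := gauss_tameD te (gauss_tame_cst (-1)).
have tb := gauss_tameD (gauss_tameZ (- t) tid) (gauss_tameZ (- (t ^+ 2 / 2)) tsq).
have trem : gauss_tame rem by rewrite remE; exact: gauss_tameD.
have Erem : gauss_mean rem = expR (t ^+ 2 / 2) - 1 - t * gauss_mean id
    - t ^+ 2 / 2 * gauss_mean (fun z => z ^+ 2).
  rewrite remE gauss_meanD// gauss_meanD//; last exact: gauss_tame_cst.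
  rewrite gauss_meanD; [|exact: gauss_tameZ|exact: gauss_tameZ].
  by rewrite gauss_mean_exp gauss_mean_cst !gauss_meanZ//; ring.
have remB z : `|rem z| <= (`|t| ^+ 3 * 27) * exp_bound z.
  apply: (le_trans (expR_taylor2 _)); rewrite normrM exprMn.
  rewrite -(mulrA (`|t| ^+ 3) (`|z| ^+ 3)) -(mulrA (`|t| ^+ 3) 27).
  rewrite ler_wpM2l ?exprn_ge0//.
  apply: (@le_trans _ _ ((27 * expR `|z|) * expR `|z|)).
    apply: ler_pM; rewrite ?exprn_ge0 ?expR_ge0 ?cube_le_expR//.
    by rewrite ler_expR ler_piMl.
  rewrite -mulrA -expRD ler_wpM2l// (le_trans _ (exp_bound_ge z))//.
  by rewrite ler_expR; lra.
have := gauss_mean_normr_le trem (gauss_tameZ _ tB) remB.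
rewrite gauss_meanZ// Erem => H1.
have H2 := expR_taylor1 (t ^+ 2 / 2).
have sq0 := sqr_ge0 t.
have H3 : (t ^+ 2 / 2) ^+ 2 * expR `|t ^+ 2 / 2| <= `|t| ^+ 3 * expR 1.
  have tt : t ^+ 2 = `|t| ^+ 2 by rewrite -normrX ger0_norm.
  have tsq1 : t ^+ 2 <= 1 by rewrite tt exprn_ile1.
  apply: ler_pM; rewrite ?sqr_ge0 ?expR_ge0//; last first.
    by rewrite ler_expR ger0_norm; lra.
  rewrite tt exprMn -exprM.
  apply: (@le_trans _ _ (`|t| ^+ 4)).
    by rewrite ler_piMr ?exprn_ge0// exprn_ile1//; lra.
  by rewrite ler_wiXn2l.
have := le_trans H2 H3.
move: H1; move: (expR (t ^+ 2 / 2)) (t * gauss_mean id) (t ^+ 2 / 2)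
  (gauss_mean (fun z => z ^+ 2)) (gauss_mean exp_bound) (expR 1)
  (`|t| ^+ 3) => A a b c g e1 P.
have -> : b * (c - 1) = b * c - b by ring.
move: (b * c) => d; rewrite !ler_norml => /andP[h1 h2] /andP[h3 h4].
by rewrite !mulrDl; apply/andP; split; lra.
Qed.

Lemma gauss_mean_sqr : gauss_mean (fun z => z ^+ 2) = 1.
Proof.
have [K HK] := gauss_moment_expansion.
apply/eqP; rewrite -subr_eq0; set D := _ - _; set m1 := gauss_mean id in HK.
have K0 : 0 <= K.
  by have := HK 1; rewrite normr1 !expr1n !mulr1 => /(_ (lexx _)); exact: le_trans.
have HD t : 0 < t <= 1 -> `|D| <= 2 * K * t.
  move=> /andP[t0 t1].
  have tn : `|t| = t by rewrite gtr0_norm.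
  (* Adding the bounds at [t] and [- t] cancels the first moment and leaves [t ^ 2 D]. *)
  have := HK t; have := HK (- t).
  rewrite normrN tn => /(_ t1) h1 /(_ t1) h2.
  have := lerD h1 h2; rewrite -/D sqrrN => h.
  have {h} := le_trans (ler_normD _ _) h.
  rewrite [X in `|X|](_ : _ = t ^+ 2 * D); last by field.
  rewrite normrM gtr0_norm ?exprn_gt0//.
  rewrite (_ : _ + _ = t ^+ 2 * (2 * K * t)); last by ring.
  by rewrite ler_pM2l// exprn_gt0.
rewrite -normr_le0 leNgt; apply/negP => D0.
pose t := Num.min 1 (`|D| / (4 * K + 1)).
have d0 : 0 < 4 * K + 1 by lra.
have t0 : 0 < t <= 1 by rewrite /t lt_min ltr01 divr_gt0//= ge_min lexx.
have := HD _ t0; rewrite leNgt => /negP; apply.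
apply: (@le_lt_trans _ _ (2 * K * (`|D| / (4 * K + 1)))).
  by rewrite ler_wpM2l ?mulr_ge0// /t ge_min lexx orbT.
by rewrite mulrA ltr_pdivrMr//; nra.
Qed.

Lemma gauss_mean_id : gauss_mean id = 0.
Proof.
have [K HK] := gauss_moment_expansion; rewrite gauss_mean_sqr subrr in HK.
apply/eqP; set m1 := gauss_mean id in HK *.
have K0 : 0 <= K.
  by have := HK 1; rewrite normr1 !expr1n !mulr1 => /(_ (lexx _)); exact: le_trans.
have HD t : 0 < t <= 1 -> `|m1| <= K * t.
  move=> /andP[t0 t1]; have tn : `|t| = t by rewrite gtr0_norm.
  have := HK t; rewrite tn => /(_ t1).
  rewrite mulr0 addr0 normrM tn => h.
  have t11 : t ^+ 2 <= t by rewrite expr2 ler_piMr// ltW.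
  rewrite -(ler_pM2l t0) (le_trans h)// (_ : K * t ^+ 3 = t * (K * t ^+ 2)); last by ring.
  by rewrite !ler_wpM2l// ltW.
rewrite -normr_le0 leNgt; apply/negP => D0.
pose t := Num.min 1 (`|m1| / (2 * K + 1)).
have d0 : 0 < 2 * K + 1 by lra.
have t0 : 0 < t <= 1 by rewrite /t lt_min ltr01 divr_gt0//= ge_min lexx.
have := HD _ t0; rewrite leNgt => /negP; apply.
apply: (@le_lt_trans _ _ (K * (`|m1| / (2 * K + 1)))).
  by rewrite ler_wpM2l// /t ge_min lexx orbT.
by rewrite mulrA ltr_pdivrMr//; nra.
Qed.

End gaussian_mean.

(** * Lindeberg replacement *)

Section lindeberg.
Context {R : realType}.
Implicit Types f h v : R -> R.

Definition gauss (s : R) f (x : R) : R := gauss_mean (fun z => f (x + s * z)).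

(** Smoothness is stated as a Taylor bound because in this form it passes under the Gaussian mean
    with the same constant, without differentiating an integral. *)
Definition taylor2 (K : R) h h1 h2 := forall x y,
  `|h (x + y) - h x - y * h1 x - y ^+ 2 / 2 * h2 x| <= K * `|y| ^+ 3.

Lemma gauss_tame_affine f B (x s : R) : continuous f -> (forall z, `|f z| <= B) ->
  gauss_tame (fun z => f (x + s * z)).
Proof.
move=> cf fB; apply: (@gauss_tame_bounded _ _ B) => // z.
apply: (@continuous_comp _ _ _ (fun z => x + s * z) f); last exact: cf.
by apply: cvgD; [exact: cvg_cst|apply: cvgMr; exact: cvg_id].
Qed.

Lemma lipschitz_continuous f L : (forall x y, `|f x - f y| <= L * `|x - y|) ->
  continuous f.
Proof.
move=> fL x; apply/cvgrPdist_lt => e e0; near=> y.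
apply: (le_lt_trans (fL _ _)).
have L1 : 0 < `|L| + 1 by rewrite ltr_wpDl.
apply: (@le_lt_trans _ _ ((`|L| + 1) * `|x - y|)).
  by rewrite ler_wpM2r// (le_trans (ler_norm _))// lerDl.
rewrite mulrC -ltr_pdivlMr//; near: y.
by apply: cvgr_dist_lt; [exact: cvg_id|rewrite divr_gt0].
Unshelve. all: by end_near. Qed.

Lemma gauss0 f x : gauss 0 f x = f x.
Proof.
rewrite /gauss -[RHS]gauss_mean_cst; congr gauss_mean; apply/funext => z.
by rewrite mul0r addr0.
Qed.

Variables (h h1 h2 : R -> R) (B L K : R).
Hypotheses (ch : continuous h) (ch1 : continuous h1) (ch2 : continuous h2).
Hypotheses (hB : forall x, `|h x| <= B) (h1B : forall x, `|h1 x| <= B)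
  (h2B : forall x, `|h2 x| <= B).
Hypothesis (hL : forall x y, `|h x - h y| <= L * `|x - y|).
Hypothesis hK : taylor2 K h h1 h2.

Let B0 : 0 <= B. Proof. exact: le_trans (hB 0). Qed.
Let L0 : 0 <= L.
Proof. by have := hL 1 0; rewrite subr0 normr1 mulr1; exact: le_trans. Qed.
Let K0 : 0 <= K.
Proof. by have := hK 0 1; rewrite normr1 !expr1n !mulr1; exact: le_trans. Qed.

Lemma gauss_bounded s f x : continuous f -> (forall x, `|f x| <= B) ->
  `|gauss s f x| <= B.
Proof.
move=> cf fB; rewrite -(gauss_mean_cst B); apply: gauss_mean_normr_le => //.
  exact: gauss_tame_affine fB.
exact: gauss_tame_cst.
Qed.

Lemma gaussB s f g x y : continuous f -> (forall x, `|f x| <= B) ->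
  continuous g -> (forall x, `|g x| <= B) ->
  gauss_mean (fun z => f (x + s * z) - g (y + s * z)) = gauss s f x - gauss s g y.
Proof.
move=> cf fB cg gB; have tf := gauss_tame_affine x s cf fB.
have tg := gauss_tame_affine y s cg gB.
rewrite /gauss -[X in _ - X]mul1r -mulNr -gauss_meanZ// -gauss_meanD//; last exact: gauss_tameZ.
by congr gauss_mean; apply/funext => z; rewrite mulN1r.
Qed.

Lemma gauss_lipschitz s x y : `|gauss s h x - gauss s h y| <= L * `|x - y|.
Proof.
rewrite -gaussB// -(gauss_mean_cst (L * `|x - y|)).
apply: gauss_mean_normr_le; last 2 first.
- exact: gauss_tame_cst.
- by move=> z; rewrite (le_trans (hL _ _))// (_ : _ - _ = x - y); last by ring.
have t1 := gauss_tame_affine x s ch hB.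
have t2 := gauss_tameZ (-1) (gauss_tame_affine y s ch hB).
by have := gauss_tameD t1 t2; congr gauss_tame; apply/funext => z; rewrite mulN1r.
Qed.

Lemma gauss_taylor2 s : taylor2 K (gauss s h) (gauss s h1) (gauss s h2).
Proof.
move=> x y.
have t0 := gauss_tame_affine (x + y) s ch hB.
have t1 := gauss_tame_affine x s ch hB.
have t2 := gauss_tame_affine x s ch1 h1B.
have t3 := gauss_tame_affine x s ch2 h2B.
have t1' := gauss_tameZ (-1) t1.
have t2' := gauss_tameZ (- y) t2.
have t3' := gauss_tameZ (- (y ^+ 2 / 2)) t3.
have t01 := gauss_tameD t0 t1'.
have t23 := gauss_tameD t2' t3'.
have tt := gauss_tameD t01 t23.
pose F z := (h (x + y + s * z) + -1 * h (x + s * z)) +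
   (- y * h1 (x + s * z) + - (y ^+ 2 / 2) * h2 (x + s * z)).
have -> : gauss s h (x + y) - gauss s h x - y * gauss s h1 x - y ^+ 2 / 2 * gauss s h2 x
    = gauss_mean F.
  by rewrite /F gauss_meanD// gauss_meanD// gauss_meanD// !gauss_meanZ// /gauss; ring.
rewrite -(gauss_mean_cst (K * `|y| ^+ 3)); apply: gauss_mean_normr_le => //.
  exact: gauss_tame_cst.
move=> z; apply: le_trans (hK (x + s * z) y); rewrite le_eqVlt; apply/orP; left.
by apply/eqP; congr (`|_|); rewrite /F (addrAC x y); ring.
Qed.

Lemma gauss_semigroup a b x : 0 <= a -> 0 < b ->
  gauss b (gauss a h) x = gauss (Num.sqrt (a ^+ 2 + b ^+ 2)) h x.
Proof.
(* For [a = 0] nothing has been smoothed yet: this is the start of the replacement. *)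
rewrite le_eqVlt => /predU1P[<-|a0] b0.
  rewrite expr0n add0r sqrtr_sqr gtr0_norm//.
  by rewrite /gauss; congr gauss_mean; apply/funext => z; rewrite -/(gauss 0 h _) gauss0.
(* Adding the bound makes the function nonnegative, as Tonelli requires; the constant is removed at
   the end. *)
pose f x := h x + B.
have cf : continuous f by move=> y; apply: cvgD; [exact: ch|exact: cvg_cst].
have f0 y : 0 <= f y by have := hB y; rewrite /f ler_norml => /andP[]; lra.
have fB y : `|f y| <= B + B.
  by rewrite (le_trans (ler_normD _ _))// lerD// ger0_norm.
have gf s y : gauss s f y = gauss s h y + B.
  by rewrite /gauss gauss_meanD ?gauss_mean_cst//;
    [exact: gauss_tame_affine hB|exact: gauss_tame_cst].
have cg : continuous (gauss a h).
  by apply: (@lipschitz_continuous _ L) => u v; exact: gauss_lipschitz.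
have gE s y : (\int[normal_prob 0 1]_z (f (y + s * z))%:E = (gauss s f y)%:E)%E.
  rewrite /gauss /gauss_mean /Rintegral fineK//.
  apply: integrable_fin_num => //; apply: gauss_tame_integrable.
  exact: gauss_tame_affine fB.
suff : gauss b (gauss a f) x = gauss (Num.sqrt (a ^+ 2 + b ^+ 2)) f x.
  rewrite gf (_ : gauss a f = fun y => gauss a h y + B); last by apply/funext => y.
  rewrite {1}/gauss gauss_meanD ?gauss_mean_cst//; last 2 first.
  - by apply: (gauss_tame_affine x b cg (B := B)) => y; exact: gauss_bounded.
  - exact: gauss_tame_cst.
  exact: addIr.
apply: EFin_inj; rewrite -gE (addrC (a ^+ 2)) -integral_normal_semigroup//.
under [RHS]eq_integral do rewrite gE.
rewrite /gauss /gauss_mean [LHS]/= {1}/Rintegral fineK//.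
apply: integrable_fin_num => //; apply: gauss_tame_integrable.
apply: (gauss_tame_affine x b (f := gauss a f) (B := B + B)); last first.
  by move=> y; rewrite gf (le_trans (ler_normD _ _))// lerD ?gauss_bounded// ger0_norm.
rewrite (_ : gauss a f = fun y => gauss a h y + B); last by apply/funext => y.
by move=> y; apply: cvgD; [exact: cg|exact: cvg_cst].
Qed.

Definition gauss_cube : R := gauss_mean (fun z => `|z| ^+ 3).

Lemma gauss_cube_ge0 : 0 <= gauss_cube.
Proof.
rewrite -(gauss_mean_cst 0); apply: gauss_mean_le.
- exact: gauss_tame_cst.
- exact: gauss_tame_cube.
- by move=> z; rewrite exprn_ge0.
Qed.

Lemma gauss_step a s x : 0 <= s ->
  `|gauss s (gauss a h) x - gauss a h x - s ^+ 2 / 2 * gauss a h2 x|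
    <= K * gauss_cube * s ^+ 3.
Proof.
move=> s0; set v := gauss a h; set v1 := gauss a h1; set v2 := gauss a h2.
have cv : continuous v.
  by apply: (@lipschitz_continuous _ L) => u w; exact: gauss_lipschitz.
have vB y : `|v y| <= B by exact: gauss_bounded.
have tv := gauss_tame_affine x s cv vB.
have tid := @gauss_tame_id R; have tsq := @gauss_tame_sqr R; have t3 := @gauss_tame_cube R.
have t1 := gauss_tameZ (- (s * v1 x)) tid.
have t2 := gauss_tameZ (- (s ^+ 2 / 2 * v2 x)) tsq.
have tc := gauss_tame_cst (- v x).
have ta := gauss_tameD tv tc; have tb := gauss_tameD t1 t2.
pose F z := (v (x + s * z) + - v x) +
   (- (s * v1 x) * z + - (s ^+ 2 / 2 * v2 x) * z ^+ 2).
have -> : gauss s v x - v x - s ^+ 2 / 2 * v2 x = gauss_mean F.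
  rewrite /F gauss_meanD// gauss_meanD// gauss_meanD// !gauss_meanZ//.
  by rewrite gauss_mean_id gauss_mean_sqr gauss_mean_cst /gauss; ring.
rewrite (_ : K * gauss_cube * s ^+ 3 = (K * s ^+ 3) * gauss_cube); last by ring.
rewrite -gauss_meanZ//; apply: gauss_mean_normr_le => //.
- exact: gauss_tameD.
- exact: gauss_tameZ.
move=> z; have := gauss_taylor2 a x (s * z).
have -> : K * `|s * z| ^+ 3 = K * s ^+ 3 * `|z| ^+ 3.
  by rewrite normrM exprMn (ger0_norm s0) mulrA.
apply: le_trans.
rewrite le_eqVlt; apply/orP; left; apply/eqP; congr (`|_|).
by rewrite /F -/v -/v1 -/v2 exprMn; ring.
Qed.

(** A centred geometric step and a Gaussian step of equal variance share the second-order term, so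
    their difference is cubic. The constant [7] is [6] for the third moment plus [1] for the cube of
    the mean. *)
Lemma geo_step a x t y : 0 < x < 1 -> 0 <= t ->
  `|geo x (fun k => gauss a h (y + t * (k%:R - x / (1 - x)))) - gauss a h y
     - (t ^+ 2 * (x / (1 - x) ^+ 2)) / 2 * gauss a h2 y|
    <= K * 7 * (t / (1 - x)) ^+ 3.
Proof.
move=> x01 t0; set v := gauss a h; set v1 := gauss a h1; set v2 := gauss a h2.
have /andP[x0 x1] := x01; have x01W : 0 <= x <= 1 by rewrite !ltW.
have xn0 : 1 - x != 0 by rewrite subr_eq0 gt_eqF.
set mu := x / (1 - x).
have mu0 : 0 <= mu by rewrite /mu divr_ge0 ?subr_ge0 ?ltW.
have vB z : `|v z| <= B by exact: gauss_bounded.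
have sv : geo_summable x (fun k => v (y + t * (k%:R - mu))).
  exact: (geo_summable_bounded x01 (fun k => vB _)).
have s1 := geo_summable_id x01; have s2 := geo_summable_sqr x01.
have s3 := geo_summable_cube x01.
have sc c := geo_summable_cst c x01W.
pose c0 := - v y + t * mu * v1 y - t ^+ 2 / 2 * v2 y * mu ^+ 2.
pose c1 := - (t * v1 y) + t ^+ 2 * v2 y * mu.
pose c2 := - (t ^+ 2 / 2 * v2 y).
have sa := geo_summableD x01W sv (sc c0).
have sb1 := geo_summableZ c1 x01W s1; have sb2 := geo_summableZ c2 x01W s2.
have sb := geo_summableD x01W sb1 sb2.
pose F k := (v (y + t * (k%:R - mu)) + c0) + (c1 * k%:R + c2 * k%:R ^+ 2).
have -> : geo x (fun k => v (y + t * (k%:R - mu))) - v y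
     - (t ^+ 2 * (x / (1 - x) ^+ 2)) / 2 * v2 y = geo x F.
  rewrite /F (geoD x01W sa sb) (geoD x01W sv (sc c0)) (geoD x01W sb1 sb2).
  rewrite (geoZ c1 x01W s1) (geoZ c2 x01W s2) geo_cst// geo_id// geo_sqr//.
  by rewrite /c0 /c1 /c2 /mu; field.
have sd := geo_summableD x01W s3 (sc (mu ^+ 3)).
have KT0 : 0 <= K * t ^+ 3 by rewrite mulr_ge0// exprn_ge0.
apply: (@le_trans _ _ (geo x (fun k => K * t ^+ 3 * (k%:R ^+ 3 + mu ^+ 3)))).
  apply: geo_normr_le => //; [exact: geo_summableD|exact: geo_summableZ|].
  move=> k; have := gauss_taylor2 a y (t * (k%:R - mu)).
  have -> : K * `|t * (k%:R - mu)| ^+ 3 = K * t ^+ 3 * `|k%:R - mu| ^+ 3.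
    by rewrite normrM exprMn (ger0_norm t0) mulrA.
  move=> H.
  apply: (@le_trans _ _ (K * t ^+ 3 * `|k%:R - mu| ^+ 3)).
    apply: le_trans H; rewrite le_eqVlt; apply/orP; left; apply/eqP; congr (`|_|).
    by rewrite /F -/v -/v1 -/v2 exprMn /c0 /c1 /c2; field.
  rewrite ler_wpM2l//.
  have [km|mk] := leP k%:R mu.
    rewrite ler0_norm ?subr_le0// opprB.
    rewrite (@le_trans _ _ (mu ^+ 3)) ?lerDr ?exprn_ge0//.
    by rewrite lerXn2r ?nnegrE ?subr_ge0// gerBl.
  rewrite gtr0_norm ?subr_gt0// (@le_trans _ _ (k%:R ^+ 3)) ?lerDl ?exprn_ge0//.
  by rewrite lerXn2r ?nnegrE ?subr_ge0 ?gerBl// ltW.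
rewrite geoZ// geoD// geo_cst//.
rewrite (_ : K * 7 * (t / (1 - x)) ^+ 3 = K * t ^+ 3 * (6 / (1 - x) ^+ 3 + 1 / (1 - x) ^+ 3)); last first.
  by field.
rewrite ler_wpM2l// lerD ?geo_cube_le// /mu expr_div_n ler_pM2r ?exprn_ile1 ?ltW//.
by rewrite invr_gt0 exprn_gt0// subr_gt0.
Qed.

Variables (r s : R).
Hypotheses (r01 : 0 < r < 1) (s0 : 0 < s).

(** The standard deviation of the scaled term of index [j + 1], namely [(j + 1) X / s] with [X]
    geometric of parameter [r ^ (j + 1)]. *)
Definition boltzmann_std j : R := j.+1%:R / s * (Num.sqrt (r ^+ j.+1) / (1 - r ^+ j.+1)).

Definition boltzmann_var j : R := \sum_(i < j) boltzmann_std i ^+ 2.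

Lemma boltzmann_std_gt0 j : 0 < boltzmann_std j.
Proof.
have /andP[x0 x1] := expr_itv01 r01 j.
by rewrite /boltzmann_std mulr_gt0// divr_gt0 ?sqrtr_gt0 ?subr_gt0.
Qed.

Lemma boltzmann_stdE j : boltzmann_std j ^+ 2 =
  (j.+1%:R / s) ^+ 2 * (r ^+ j.+1 / (1 - r ^+ j.+1) ^+ 2).
Proof.
have /andP[x0 x1] := expr_itv01 r01 j.
by rewrite /boltzmann_std exprMn (expr_div_n (Num.sqrt _)) sqr_sqrtr// ltW.
Qed.

Lemma boltzmann_std_le j : boltzmann_std j <= j.+1%:R / s / (1 - r ^+ j.+1).
Proof.
have /andP[x0 x1] := expr_itv01 r01 j.
rewrite /boltzmann_std mulrA ler_pM2r ?invr_gt0 ?subr_gt0//.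
rewrite ler_piMr ?divr_ge0 ?(ltW s0)//.
by rewrite -[leRHS]sqrtr1 ler_wsqrtr// ltW.
Qed.

Lemma boltzmann_var_ge0 j : 0 <= boltzmann_var j.
Proof. by apply: sumr_ge0 => i _; rewrite sqr_ge0. Qed.

(* The geometric terms are replaced one at a time; by the semigroup property
   the Gaussian factors already introduced merge into one smoothing [gauss]. *)
Lemma boltzmann_lindeberg j b c :
  `|boltzmann r j (fun N => h ((N%:R + c) / s)) b -
    gauss (Num.sqrt (boltzmann_var j)) h ((b%:R + c + boltzmann_mean r j) / s)|
  <= \sum_(i < j) K * (7 + gauss_cube) * (i.+1%:R / s / (1 - r ^+ i.+1)) ^+ 3.
Proof.
elim: j b => [|j IH] b /=.
  by rewrite /boltzmann_var /boltzmann_mean !big_ord0 sqrtr0 gauss0 addr0 subrr normr0.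
have x01 := expr_itv01 r01 j; have x01W := expr_itv01W r01 j.
set x := r ^+ j.+1 in x01 x01W *; have /andP[x0 x1] := x01.
rewrite /boltzmann_mean /boltzmann_var !big_ord_recr /= -/(boltzmann_var j) -/(boltzmann_mean r j).
set mj := boltzmann_mean r j; set V := boltzmann_var j; set sg := boltzmann_std j.
have V0 : 0 <= V by exact: boltzmann_var_ge0.
have sg0 : 0 < sg by exact: boltzmann_std_gt0.
set y := (b%:R + c + (mj + _)) / s.
set W := boltzmann r j _ in IH *; set E := \sum_(i < j) _ in IH *.
have gH : affine_growth (fun N => h ((N%:R + c) / s)).
  exact: (affine_growth_bounded (fun N => hB _)).
have sW : geo_summable x (fun k => W (b + j.+1 * k)%N) by exact: boltzmann_summable.
pose v := gauss (Num.sqrt V) h.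
have vB z : `|v z| <= B by exact: gauss_bounded.
pose t := j.+1%:R / s; have t0 : 0 <= t by rewrite divr_ge0// ltW.
have sv : geo_summable x (fun k => v (y + t * (k%:R - x / (1 - x)))).
  exact: (geo_summable_bounded x01 (fun k => vB _)).
(* [E1] replaces the first [j] terms for every value of the last one, by induction. [H2] and [H1]
   below then trade the last term for a Gaussian of the same variance. *)
have E1 : `|geo x (fun k => W (b + j.+1 * k)%N) - geo x (fun k => v (y + t * (k%:R - x / (1 - x))))| <= E.
  rewrite -geoB// -(geo_cst E x01); apply: geo_normr_le => //.
  - exact: geo_summableB.
  - exact: geo_summable_cst.
  move=> k; apply: le_trans (IH (b + j.+1 * k)%N).
  rewrite le_eqVlt; apply/orP; left; apply/eqP; congr (`|_ - v _|).
  have xn0 : 1 - x != 0 by rewrite subr_eq0 gt_eqF.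
  have sn0 : s != 0 by rewrite gt_eqF.
  rewrite /y /t natrD natrM -/x -/mj; move: (j.+1%:R : R) xn0 => w xn0.
  by field; rewrite ?xn0 ?sn0.
have := geo_step (Num.sqrt V) y x01 t0.
have := gauss_step (Num.sqrt V) y (ltW sg0).
rewrite -/v gauss_semigroup ?sqrtr_ge0// sqr_sqrtr// -/x.
rewrite (boltzmann_stdE j) -/t -/x => H1 H2.
have H3 : K * gauss_cube * sg ^+ 3 <= K * gauss_cube * (t / (1 - x)) ^+ 3.
  rewrite ler_wpM2l ?mulr_ge0 ?gauss_cube_ge0// lerXn2r ?nnegrE ?(ltW sg0)//.
    by rewrite divr_ge0// subr_ge0 ltW.
  exact: boltzmann_std_le.
move: H1 (le_trans H1 H3) H2 E1 => _; set P := (t / (1 - x)) ^+ 3.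
rewrite (_ : K * (7 + gauss_cube) * P = K * 7 * P + K * gauss_cube * P); last by ring.
move: (geo x (fun k => v (y + t * (k%:R - x / (1 - x)))))
  (geo x (fun k => W (b + j.+1 * k)%N)) (v y) (t ^+ 2 * (x / (1 - x) ^+ 2) / 2 * _)
  (gauss (Num.sqrt (V + _)) h y) (K * gauss_cube * P) => A A' v0 w G Q.
rewrite !ler_norml => /andP[a1 a2] /andP[b1 b2] /andP[e1 e2].
by apply/andP; split; lra.
Qed.

End lindeberg.

(** * Debye integrals and Riemann sums *)

Section debye_integral.
Context {R : realType}.
Local Notation mu := (@lebesgue_measure R).

Lemma mean_value_pos (f df : R -> R) s t : 0 < s -> s <= t ->
  (forall x : R, 0 < x -> is_derive x (1 : R) f (df x)) ->
  exists2 c, s <= c <= t & f t - f s = df c * (t - s).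
Proof.
move=> s0 st fdf.
have [||c] := @MVT_segment R f df s t st.
- by move=> x; rewrite in_itv/= => /andP[sx _]; apply: fdf; exact: lt_trans sx.
- apply: derivable_within_continuous => x; rewrite in_itv/= => /andP[sx _].
  by have [] := fdf x (lt_le_trans s0 sx).
by rewrite in_itv/= => cst E; exists c.
Qed.

Lemma nonincreasing_pos (f df : R -> R) :
  (forall x : R, 0 < x -> is_derive x (1 : R) f (df x)) ->
  (forall x, 0 < x -> df x <= 0) ->
  forall s t, 0 < s -> s <= t -> f t <= f s.
Proof.
move=> fdf df0 s t s0 st; have [c /andP[sc ct] E] := mean_value_pos s0 st fdf.
rewrite -subr_le0 E mulr_le0_ge0 ?subr_ge0//; apply: df0; exact: lt_le_trans sc.
Qed.

(** Monotonicity sandwiches each cell [[i h, (i + 1) h]] with [i >= 1]. The first cell is handled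
    through [Psi t = O(t)], since the integrands used here take the junk value [0] at [0]; the shift
    between left and right endpoints costs at most [G h]. *)
Lemma riemann_nonincreasing (g Psi : R -> R) (lambda C G h : R) (m : nat) :
  0 < lambda -> h = lambda / m.+1%:R ->
  (forall s t, 0 < s -> s <= t -> g t <= g s) ->
  (forall t, 0 < t <= lambda -> 0 <= g t <= G) ->
  (forall t : R, 0 < t -> is_derive t (1 : R) Psi (g t)) ->
  (forall t, 0 < t <= lambda -> `|Psi t| <= C * t) ->
  `|\sum_(i < m) g (i.+1%:R * h) * h - Psi lambda| <= (C + G) * h.
Proof.
move=> l0 hE gdecr gG Psig PsiC.
have h0 : 0 < h by rewrite hE divr_gt0.
have y0 i : 0 < i.+1%:R * h by rewrite mulr_gt0.
have yl i : (i <= m)%N -> i.+1%:R * h <= lambda.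
  by move=> im; rewrite hE mulrCA ler_piMr ?(ltW l0)// ler_pdivrMr// mul1r ler_nat.
have hl : h <= lambda by have := yl 0%N; rewrite mul1r; exact.
have stp i : g (i.+2%:R * h) * h <= Psi (i.+2%:R * h) - Psi (i.+1%:R * h) <= g (i.+1%:R * h) * h.
  have yy : i.+1%:R * h <= i.+2%:R * h by rewrite ler_pM2r// ler_nat.
  have [c /andP[c1 c2] ->] := mean_value_pos (y0 i) yy Psig.
  rewrite -mulrBl -natrB// subSnn mul1r !ler_pM2r//.
  by rewrite !gdecr// (lt_le_trans (y0 i)).
have tele n : \sum_(i < n) (Psi (i.+2%:R * h) - Psi (i.+1%:R * h)) = Psi (n.+1%:R * h) - Psi h.
  elim: n => [|n IH]; first by rewrite big_ord0 mul1r subrr.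
  by rewrite big_ord_recr /= IH addrC subrKA.
have lE : m.+1%:R * h = lambda by rewrite hE mulrC divfK// pnatr_eq0.
have up : Psi lambda - Psi h <= \sum_(i < m) g (i.+1%:R * h) * h.
  by rewrite -lE -tele; apply: ler_sum => i _; have /andP[] := stp i.
have shift n : \sum_(i < n) g (i.+2%:R * h) * h + g h * h =
    \sum_(i < n) g (i.+1%:R * h) * h + g (n.+1%:R * h) * h.
  elim: n => [|n IH]; first by rewrite !big_ord0 mul1r.
  by rewrite !big_ord_recr /= -IH addrAC.
have lo : \sum_(i < m) g (i.+1%:R * h) * h <= Psi lambda - Psi h + G * h.
  have := shift m; have : \sum_(i < m) g (i.+2%:R * h) * h <= Psi lambda - Psi h.
    by rewrite -lE -tele; apply: ler_sum => i _; have /andP[] := stp i.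
  have : g h * h <= G * h.
    rewrite ler_pM2r//; have /gG/andP[] // : 0 < h <= lambda.
    by rewrite h0 hl.
  have : 0 <= g (m.+1%:R * h) * h.
    by rewrite mulr_ge0 ?(ltW h0)// lE; have /gG/andP[] // : 0 < lambda <= lambda; rewrite l0 lexx.
  lra.
have Ph : `|Psi h| <= C * h by apply: PsiC; rewrite h0 hl.
have Gh : 0 <= G * h.
  rewrite mulr_ge0 ?(ltW h0)//; have /gG/andP[a b] : 0 < lambda <= lambda by rewrite l0 lexx.
  exact: le_trans b.
move: Ph up lo; rewrite !ler_norml mulrDl => /andP[p1 p2] up lo.
apply/andP; split; lra.
Qed.

Definition debye (t : R) : R := t / (expR t - 1).
(* The integrand of the variance; [debye2_int] is its primitive obtained by
   integration by parts. *)
Definition debye2 (t : R) : R := t ^+ 2 * expR t / (expR t - 1) ^+ 2.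

Lemma expm1_gt0 (t : R) : 0 < t -> 0 < expR t - 1.
Proof. by move=> t0; rewrite subr_gt0 expR_gt1. Qed.

Lemma onem_mul_expR_le1 (t : R) : (1 - t) * expR t <= 1.
Proof.
have H := expR_ge1Dx (- t); have t0 := expR_gt0 t.
by rewrite -[leRHS](expRxMexpNx_1 t) mulrC ler_wpM2l// ltW.
Qed.

Lemma debye_itv t : 0 <= t -> 0 <= debye t <= 1.
Proof.
rewrite le_eqVlt => /predU1P[<-|t0]; first by rewrite /debye mul0r lexx ler01.
have e0 := expm1_gt0 t0; rewrite /debye divr_ge0 ?(ltW t0) ?(ltW e0)//=.
by rewrite ler_pdivrMr// mul1r; have := expR_ge1Dx t; lra.
Qed.

Lemma is_derive_debye (t : R) : 0 < t ->
  is_derive t (1 : R) debye ((expR t - 1 - t * expR t) / (expR t - 1) ^+ 2).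
Proof.
move=> t0; have e0 := expm1_gt0 t0; have en0 : expR t - 1 != 0 by rewrite gt_eqF.
rewrite /debye; apply: is_derive_eq; rewrite /GRing.scale/=.
by field.
Qed.

Lemma debye_nonincreasing s t : 0 < s -> s <= t -> debye t <= debye s.
Proof.
apply: (nonincreasing_pos is_derive_debye) => x x0.
rewrite mulr_le0_ge0 ?invr_ge0 ?sqr_ge0//.
by have := onem_mul_expR_le1 x; lra.
Qed.

Lemma is_derive_debye2 (t : R) : 0 < t ->
  is_derive t (1 : R) debye2
    (t * expR t * ((2 - t) * expR t - (2 + t)) / (expR t - 1) ^+ 3).
Proof.
move=> t0; have e0 := expm1_gt0 t0; have en0 : expR t - 1 != 0 by rewrite gt_eqF.
have en2 : (expR t - 1) ^+ 2 != 0 by rewrite expf_neq0.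
rewrite /debye2; apply: is_derive_eq; rewrite /GRing.scale/=.
by field.
Qed.

(** This decides the sign of the derivative of [debye2]. The difference of the two sides vanishes at
    [0] and has derivative [1 - (1 - x) expR x >= 0]. *)
Lemma debye2_sign (t : R) : 0 < t -> (2 - t) * expR t <= 2 + t.
Proof.
move=> t0; pose k (x : R) := (2 + x) - (2 - x) * expR x.
have kdk (x : R) : is_derive x (1 : R) k (1 - (1 - x) * expR x).
  by apply: is_derive_eq; rewrite /GRing.scale/=; ring.
have [c _ E] := mean_value 0 t kdk.
have k0 : k 0 = 0 by rewrite /k expR0; ring.
have : 0 <= k t - k 0.
  by rewrite E subr0 mulr_ge0 ?(ltW t0)// subr_ge0 onem_mul_expR_le1.
by rewrite k0 subr0 /k subr_ge0.
Qed.

Lemma debye2_nonincreasing s t : 0 < s -> s <= t -> debye2 t <= debye2 s.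
Proof.
apply: (nonincreasing_pos is_derive_debye2) => x x0.
have e0 := expm1_gt0 x0.
rewrite mulr_le0_ge0 ?invr_ge0 ?exprn_ge0 ?(ltW e0)//.
rewrite mulr_ge0_le0 ?mulr_ge0 ?expR_ge0 ?(ltW x0)// subr_le0.
exact: debye2_sign.
Qed.

Lemma debye2E t : debye2 t = debye t ^+ 2 * expR t.
Proof. by rewrite /debye2 /debye expr_div_n mulrAC. Qed.

Lemma debye2_gt0 t : 0 < t -> 0 < debye2 t.
Proof.
by move=> t0; rewrite debye2E mulr_gt0 ?expR_gt0// exprn_gt0// divr_gt0// expm1_gt0.
Qed.

Lemma debye2_itv lambda t : 0 < t <= lambda -> 0 <= debye2 t <= expR lambda.
Proof.
move=> /andP[t0 tl]; rewrite (ltW (debye2_gt0 t0))/= debye2E.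
have /andP[d0 d1] := debye_itv (ltW t0).
rewrite -[leRHS]mul1r; apply: ler_pM; rewrite ?expR_ge0 ?exprn_ge0 ?ler_expR//.
exact: exprn_ile1.
Qed.

Definition debye_int (t : R) : R := \int[mu]_(x in `[0, t]) debye x.

Lemma continuous_debye (t : R) : 0 < t -> {for t, continuous debye}.
Proof.
move=> t0; have [d _] := is_derive_debye t0.
by apply: differentiable_continuous; apply/derivable1_diffP.
Qed.

(** [debye] jumps at [0], where division by zero gives [0] instead of the limit [1]; the origin is
    therefore split off. *)
Lemma measurable_debye (u : R) : measurable_fun `[0, u] debye.
Proof.
have m1 : measurable_fun `](0 : R), +oo[ debye.
  apply: open_continuous_measurable_fun; first exact: interval_open.
  by move=> x; rewrite inE/= in_itv/= andbT => x0; exact: continuous_debye.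
have m2 : measurable_fun ([set (0 : R)] `|` `](0 : R), +oo[) debye.
  by apply/measurable_funU => //; split => //; exact: measurable_fun_set1.
apply: measurable_funS m2; first exact: measurableU.
move=> x; rewrite /= !in_itv/= => /andP[+ _].
by rewrite le_eqVlt => /predU1P[<-|x0]; [left|right; rewrite x0].
Qed.

Lemma integrable_debye (u : R) : mu.-integrable `[0, u] (EFin \o debye).
Proof.
apply: measurable_bounded_integrable => //.
- rewrite /= lebesgue_measure_itv/=; case: ifPn => _; last exact: ltry.
  by rewrite -EFinB ltry.
- exact: measurable_debye.
exists 1; split => // M M1 x; rewrite /= in_itv/= => /andP[x0 _].
by have /andP[d0 d1] := debye_itv x0; rewrite ger0_norm// (le_trans d1)// ltW.
Qed.

Lemma is_derive_debye_int (t : R) : 0 < t -> is_derive t (1 : R) debye_int (debye t).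
Proof.
move=> t0; have tu : t < t + 1 by rewrite ltrDl.
have [d E] := continuous_FTC1_closed tu (integrable_debye (t + 1)) t0 (continuous_debye t0).
by apply: DeriveDef; [exact: d|rewrite -derive1E; exact: E].
Qed.

Lemma debye_int_itv t : 0 <= t -> 0 <= debye_int t <= t.
Proof.
move=> t0; apply/andP; split.
  by apply: Rintegral_ge0 => x; rewrite /= in_itv/= => /andP[x0 _]; have /andP[] := debye_itv x0.
apply: (@le_trans _ _ (\int[mu]_(x in `[0, t]) (cst 1 x))).
  apply: le_Rintegral => //.
  - exact: integrable_debye.
  - apply: measurable_bounded_integrable => //.
    + rewrite /= lebesgue_measure_itv/=; case: ifPn => _; last exact: ltry.
      by rewrite -EFinB ltry.
    + by exists 1; split => // M M1 x _ /=; rewrite normr1 ltW.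
  - by move=> x; rewrite /= in_itv/= => /andP[x0 _]; have /andP[] := debye_itv x0.
rewrite Rintegral_cst// mul1r /= lebesgue_measure_itv/= lte_fin.
by case: ifPn => _ //=; rewrite subr0.
Qed.

Definition debye2_int (t : R) : R := 2 * debye_int t - t ^+ 2 / (expR t - 1).

Lemma is_derive_debye2_int (t : R) : 0 < t ->
  is_derive t (1 : R) debye2_int (debye2 t).
Proof.
move=> t0; have e0 := expm1_gt0 t0; have en0 : expR t - 1 != 0 by rewrite gt_eqF.
have d1 := is_derive_debye_int t0.
rewrite /debye2_int; apply: is_derive_eq; rewrite /GRing.scale/= /debye /debye2.
by field.
Qed.

Lemma debye2_int_le t : 0 < t -> `|debye2_int t| <= 2 * t.
Proof.
move=> t0; have /andP[a0 a1] := debye_int_itv (ltW t0).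
have /andP[b0 b1] := debye_itv (ltW t0).
rewrite /debye2_int; have -> : t ^+ 2 / (expR t - 1) = t * debye t.
  by rewrite /debye mulrA -expr2.
have c0 : 0 <= t * debye t by rewrite mulr_ge0// ltW.
have c1 : t * debye t <= t by rewrite ler_piMr// ltW.
by rewrite ler_norml; apply/andP; split; lra.
Qed.

Lemma debye2_int_gt0 t : 0 < t -> 0 < debye2_int t.
Proof.
move=> t0; set g := debye2 t; have g0 : 0 < g by exact: debye2_gt0.
have D0 : 0 < 2 * (2 + g) by lra.
(* With this [s] one has [(2 + g) s = t g / 2], so the increment over [[s, t]], at least
   [g (t - s)], exceeds the bound [2 s] on the value at [s]. *)
pose s := t * (g / (2 * (2 + g))).
have s0 : 0 < s by rewrite mulr_gt0// divr_gt0.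
have st : s <= t by rewrite ler_piMr ?(ltW t0)// ler_pdivrMr// mul1r; lra.
have [c /andP[sc ct] E] := mean_value_pos s0 st is_derive_debye2_int.
have gc : g <= debye2 c by apply: debye2_nonincreasing => //; exact: lt_le_trans sc.
have := debye2_int_le s0; rewrite ler_norml => /andP[h1 _].
have h2 : g * (t - s) <= debye2 c * (t - s) by rewrite ler_wpM2r// subr_ge0.
have h3 : s * (2 * (2 + g)) = t * g by rewrite /s -mulrA divfK// gt_eqF.
have : 0 < t * g by rewrite mulr_gt0.
by move: h2; rewrite mulrBr [g * t]mulrC; lra.
Qed.

End debye_integral.

(** * Asymptotics of the mean and the variance *)

Section boltzmann_asymptotics.
Context {R : realType}.
Variables (lambda : R) (m : nat).
Hypothesis lambda_gt0 : 0 < lambda.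
Local Notation d := m.+1.
Let r := expR (- (lambda / d%:R)).

Lemma expR_onem_itv01 : 0 < r < 1.
Proof. by rewrite expR_gt0/= expR_lt1 oppr_lt0 divr_gt0. Qed.

Lemma expR_onem_pow : r ^+ d = expR (- lambda).
Proof. by rewrite -expRM_natl mulrN mulrC divfK// gt_eqF. Qed.

Let y i := i.+1%:R * (lambda / d%:R).

Let y_gt0 i : 0 < y i. Proof. by rewrite mulr_gt0// divr_gt0. Qed.

Let rE i : r ^+ i.+1 = (expR (y i))^-1.
Proof. by rewrite -expRM_natl mulrN expRN. Qed.

(** With [y = j lambda / d], the mean of [j X_j] is [(d / lambda) ^ 2] times
    [debye y * (lambda / d)], a term of a Riemann sum. The error [O(d)] is below the scale
    [d ^ (3/2)]. *)
Lemma boltzmann_mean_asymp :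
  `|boltzmann_mean r m - (d%:R / lambda) ^+ 2 * debye_int lambda| <= 2 * (d%:R / lambda).
Proof.
have ln0 : lambda != 0 by rewrite gt_eqF.
have dn0 : d%:R != 0 :> R by rewrite gt_eqF.
have H := @riemann_nonincreasing R debye debye_int lambda 1 1 (lambda / d%:R) m
  lambda_gt0 erefl debye_nonincreasing _ is_derive_debye_int _.
have {}H : `|\sum_(i < m) debye (y i) * (lambda / d%:R) - debye_int lambda| <= (1 + 1) * (lambda / d%:R).
  apply: H => t /andP[t0 _]; first exact/debye_itv/ltW.
  by have /andP[a b] := debye_int_itv (ltW t0); rewrite ger0_norm// mul1r.
have -> : boltzmann_mean r m = (d%:R / lambda) ^+ 2 * (\sum_(i < m) debye (y i) * (lambda / d%:R)).
  rewrite /boltzmann_mean mulr_sumr; apply: eq_bigr => i _.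
  have e1 := expm1_gt0 (y_gt0 i); have en1 : expR (y i) - 1 != 0 by rewrite gt_eqF.
  have en : expR (y i) != 0 by rewrite gt_eqF// expR_gt0.
  rewrite rE (_ : debye (y i) = i.+1%:R * (lambda / d%:R) / (expR (y i) - 1))//.
  move: (expR (y i)) en en1 => e en en1; move: (i.+1%:R : R) (d%:R : R) dn0 => w D Dn0.
  by field; rewrite ?ln0 ?Dn0 ?en ?en1.
rewrite -mulrBr normrM ger0_norm ?sqr_ge0//.
apply: (le_trans (ler_wpM2l (sqr_ge0 _) H)).
move: (d%:R : R) dn0 => D Dn0.
by rewrite le_eqVlt; apply/orP; left; apply/eqP; field; rewrite ?ln0 ?Dn0.
Qed.

(** At the scale [s ^ 2 = d ^ 3] the variance of [j X_j / s] is [debye2 y * (lambda / d)] divided by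
    [lambda ^ 3], with [y] as for the mean. *)
Lemma boltzmann_var_asymp (s : R) : s ^+ 2 = d%:R ^+ 3 ->
  `|boltzmann_var r s m - debye2_int lambda / lambda ^+ 3|
    <= (2 + expR lambda) / (lambda ^+ 2 * d%:R).
Proof.
move=> sE; have ln0 : lambda != 0 by rewrite gt_eqF.
have dn0 : d%:R != 0 :> R by rewrite gt_eqF.
have H := @riemann_nonincreasing R debye2 debye2_int lambda 2 (expR lambda) (lambda / d%:R) m
  lambda_gt0 erefl debye2_nonincreasing _ is_derive_debye2_int _.
have {}H : `|\sum_(i < m) debye2 (y i) * (lambda / d%:R) - debye2_int lambda|
    <= (2 + expR lambda) * (lambda / d%:R).
  by apply: H => t /andP[t0 tl]; [apply: debye2_itv; rewrite t0|exact: debye2_int_le].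
have -> : boltzmann_var r s m = (\sum_(i < m) debye2 (y i) * (lambda / d%:R)) / lambda ^+ 3.
  rewrite /boltzmann_var mulr_suml; apply: eq_bigr => i _.
  rewrite (boltzmann_stdE _ expR_onem_itv01) expr_div_n sE.
  have e1 := expm1_gt0 (y_gt0 i); have en1 : expR (y i) - 1 != 0 by rewrite gt_eqF.
  have en : expR (y i) != 0 by rewrite gt_eqF// expR_gt0.
  rewrite rE (_ : debye2 (y i) = (i.+1%:R * (lambda / d%:R)) ^+ 2 * expR (y i) / (expR (y i) - 1) ^+ 2)//.
  move: (expR (y i)) en en1 => e en en1; move: (i.+1%:R : R) (d%:R : R) dn0 => w D Dn0.
  by field; rewrite ?ln0 ?Dn0 ?en ?en1.
rewrite -mulrBl normrM (ger0_norm (_ : 0 <= (lambda ^+ 3)^-1)); last first.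
  by rewrite invr_ge0 exprn_ge0// ltW.
have i0 : 0 <= (lambda ^+ 3)^-1 by rewrite invr_ge0 exprn_ge0// ltW.
apply: (le_trans (ler_wpM2r i0 H)).
move: (d%:R : R) dn0 => D Dn0.
by rewrite le_eqVlt; apply/orP; left; apply/eqP; field; rewrite ?ln0 ?Dn0.
Qed.

End boltzmann_asymptotics.

(** * Weak convergence from smooth test functions *)

Section smoothing.
Context {R : realType}.
Local Notation mu := (@lebesgue_measure R).
Implicit Types (f g : R -> R) (A : R).

Definition compact_support A f := forall x, A <= `|x| -> f x = 0.

Lemma uniformly_continuous_compact_support A f : continuous f -> compact_support A f ->
  forall e, 0 < e -> exists2 d, 0 < d & forall x y, `|x - y| <= d -> `|f x - f y| <= e.
Proof.
move=> cf sf e e0.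
have /compact_near_coveringP nc := @segment_compact R (- (A + 1)) (A + 1).
pose P (d x : R) := forall y, `|x - y| <= d -> `|f x - f y| <= e.
have : \forall d \near 0^'+, `[- (A + 1), A + 1] `<=` P d.
  apply: nc => x _.
  have /cvgrPdist_lt/(_ (e / 2)) := cf x; rewrite divr_gt0// => /(_ isT).
  rewrite near_simpl => -[d /= d0 Hd].
  exists (ball x (d / 2), [set u | u < d / 2]) => /=.
    split; first by apply: nbhsx_ballx; rewrite divr_gt0.
    by apply: nbhs_right_lt; rewrite divr_gt0.
  move=> [x' u] /= [xx' ud] y x'y.
  have h1 : `|f x - f x'| < e / 2.
    by apply: Hd; rewrite /ball_/= (lt_trans xx')// gtr_pMr// invf_lt1// ltr1n.
  have h2 : `|f x - f y| < e / 2.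
    apply: Hd; rewrite /ball_/= -(subrKA x') (le_lt_trans (ler_normD _ _))//.
    rewrite [ltRHS](splitr d); apply: ltrD => //; exact: le_lt_trans ud.
  rewrite -(subrKA (f x)) (le_trans (ler_normD _ _))// [leRHS](splitr e).
  by apply: lerD; rewrite ltW// distrC.
move=> [d /= d0 Hd].
(* Since [d' <= 1], a point within [d'] of some [x] beyond [A + 1] is still outside the support. *)
pose d' := Num.min (d / 2) 1.
have d'0 : 0 < d' by rewrite lt_min ltr01 andbT divr_gt0.
have d'1 : d' <= 1 by rewrite ge_min lexx orbT.
have d'd : d' < d by rewrite gt_min gtr_pMr// invf_lt1// ltr1n.
exists d' => // x y xy.
have [xA|xA] := leP `|x| (A + 1).
  apply: (Hd d') => //=; first by rewrite /ball_/= sub0r normrN gtr0_norm.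
  by rewrite in_itv/= -ler_norml.
rewrite (sf x); last by rewrite (le_trans _ (ltW xA))// lerDl.
rewrite (sf y) ?subrr ?normr0 ?(ltW e0)//.
have := lerB_dist x y; have := le_trans xy d'1; lra.
Qed.

Lemma bounded_compact_support A f : continuous f -> compact_support A f ->
  exists2 M, 0 <= M & forall x, `|f x| <= M.
Proof.
move=> cf sf.
have AA : - `|A| <= `|A| by rewrite (@le_trans _ _ 0)// oppr_le0.
have cn : {within `[- `|A|, `|A|], continuous (fun x => `|f x|)}.
  apply: continuous_subspaceT => x.
  by apply: (@continuous_comp _ _ _ f (fun y : R => `|y|)); [exact: cf|exact: norm_continuous].
have [c _ cM] := EVT_max AA cn; exists `|f c| => // x.
have [xA|xA] := leP `|x| `|A|.
  by apply: cM; rewrite in_itv/= -ler_norml.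
by rewrite sf ?normr0// (le_trans (ler_norm A))// ltW.
Qed.

(** Compact support makes [f] integrable on half-lines, so one primitive based at [-oo] serves every
    point. *)
Lemma antiderivative_compact_support A f : continuous f -> compact_support A f ->
  exists F, forall x : R, is_derive x (1 : R) F (f x).
Proof.
move=> cf sf; have [M M0 fM] := bounded_compact_support cf sf.
exists (fun x => \int[mu]_(t in [set` Interval -oo%O (BRight x)]) f t) => x.
have xu : x < x + 1 by rewrite ltrDl.
have fi : mu.-integrable [set` Interval -oo%O (BRight (x + 1))] (EFin \o f).
  apply: (@integrableS _ _ _ mu setT) => //.
  have i1 := integrableZl measurableT M (integrable_indic_itv (- A) A true false).
  apply: le_integrable i1 => //.
    by apply/measurable_EFinP; exact: continuous_measurable_fun.
  move=> y _ /=; rewrite lee_fin; have [yA|yA] := leP A `|y|.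
    by rewrite sf// normr0.
  rewrite indicE mem_set; last by rewrite /= in_itv/= -ler_norml ltW.
  by rewrite mulr1 (ger0_norm M0).
have [|d E] := continuous_FTC1 xu fi _ (cf x); first by rewrite /= ltNyr.
by apply: DeriveDef; [exact: d|rewrite -derive1E; exact: E].
Qed.

Lemma derive_continuous f (df : R -> R) : (forall x : R, is_derive x (1 : R) f (df x)) ->
  continuous f.
Proof.
move=> fdf x; apply: differentiable_continuous; apply/derivable1_diffP.
by have [] := fdf x.
Qed.

Lemma is_derive_shift f (df : R -> R) (a : R) :
  (forall x : R, is_derive x (1 : R) f (df x)) ->
  forall x : R, is_derive x (1 : R) (fun y => f (a + y)) (df (a + x)).
Proof.
move=> fdf x; rewrite -[df _]mulr1.
apply: (@is_derive1_comp R f (fun y => a + y)).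
by apply: is_derive_eq; rewrite add0r mulr1.
Qed.

(* [g x] is the average of [f] over [[x, x + d]]. *)
Lemma box_average A f d : continuous f -> compact_support A f -> 0 < d ->
  exists g, [/\ forall x : R, is_derive x (1 : R) g ((f (d + x) - f x) / d),
    forall x, exists2 c, `|c - x| <= d & g x = f c & compact_support (A + d) g].
Proof.
move=> cf sf d0; have [F Ff] := antiderivative_compact_support cf sf.
have dn0 : d != 0 by rewrite gt_eqF.
exists (fun x => (F (d + x) - F x) / d).
have av x : exists2 c, `|c - x| <= d & (F (d + x) - F x) / d = f c.
  have [c cx E] := mean_value x (d + x) Ff.
  exists c; first by rewrite addrK (gtr0_norm d0) in cx.
  by rewrite E addrK mulfK.
split=> //.
- move=> x; have Fd := is_derive_shift d Ff x.
  by have := Ff x => Fx; apply: is_derive_eq; rewrite /GRing.scale/= ?scaler0; ring.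
- move=> x Ax; have [c cx ->] := av x; apply: sf.
  by have := lerB_dist x (x - c); rewrite opprB addrCA subrr addr0 distrC; lra.
Qed.

(** The mean value theorem is applied twice, to the first-order remainder of [h1] and to the
    second-order remainder of [h]; each application gains one power of [|y|]. *)
Lemma taylor2_lipschitz (h h1 h2 : R -> R) (K : R) :
  (forall x : R, is_derive x (1 : R) h (h1 x)) ->
  (forall x : R, is_derive x (1 : R) h1 (h2 x)) ->
  (forall x y, `|h2 x - h2 y| <= K * `|x - y|) -> taylor2 K h h1 h2.
Proof.
move=> Dh Dh1 Lh2.
have K0 : 0 <= K by have := Lh2 1 0; rewrite subr0 normr1 mulr1; exact: le_trans.
have T1 x y : `|h1 (x + y) - h1 x - y * h2 x| <= K * `|y| ^+ 2.
  pose phi t := h1 (x + t) - t * h2 x.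
  have Dphi (t : R) : is_derive t (1 : R) phi (h2 (x + t) - h2 x).
    have D1 := is_derive_shift x Dh1 t.
    by apply: is_derive_eq; rewrite /GRing.scale/=; ring.
  have [c cy E] := mean_value 0 y Dphi; rewrite !subr0 in cy E.
  have -> : h1 (x + y) - h1 x - y * h2 x = phi y - phi 0.
    by rewrite /phi addr0; ring.
  rewrite E normrM expr2 mulrA ler_wpM2r//.
  by rewrite (le_trans (Lh2 _ _))// addrC addKr ler_wpM2l.
move=> x y.
pose psi t := h (x + t) - t * h1 x - t ^+ 2 / 2 * h2 x.
have Dpsi (t : R) : is_derive t (1 : R) psi (h1 (x + t) - h1 x - t * h2 x).
  have D1 := is_derive_shift x Dh t.
  by apply: is_derive_eq; rewrite /GRing.scale/=; field.
have [c cy E] := mean_value 0 y Dpsi; rewrite !subr0 in cy E.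
have -> : h (x + y) - h x - y * h1 x - y ^+ 2 / 2 * h2 x = psi y - psi 0.
  by rewrite /psi addr0; field.
rewrite E normrM exprSr mulrA ler_wpM2r// (le_trans (T1 _ _))//.
by rewrite ler_wpM2l// lerXn2r ?nnegrE.
Qed.

Lemma lipschitz_derive f (df : R -> R) L : (forall x : R, is_derive x (1 : R) f (df x)) ->
  (forall x, `|df x| <= L) -> forall x y, `|f x - f y| <= L * `|x - y|.
Proof.
move=> Df dL x y; have [c _ ->] := mean_value y x Df.
by rewrite normrM ler_wpM2r.
Qed.

Definition smooth_test (h h1 h2 : R -> R) (B L K : R) :=
  [/\ [/\ continuous h, continuous h1 & continuous h2],
      [/\ forall x, `|h x| <= B, forall x, `|h1 x| <= B & forall x, `|h2 x| <= B],
      forall x y, `|h x - h y| <= L * `|x - y| & taylor2 K h h1 h2].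

(* Three successive box averages are twice differentiable with Lipschitz second
   derivative. *)
Lemma smooth_approximation A f e : continuous f -> compact_support A f -> 0 < e ->
  exists h h1 h2 B L K,
    smooth_test h h1 h2 B L K /\ forall x, `|h x - f x| <= e.
Proof.
move=> cf sf e0.
have [d0 d00 Hd0] := uniformly_continuous_compact_support cf sf e0.
have [M M0 fM] := bounded_compact_support cf sf.
(* Each of the three averages moves the evaluation point by at most [d], hence by [d0]
   altogether. *)
pose d := d0 / 3; have dp : 0 < d by rewrite divr_gt0.
have dn0 : d != 0 by rewrite gt_eqF.
have [g1 [D1 a1 s1]] := box_average cf sf dp.
have [g2 [D2 a2 s2]] := box_average (derive_continuous D1) s1 dp.
have [g3 [D3 a3 s3]] := box_average (derive_continuous D2) s2 dp.
have g1M x : `|g1 x| <= M by have [c _ ->] := a1 x.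
have g2M x : `|g2 x| <= M by have [c _ ->] := a2 x.
have g3M x : `|g3 x| <= M by have [c _ ->] := a3 x.
pose h1 x := (g2 (d + x) - g2 x) / d.
pose h2 x := ((g1 (d + (d + x)) - g1 (d + x)) / d - (g1 (d + x) - g1 x) / d) / d.
have Dh1 (x : R) : is_derive x (1 : R) h1 (h2 x).
  have E1 := D2 x; have E2 := is_derive_shift d D2 x.
  rewrite /h1; apply: is_derive_eq; rewrite /GRing.scale/= ?scaler0 /h2; ring.
have diffM g : (forall x, `|g x| <= M) -> forall x, `|(g (d + x) - g x) / d| <= 2 * M / d.
  move=> gM x; rewrite normrM (gtr0_norm (_ : 0 < d^-1)) ?invr_gt0//.
  rewrite ler_pM2r ?invr_gt0// (le_trans (ler_normB _ _))//.
  by have := gM x; have := gM (d + x); lra.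
have g1L := lipschitz_derive D1 (diffM _ fM).
pose K1 := 2 * M / d; have K10 : 0 <= K1 by rewrite divr_ge0 ?mulr_ge0// ltW.
have h2L x y : `|h2 x - h2 y| <= 4 * K1 / (d * d) * `|x - y|.
  have l1 := g1L (d + (d + x)) (d + (d + y)).
  have l2 := g1L (d + x) (d + y); have l3 := g1L x y.
  have e2 : d + x - (d + y) = x - y by ring.
  have e1 : d + (d + x) - (d + (d + y)) = x - y by ring.
  rewrite e1 in l1; rewrite e2 in l2.
  have -> : h2 x - h2 y = ((g1 (d + (d + x)) - g1 (d + (d + y))) - (g1 (d + x) - g1 (d + y))
     - (g1 (d + x) - g1 (d + y)) + (g1 x - g1 y)) / (d * d).
    by rewrite /h2; field.
  rewrite normrM (ger0_norm (_ : 0 <= (d * d)^-1)); last by rewrite invr_ge0 mulr_ge0// ltW.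
  rewrite [leRHS]mulrAC ler_pM2r ?invr_gt0 ?mulr_gt0//.
  rewrite -/K1 in l1 l2 l3; move: l1 l2 l3.
  move: (g1 (d + (d + x)) - _) (g1 (d + x) - _) (g1 x - _) => u v w l1 l2 l3.
  have := ler_normD (u - v - v) w; have := ler_normB (u - v) v; have := ler_normB u v.
  lra.
have c2 : continuous h2.
  exact: lipschitz_continuous h2L.
have h1M x : `|h1 x| <= K1 by exact: diffM.
have h2M x : `|h2 x| <= 2 * K1 / d.
  rewrite /h2 normrM (gtr0_norm (_ : 0 < d^-1)) ?invr_gt0//.
  rewrite ler_pM2r ?invr_gt0// (le_trans (ler_normB _ _))//.
  by have := diffM _ g1M x; have := diffM _ g1M (d + x); rewrite -/K1; lra.
have B2 : 0 <= 2 * K1 / d by apply: divr_ge0; [exact: mulr_ge0|exact: ltW].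
exists g3, h1, h2, (M + K1 + 2 * K1 / d), K1, (4 * K1 / (d * d)); split.
  split.
  - split; [exact: derive_continuous D3|exact: derive_continuous Dh1|exact: c2].
  - split => x.
    + by rewrite (le_trans (g3M x))//; lra.
    + by rewrite (le_trans (h1M x))//; lra.
    + by rewrite (le_trans (h2M x))//; lra.
  - exact: (lipschitz_derive D3 h1M).
  - exact: taylor2_lipschitz D3 Dh1 h2L.
move=> x; have [c3 x3 ->] := a3 x; have [c2' x2 ->] := a2 c3; have [c1 x1 ->] := a1 c2'.
apply: Hd0.
have -> : c1 - x = (c1 - c2') + (c2' - c3) + (c3 - x) by ring.
have := ler_normD (c1 - c2' + (c2' - c3)) (c3 - x).
have := ler_normD (c1 - c2') (c2' - c3).
have : d * 3 = d0 by rewrite /d divfK.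
lra.
Qed.

End smoothing.

(** * Means of bounded continuous functions *)

Section mean_of_bounded_continuous.
Context {R : realType}.
Variable P : probability (measurableTypeR R) R.
Implicit Types f g : R -> R.

Definition bounded_continuous f := continuous f /\ exists B, forall x, `|f x| <= B.

Lemma bounded_continuousD f g : bounded_continuous f -> bounded_continuous g ->
  bounded_continuous (fun x => f x + g x).
Proof.
move=> [cf [B fB]] [cg [C gC]]; split.
  by move=> x; apply: cvgD; [exact: cf|exact: cg].
by exists (B + C) => x; rewrite (le_trans (ler_normD _ _))// lerD.
Qed.

Lemma bounded_continuousM f g : bounded_continuous f -> bounded_continuous g ->
  bounded_continuous (fun x => f x * g x).
Proof.
move=> [cf [B fB]] [cg [C gC]]; split.
  by move=> x; apply: cvgM; [exact: cf|exact: cg].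
by exists (B * C) => x; rewrite normrM ler_pM.
Qed.

Lemma bounded_continuous_cst (c : R) : bounded_continuous (fun=> c).
Proof. by split; [move=> x; exact: cvg_cst|exists `|c|]. Qed.

Lemma bounded_continuousB f g : bounded_continuous f -> bounded_continuous g ->
  bounded_continuous (fun x => f x - g x).
Proof.
move=> bf bg.
have := bounded_continuousD bf (bounded_continuousM (bounded_continuous_cst (-1)) bg).
by congr bounded_continuous; apply/funext => x; rewrite mulN1r.
Qed.

Lemma bounded_continuous_integrable f : bounded_continuous f ->
  P.-integrable setT (EFin \o f).
Proof.
move=> [cf [B fB]]; apply: measurable_bounded_integrable => //.
- by rewrite (le_lt_trans (probability_le1 P measurableT))// ltry.
- exact: continuous_measurable_fun.
- exists B; split; first exact: num_real.
  by move=> M BM x _ /=; rewrite (le_trans (fB x))// ltW.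
Qed.

Lemma mean_cst (c : R) : \int[P]_x c = c.
Proof.
rewrite Rintegral_cst// [X in fine X](_ : _ = 1%E) ?mulr1//.
exact: probability_setT.
Qed.

Lemma meanB f g : bounded_continuous f -> bounded_continuous g ->
  \int[P]_x (f x - g x) = \int[P]_x f x - \int[P]_x g x.
Proof.
by move=> /bounded_continuous_integrable ? /bounded_continuous_integrable ?; exact: RintegralB.
Qed.

Lemma meanZ f c : bounded_continuous f -> \int[P]_x (c * f x) = c * \int[P]_x f x.
Proof. by move=> /bounded_continuous_integrable ?; exact: RintegralZl. Qed.

Lemma mean_le f g : bounded_continuous f -> bounded_continuous g ->
  (forall x, f x <= g x) -> \int[P]_x f x <= \int[P]_x g x.
Proof.
move=> /bounded_continuous_integrable ? /bounded_continuous_integrable ? fg.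
exact: le_Rintegral.
Qed.

Lemma mean_dist_le f g h : bounded_continuous f -> bounded_continuous g ->
  bounded_continuous h -> (forall x, `|f x - g x| <= h x) ->
  `|\int[P]_x f x - \int[P]_x g x| <= \int[P]_x h x.
Proof.
move=> bf bg bh fgh; rewrite -meanB// ler_norml -mulN1r -meanZ//.
have bh' := bounded_continuousM (bounded_continuous_cst (-1)) bh.
apply/andP; split; apply: mean_le => //; try exact: bounded_continuousB.
  by move=> x; have := fgh x; rewrite mulN1r ler_norml => /andP[].
by move=> x; rewrite (le_trans (ler_norm _)).
Qed.

End mean_of_bounded_continuous.

(** * Extension from smooth to bounded continuous test functions *)

Section weak_convergence_criterion.
Context {R : realType}.
Variables (mu : nat -> probability (measurableTypeR R) R)
          (nu : probability (measurableTypeR R) R).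

Hypothesis cvg_smooth : forall (h h1 h2 : R -> R) B L K, smooth_test h h1 h2 B L K ->
  \int[mu n]_x h x @[n --> \oo] --> \int[nu]_x h x.

Lemma cvg_compact_support (f : R -> R) A : continuous f -> compact_support A f ->
  \int[mu n]_x f x @[n --> \oo] --> \int[nu]_x f x.
Proof.
move=> cf sf; apply/cvgrPdist_le => e e0.
have e30 : 0 < e / 3 by rewrite divr_gt0.
have [h [h1 [h2 [B [L [K [Hh hf]]]]]]] := smooth_approximation cf sf e30.
have [M M0 fM] := bounded_compact_support cf sf.
have bf : bounded_continuous f by split => //; exists M.
have bh : bounded_continuous h.
  by case: Hh => -[ch _ _] [hB _ _] _ _; split => //; exists B.
have bc := bounded_continuous_cst (e / 3).
have close (P : probability (measurableTypeR R) R) : `|\int[P]_x h x - \int[P]_x f x| <= e / 3.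
  by rewrite -[leRHS](mean_cst P); exact: mean_dist_le.
have /cvgrPdist_le/(_ _ e30) := cvg_smooth Hh.
apply: filterS => n Hn.
have := close nu; have := close (mu n); move: Hn.
rewrite !ler_norml => /andP[a1 a2] /andP[b1 b2] /andP[c1 c2].
by apply/andP; split; lra.
Qed.

Definition cutoff (A x : R) : R := Num.max 0 (Num.min 1 (A + 1 - `|x|)).

Lemma cutoff_itv A x : 0 <= cutoff A x <= 1.
Proof. by rewrite /cutoff le_max lexx/= ge_max ler01/= ge_min lexx. Qed.

Lemma continuous_cutoff A : continuous (cutoff A).
Proof.
apply: (@lipschitz_continuous _ _ 1) => x y; rewrite mul1r.
have := lerB_dist x y; have := lerB_dist y x; rewrite (distrC y x) => h1 h2.
rewrite /cutoff; move: (normr_ge0 (x - y)); move: h1 h2; move: `|x - y| `|x| `|y| => D a b h1 h2 D0.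
rewrite ler_norml !minEle !maxEle.
case: (leP 1 (A + 1 - a)) => ?; case: (leP 1 (A + 1 - b)) => ?; rewrite ?ler01.
- by apply/andP; split; lra.
- by case: (leP 0 (A + 1 - b)) => ?; apply/andP; split; lra.
- by case: (leP 0 (A + 1 - a)) => ?; apply/andP; split; lra.
- by case: (leP 0 (A + 1 - a)) => ?; case: (leP 0 (A + 1 - b)) => ?; apply/andP; split; lra.
Qed.

Lemma cutoff_support A : compact_support (A + 1) (cutoff A).
Proof.
move=> x Ax; rewrite /cutoff; apply/eqP; rewrite eq_le le_max lexx andbT.
by rewrite ge_max lexx/= ge_min subr_le0 Ax orbT.
Qed.

Lemma bounded_continuous_cutoff A : bounded_continuous (cutoff A).
Proof.
split; first exact: continuous_cutoff.
by exists 1 => x; have /andP[a b] := cutoff_itv A x; rewrite ger0_norm.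
Qed.

Hypothesis tight : forall e, 0 < e -> exists A, \int[nu]_x (1 - cutoff A x) <= e.

(** Tightness is assumed of the limit only. The cutoff is itself a compactly supported test
    function, so its means converge and the mass that [mu n] leaves outside is eventually small as
    well. *)
Lemma weak_cvg_smooth : weak_cvg mu nu.
Proof.
(* [bounded_fun] provides a bound only for reals strictly above [M0]; the maximum with [0] makes [M]
   positive. *)
move=> f cf [M0 [_ HM]]; pose M := Num.max 0 M0 + 1.
have Mp : 0 < M by rewrite ltr_wpDl// le_max lexx.
have fM x : `|f x| <= M.
  by apply: HM => //; rewrite (@le_lt_trans _ _ (Num.max 0 M0)) ?ltrDl// le_max lexx orbT.
apply/cvgrPdist_le => e e0.
have M8 : 0 < e / (8 * M) by rewrite divr_gt0// mulr_gt0.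
have [A HA] := tight M8.
have e40 : 0 < e / 4 by rewrite divr_gt0.
have bf : bounded_continuous f by split => //; exists M.
have bchi := bounded_continuous_cutoff A.
have b1 := bounded_continuous_cst (1 : R).
have b1chi := bounded_continuousB b1 bchi.
have bM := bounded_continuousM (bounded_continuous_cst M) b1chi.
pose g x := f x * cutoff A x.
have bg : bounded_continuous g by exact: bounded_continuousM.
have sg : compact_support (A + 1) g.
  by move=> x Ax; rewrite /g (cutoff_support Ax) mulr0.
have cut (P : probability (measurableTypeR R) R) :
    `|\int[P]_x f x - \int[P]_x g x| <= M * (1 - \int[P]_x cutoff A x).
  apply: (@le_trans _ _ (\int[P]_x (M * (1 - cutoff A x)))).
    apply: mean_dist_le => // x; rewrite /g -[X in X - _]mulr1 -mulrBr normrM.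
    have /andP[c0 c1] := cutoff_itv A x.
    by rewrite (ger0_norm (_ : 0 <= 1 - cutoff A x)) ?subr_ge0// ler_wpM2r// subr_ge0.
  by rewrite meanZ// meanB// mean_cst.
rewrite meanB// mean_cst in HA.
have Hg := cvg_compact_support bg.1 sg; have Hchi := cvg_compact_support (@continuous_cutoff A) (@cutoff_support A).
have /cvgrPdist_le/(_ _ e40) := Hg; have /cvgrPdist_le/(_ _ M8) := Hchi.
apply: filterS2 => n H1 H2.
have c1 := cut nu; have c2 := cut (mu n).
have MA : M * (1 - \int[nu]_x cutoff A x) <= e / 8.
  rewrite (le_trans (ler_wpM2l (ltW Mp) HA))// le_eqVlt; apply/orP; left; apply/eqP.
  by field; rewrite gt_eqF.
have MB : M * (1 - \int[mu n]_x cutoff A x) <= e / 4.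
  have h : 1 - \int[mu n]_x cutoff A x <= e / (8 * M) + e / (8 * M).
    by move: H1; rewrite ler_norml => /andP[]; move: (e / (8 * M)) HA => w; lra.
  rewrite (le_trans (ler_wpM2l (ltW Mp) h))// le_eqVlt; apply/orP; left; apply/eqP.
  by field; rewrite gt_eqF.
move: (le_trans c1 MA) (le_trans c2 MB) H2; rewrite !ler_norml.
move=> /andP[p1 p2] /andP[q1 q2] /andP[r1 r2].
by apply/andP; split; lra.
Qed.

End weak_convergence_criterion.

(** * Integration against the law of the random partition *)

Section mean_partition.
Context {R : realType}.
Variables (q : R) (n m : nat).
Hypotheses (q_gt0 : 0 < q) (m_gt0 : (0 < m)%N).
Local Notation P := (partition_prob q n m).
Local Notation T := (m.-tuple nat).

Let e : seq T := finmap.enum_fset (fset_set (partitions n m)).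
Let k0 : T := [tuple of nseq m 0%N].

Lemma norm_const_gt0 : 0 < \sum_(k \in partitions n m) q ^+ first_part k.
Proof.
have [k kP] := partitions_neq0 n m_gt0.
rewrite (fsbigD1 k)//=; last exact: finite_partitions.
by rewrite ltr_pwDl ?exprn_gt0// fsumr_ge0// => i _; rewrite exprn_ge0// ltW.
Qed.

Lemma partition_pmf_ge0 (k : T) : 0 <= partition_pmf q n k.
Proof. by rewrite mulr_ge0 ?invr_ge0 ?exprn_ge0 ?ltW// norm_const_gt0. Qed.

(** A presentation of [P] as a finite sum of weighted point masses reduces integrals to finite
    sums. *)
Let atom (i : nat) : {measure set T -> \bar R} :=
  mscale (NngNum (partition_pmf_ge0 (nth k0 e i))) (dirac (nth k0 e i)).

Lemma partition_prob_atoms (A : set T) : P A = msum atom (size e) A.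
Proof.
rewrite /partition_prob q_gt0 m_gt0 /=.
rewrite /msum /= /mscale /= -(big_mkord xpredT
  (fun i => ((partition_pmf q n (nth k0 e i))%:E * \d_(nth k0 e i) A)%E)).
rewrite -(big_nth k0 xpredT (fun k => ((partition_pmf q n k)%:E * \d_k A)%E)).
rewrite fsbig_mkcondr fsbig_finite/=; last exact: finite_partitions.
apply: eq_bigr => k _; rewrite diracE.
by case: (k \in A); rewrite ?mule1 ?mule0.
Qed.

Lemma ge0_integral_partition_prob (F : T -> R) : measurable_fun setT F ->
  (forall k, 0 <= F k) ->
  (\int[P]_k (F k)%:E =
   (\sum_(k \in partitions n m) partition_pmf q n k * F k)%:E)%E.
Proof.
move=> mF F0.
rewrite (eq_measure_integral (msum atom (size e))); last first.
  by move=> A _ _; exact: partition_prob_atoms.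
have mFE : measurable_fun setT (EFin \o F) by exact/measurable_EFinP.
have F0E k : setT k -> (0 <= (F k)%:E)%E by rewrite lee_fin.
rewrite (@ge0_integral_measure_sum _ _ _ atom setT measurableT _ F0E mFE).
rewrite fsbig_finite/=; last exact: finite_partitions.
rewrite -sumEFin (big_nth k0) big_mkord; apply: eq_bigr => i _.
rewrite (ge0_integral_mscale _ measurableT _ mFE F0E).
by rewrite (integral_dirac _ measurableT mFE) diracT mul1e.
Qed.

Lemma integral_partition_distribution (gamma : R) (h : R -> R) (B : R) :
  continuous h -> (forall x, `|h x| <= B) ->
  \int[distribution P (@scaled_first_part R gamma n m)]_x h x =
  (\sum_(k \in partitions n m) q ^+ first_part k * h (scaled_first_part gamma n k)) /
  (\sum_(k \in partitions n m) q ^+ first_part k).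
Proof.
move=> ch hB.
have mh : measurable_fun setT h by exact: continuous_measurable_fun.
have mX := @measurable_scaled_first_part R gamma n m.
(* The shift by [B] makes the integrand nonnegative, as the change of variables and the summation
   formula require. *)
pose g x := h x + B.
have g0 x : 0 <= g x by have := hB x; rewrite /g ler_norml => /andP[]; lra.
have bh : bounded_continuous h by split => //; exists B.
have bg : bounded_continuous g by apply: bounded_continuousD => //; exact: bounded_continuous_cst.
have Sg : \int[distribution P (@scaled_first_part R gamma n m)]_x g x =
    \sum_(k \in partitions n m) partition_pmf q n k * g (scaled_first_part gamma n k).
  have mg : measurable_fun [set: measurableTypeR R] g by exact: measurable_funD.
  have mgE : measurable_fun [set: measurableTypeR R] (EFin \o g) by exact/measurable_EFinP.
  rewrite /Rintegral (ge0_integral_distribution _ mgE); last first.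
    by move=> x; rewrite lee_fin.
  rewrite (ge0_integral_partition_prob (F := fun k => g (scaled_first_part gamma n k)))//.
  exact: measurableT_comp.
have pmf1 : \sum_(k \in partitions n m) partition_pmf q n k = 1.
  rewrite fsbig_finite/=; last exact: finite_partitions.
  rewrite -mulr_sumr /norm_const fsbig_finite/=; last exact: finite_partitions.
  rewrite mulVf//; have := norm_const_gt0.
  by rewrite fsbig_finite/= => [/lt0r_neq0//|]; exact: finite_partitions.
rewrite (_ : Rintegral _ _ _ = \int[distribution P (@scaled_first_part R gamma n m)]_x (g x - B)); last first.
  by apply: eq_Rintegral => x _; rewrite /g addrK.
rewrite meanB//; last exact: bounded_continuous_cst.
rewrite mean_cst Sg.
have fP := finite_partitions n m.
have fs (F : T -> R) : \sum_(k \in partitions n m) F k = \sum_(k <- fset_set (partitions n m)) F k.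
  exact: fsbig_finite.
rewrite !fs in pmf1 *.
transitivity (\sum_(k <- fset_set (partitions n m)) partition_pmf q n k * h (scaled_first_part gamma n k)).
  by rewrite -[X in _ - X]mul1r -pmf1 mulr_suml -sumrB; apply: eq_bigr => k _; rewrite /g; ring.
rewrite mulr_suml; apply: eq_bigr => k _.
by rewrite /partition_pmf /norm_const fs; ring.
Qed.

End mean_partition.

(** * The limit law *)

Section gauss_continuity.
Context {R : realType}.
Variables (h : R -> R) (B Lip : R).
Hypotheses (ch : continuous h) (hB : forall x, `|h x| <= B).
Hypothesis hL : forall x y, `|h x - h y| <= Lip * `|x - y|.

Definition gauss_abs : R := gauss_mean (fun z => `|z|).

Lemma gauss_abs_ge0 : 0 <= gauss_abs.
Proof.
rewrite -(gauss_mean_cst 0); apply: gauss_mean_le => //.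
- exact: gauss_tame_cst.
- exact: gauss_tame_norm.
Qed.

(** Both means run over the same standard normal variable, a coupling under which the Lipschitz
    bound applies pointwise. *)
Lemma gauss_dist (a b x : R) :
  `|gauss a h x - gauss b h 0| <= Lip * (`|x| + `|a - b| * gauss_abs).
Proof.
have Lip0 : 0 <= Lip by have := hL 1 0; rewrite subr0 normr1 mulr1; exact: le_trans.
have t1 := gauss_tame_affine x a ch hB.
have t2 := gauss_tame_affine 0 b ch hB.
have t3 := gauss_tameD t1 (gauss_tameZ (-1) t2).
have tn := gauss_tameZ `|a - b| (@gauss_tame_norm R).
have tc := gauss_tame_cst `|x|.
have tb := gauss_tameZ Lip (gauss_tameD tc tn).
have -> : gauss a h x - gauss b h 0 =
    gauss_mean (fun z => h (x + a * z) + -1 * h (0 + b * z)).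
  by rewrite gauss_meanD// ?gauss_meanZ// ?mulN1r//; exact: gauss_tameZ.
have -> : Lip * (`|x| + `|a - b| * gauss_abs) =
    gauss_mean (fun z => Lip * (`|x| + `|a - b| * `|z|)).
  rewrite gauss_meanZ//; last exact: gauss_tameD.
  by rewrite gauss_meanD// gauss_mean_cst gauss_meanZ//; exact: gauss_tame_norm.
apply: gauss_mean_normr_le => // z; rewrite mulN1r (le_trans (hL _ _))//.
rewrite ler_wpM2l// add0r -addrA -mulrBl (le_trans (ler_normD _ _))//.
by rewrite normrM.
Qed.

End gauss_continuity.

Lemma mean_normal_prob (R : realType) (s B : R) (h : R -> R) : 0 < s -> continuous h ->
  (forall x, `|h x| <= B) -> \int[normal_prob 0 s]_x h x = gauss s h 0.
Proof.
move=> s0 ch hB.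
have bh : bounded_continuous h by split => //; exists B.
have bB := bounded_continuous_cst B.
pose g x := h x + B.
have g0 x : 0 <= g x by have := hB x; rewrite /g ler_norml => /andP[]; lra.
have bg : bounded_continuous g by exact: bounded_continuousD.
have E : \int[normal_prob 0 s]_x g x = gauss s g 0.
  by rewrite /gauss /gauss_mean /Rintegral integral_normal_affine//; case: bg.
have -> : \int[normal_prob 0 s]_x h x = \int[normal_prob 0 s]_x (g x - B).
  by apply: eq_Rintegral => x _; rewrite /g addrK.
rewrite (@meanB R (normal_prob 0 s) g (fun=> B) bg bB) (@mean_cst R (normal_prob 0 s)) E.
rewrite /gauss (gauss_meanD (gauss_tame_affine 0 s ch hB) (gauss_tame_cst B)).
by rewrite gauss_mean_cst addrK.
Qed.

Lemma sqrt_dist (R : realType) (V S : R) : 0 <= V -> 0 < S ->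
  `|Num.sqrt V - Num.sqrt S| <= `|V - S| / Num.sqrt S.
Proof.
move=> V0 S0; have s0 : 0 < Num.sqrt S by rewrite sqrtr_gt0.
have E : V - S = (Num.sqrt V - Num.sqrt S) * (Num.sqrt V + Num.sqrt S).
  by rewrite -subr_sqr !sqr_sqrtr// ltW.
rewrite ler_pdivlMr// E normrM.
by rewrite ler_wpM2l// ger0_norm ?lerDr ?addr_ge0 ?sqrtr_ge0.
Qed.

(** * Quantitative bounds for a smooth test function *)

Section error_bound.
Context {R : realType}.
Variables (q lambda : R).
Hypotheses (q_gt0 : 0 < q) (q_lt1 : q < 1) (lambda_gt0 : 0 < lambda).
Hypothesis lambdaE : expR (- lambda) = q.
Variables (h h1 h2 : R -> R) (B Lip K : R).
Hypothesis test : smooth_test h h1 h2 B Lip K.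
Variables (n m : nat).
Hypothesis n_gt0 : (0 < n)%N.
Local Notation d := m.+1.
Local Notation res := (@residue R n m).

Let r := expR (- (lambda / d%:R)).
Let rt : R := Num.sqrt d%:R.
Let s := d%:R * rt.
Let gamma := (lambda ^+ 2)^-1 * debye_int lambda.
Let var := debye2_int lambda / lambda ^+ 3.
(** This constant makes [(N + c) / s], with [s = d ^ (3/2)] and [N = d k_1 - n], the rescaled first
    part. *)
Let c : R := n%:R - d%:R * (Num.ceil (n%:R / d%:R : R))%:~R - gamma * d%:R ^+ 2.
Let H (N : nat) := h ((N%:R + c) / s).

Let r01 : 0 < r < 1. Proof. exact: expR_onem_itv01. Qed.
Let rq : r ^+ d = q. Proof. by rewrite /r expR_onem_pow. Qed.
Let d_gt0 : 0 < d%:R :> R. Proof. by rewrite ltr0n. Qed.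
Let d_neq0 : d%:R != 0 :> R. Proof. by rewrite gt_eqF. Qed.
Let rt_gt0 : 0 < rt. Proof. by rewrite sqrtr_gt0. Qed.
Let rt_neq0 : rt != 0. Proof. by rewrite gt_eqF. Qed.
Let rt2 : rt ^+ 2 = d%:R. Proof. by rewrite sqr_sqrtr// ltW. Qed.
Let s_gt0 : 0 < s. Proof. exact: mulr_gt0. Qed.
Let s2 : s ^+ 2 = d%:R ^+ 3. Proof. by rewrite exprMn rt2 -exprSr. Qed.
Let q1_gt0 : 0 < 1 - q. Proof. by rewrite subr_gt0. Qed.
Let q_neq0 : q != 0. Proof. by rewrite gt_eqF. Qed.
Let q1_neq0 : 1 - q != 0. Proof. by rewrite gt_eqF. Qed.
Let l_neq0 : lambda != 0. Proof. by rewrite gt_eqF. Qed.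
Let var_gt0 : 0 < var. Proof. by rewrite divr_gt0 ?debye2_int_gt0 ?exprn_gt0. Qed.
Let hB x : `|h x| <= B. Proof. by case: test => _ []. Qed.
Let hL x y : `|h x - h y| <= Lip * `|x - y|. Proof. by case: test. Qed.
Let ch : continuous h. Proof. by case: test => -[]. Qed.
Let B0 : 0 <= B. Proof. exact: le_trans (normr_ge0 _) (hB 0). Qed.
Let Lip0 : 0 <= Lip.
Proof. by have := hL 1 0; rewrite subr0 normr1 mulr1; exact: le_trans. Qed.
Let K0 : 0 <= K.
Proof.
have [_ _ _ hK] := test.
by have := hK 0 1; rewrite normr1 !expr1n !mulr1; exact: le_trans.
Qed.

Lemma scaled_first_part_deficit (k : d.-tuple nat) : partitions n d k ->
  h (scaled_first_part gamma n k) = H (deficit n k).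
Proof.
move=> kP; rewrite /H; congr h; rewrite /scaled_first_part -/rt /deficit.
have nk : (n <= d * first_part k)%N.
  apply: (@first_part_ge n m k); rewrite -[k \in _]/(k \in fset_set (partitions n d)).
  by rewrite in_fset_set; [exact/mem_set|exact: finite_partitions].
rewrite natrB// natrM /c /s; move: (_%:~R : R) (first_part k)%:R => ce kk.
by move: (d%:R : R) d_neq0 => D Dn0; field; rewrite ?rt_neq0 ?Dn0.
Qed.

(* [d] times the normalization that turns partition weights into Boltzmann
   probabilities; the factor [d] compensates the probability [1 / d] of the
   residue class. *)
Definition scaled_weight : R := d%:R * (\prod_(i < m) (1 - r ^+ i.+1) / r ^+ n).

Lemma scaled_weight_gt0 : 0 < scaled_weight.
Proof.
rewrite mulr_gt0// divr_gt0 ?exprn_gt0 ?expR_gt0//.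
by apply: prodr_gt0 => i _; rewrite subr_gt0; case/andP: (expr_itv01 r01 i).
Qed.

Let partition_error : R := 2 * B * ((q * (1 - q))^-1 * ((1 - q)^-1 + 1)) * (d%:R ^+ 3 / n%:R).

(** One [d] comes from the rescaling, the Markov bound contributes [d / n], and the mean deficit on
    the residue class is [O(d ^ 2)] times a probability [O(1 / d)]. This is where [m = o(n ^ (1/3))]
    is spent. *)
Lemma partition_error_le : (0 < m)%N ->
  `|scaled_weight * (\sum_(k \in partitions n d) q ^+ first_part k * H (deficit n k))
     - d%:R * boltzmann r m (fun N => H N * res N) 0| <= partition_error.
Proof.
move=> m0; have := @sum_partitions_boltzmann R r n m r01 n_gt0 H B (fun N => hB _).
rewrite rq /scaled_weight; move: (_ / r ^+ n) (\sum_(k \in _) _) (boltzmann _ _ _ _) => w S b.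
move=> E; rewrite -(mulrA _ w) -mulrBr normrM gtr0_norm//.
apply: (le_trans (ler_wpM2l (ltW d_gt0) E)) => {E w S b}.
have W := boltzmann_id_residue_le r01 rq n m0.
have mm := boltzmann_mean_le r01 rq m.
have od := onem_base_le r01 rq.
have n0 : 0 < n%:R :> R by rewrite ltr0n.
have n_neq0 : n%:R != 0 :> R by rewrite gt_eqF.
have W2 : d%:R * boltzmann r m (fun N => N%:R * res N) 0 <=
    (1 - q) / q / (1 - q) ^+ 2 * (d%:R * (d%:R / (1 - q)) + d%:R * d%:R).
  apply: (le_trans (ler_wpM2l (ltW d_gt0) W)); rewrite [leLHS]mulrA.
  have i2 : 0 <= ((1 - q) ^+ 2)^-1 by rewrite invr_ge0 exprn_ge0// ltW.
  apply: ler_pM.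
  - by rewrite mulr_ge0// mulr_ge0 ?subr_ge0 ?(ltW d_gt0)//; case/andP: r01 => _ /ltW.
  - by rewrite addr_ge0 ?(ltW d_gt0)// boltzmann_mean_ge0.
  - by rewrite mulrA ler_wpM2r.
  - apply: lerD; last by rewrite ler_peMl ?(ltW d_gt0)// ler1n.
    by rewrite (le_trans mm)// ler_wpM2r ?ler_nat// divr_ge0// ltW.
rewrite mulrCA; apply: (le_trans (ler_wpM2l _ W2)).
  by rewrite !mulr_ge0// invr_ge0.
rewrite le_eqVlt; apply/orP; left; apply/eqP; rewrite /partition_error.
move: (d%:R : R) (n%:R : R) n_neq0 => D N' Nn0.
by field; rewrite ?q_neq0 ?q1_neq0 ?Nn0.
Qed.

Let decouple_error L : R :=
  B * residue_error q m L + Lip * L%:R * decoupling_const q / rt.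

(** A unit of deficit moves the argument of [h] by [1 / s], and the first [L] terms move the deficit
    by [O(L d)]; the displacement error is [O(L / sqrt d)]. *)
Lemma decouple_error_le L : (1 < L <= m)%N ->
  `|d%:R * boltzmann r m (fun N => H N * res N) 0 - boltzmann r m H 0|
    <= decouple_error L.
Proof.
move=> /andP[L1 Lm]; have L1d : (1 < L <= d)%N by rewrite L1 ltnW.
have del0 : 0 <= Lip / s by rewrite divr_ge0// ltW.
have Hl b N : `|H (b + N)%N - H b| <= Lip / s * N%:R.
  rewrite (le_trans (hL _ _))// -mulrA ler_wpM2l//.
  rewrite -mulrBl natrD (_ : _ - _ = N%:R); last by ring.
  by rewrite ger0_norm ?divr_ge0 ?(ltW s_gt0)// mulrC.
have := boltzmann_decouple r01 rq n L1d Lm (fun N => hB _) del0 Hl.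
rewrite /decouple_error (_ : Lip / s * d%:R * L%:R * _ = Lip * L%:R * decoupling_const q / rt)//.
by rewrite /s; move: (d%:R : R) d_neq0 => D Dn0; field; rewrite ?Dn0 ?rt_neq0.
Qed.

Let clt_error : R := K * (7 + gauss_cube) / (q * (1 - q)) ^+ 3 / rt.

(** [j / (1 - r ^ j) = O(d)] uniformly in [j], so each scaled term has size [O(1 / sqrt d)], and
    fewer than [d] cubes add up to [O(1 / sqrt d)]. *)
Lemma clt_error_le :
  `|boltzmann r m H 0 - gauss (Num.sqrt (boltzmann_var r s m)) h ((c + boltzmann_mean r m) / s)|
    <= clt_error.
Proof.
have [[_ ch1 ch2] [_ h1B h2B] _ hK] := test.
have := boltzmann_lindeberg ch ch1 ch2 hB h1B h2B hL hK r01 s_gt0 m 0 c.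
rewrite add0r => E; apply: (le_trans E).
have g0 := @gauss_cube_ge0 R.
have KG : 0 <= K * (7 + gauss_cube) by rewrite mulr_ge0// addr_ge0.
apply: (@le_trans _ _ (\sum_(i < m) K * (7 + gauss_cube) * ((q * (1 - q))^-1 / rt) ^+ 3)).
  apply: ler_sum => i _; rewrite ler_wpM2l//.
  have /andP[x0 x1] := expr_itv01 r01 i.
  have x1' : 0 < 1 - r ^+ i.+1 by rewrite subr_gt0.
  have qx : q <= r ^+ i.+1.
    rewrite -rq ler_wiXn2l ?(ltW (expR_gt0 _))//; last exact: leqW.
    by case/andP: r01 => _ /ltW.
  have h3 : i.+1%:R / (1 - r ^+ i.+1) <= (q * (1 - q))^-1 * d%:R.
    rewrite ler_pdivrMr// -mulrA ler_pdivlMl ?mulr_gt0// (mulrC d%:R).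
    rewrite -ler_pdivrMr//; apply: le_trans (onem_expr_ge r01 i.+1).
    rewrite [leLHS](_ : _ = i.+1%:R * (q * ((1 - q) / d%:R))); last by field; rewrite ?d_neq0.
    rewrite -[leRHS]mulrA ler_wpM2l//; apply: ler_pM => //.
    - exact: ltW.
    - by rewrite divr_ge0 ?ltW.
    - by rewrite ler_pdivrMr// mulrC (onem_base_ge r01 rq).
  rewrite lerXn2r ?nnegrE//.
  - by rewrite divr_ge0 ?divr_ge0 ?(ltW s_gt0) ?(ltW x1').
  - by rewrite divr_ge0 ?invr_ge0 ?mulr_ge0 ?(ltW rt_gt0) ?(ltW q_gt0) ?(ltW q1_gt0).
  - rewrite mulrAC (_ : (q * (1 - q))^-1 / rt = (q * (1 - q))^-1 * d%:R / s); last first.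
      rewrite /s; move: (d%:R : R) d_neq0 => D Dn0.
      by field; rewrite ?q_neq0 ?q1_neq0 ?rt_neq0 ?Dn0.
    by rewrite ler_pM2r ?invr_gt0.
rewrite sumr_const card_ord -[leLHS]mulr_natl.
apply: (@le_trans _ _ (d%:R * (K * (7 + gauss_cube) * ((q * (1 - q))^-1 / rt) ^+ 3))).
  rewrite ler_wpM2r ?ler_nat// mulr_ge0// exprn_ge0// divr_ge0 ?(ltW rt_gt0)//.
  by rewrite invr_ge0 mulr_ge0 ?ltW.
rewrite le_eqVlt; apply/orP; left; apply/eqP; rewrite /clt_error -rt2.
by field; rewrite ?q_neq0 ?q1_neq0 ?rt_neq0.
Qed.

Let limit_error : R := Lip * ((1 + 2 / lambda) / rt +
  (2 + expR lambda) / (lambda ^+ 2 * d%:R) / Num.sqrt var * gauss_abs).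

(** The ceiling and the Riemann sum displace the centre by [O(d)], to be divided by [s = d ^ (3/2)];
    the standard deviation is off by [O(1 / d)]. *)
Lemma limit_error_le :
  `|gauss (Num.sqrt (boltzmann_var r s m)) h ((c + boltzmann_mean r m) / s)
    - gauss (Num.sqrt var) h 0| <= limit_error.
Proof.
apply: (le_trans (gauss_dist ch hB hL _ _ _)); rewrite ler_wpM2l//.
apply: lerD; last first.
  rewrite ler_wpM2r ?gauss_abs_ge0//.
  apply: (le_trans (sqrt_dist (boltzmann_var_ge0 _ _ _) var_gt0)).
  by rewrite ler_pM2r ?invr_gt0 ?sqrtr_gt0// boltzmann_var_asymp.
rewrite normrM (gtr0_norm (_ : 0 < s^-1)) ?invr_gt0// ler_pdivrMr//.
have mA := boltzmann_mean_asymp m lambda_gt0.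
have cE : `|n%:R - d%:R * (Num.ceil (n%:R / d%:R : R))%:~R| <= d%:R :> R.
  have h3 := ceil_ge (n%:R / d%:R : R); have h4 := ceilB1_lt (n%:R / d%:R : R).
  move: h3 h4; rewrite intrD; move: ((Num.ceil _)%:~R : R) => ce.
  rewrite ler_pdivrMr// ltr_pdivlMr// => h3 h4.
  have h5 := ltW d_gt0.
  rewrite ler_norml; apply/andP; split; lra.
have -> : c + boltzmann_mean r m =
   (n%:R - d%:R * (Num.ceil (n%:R / d%:R : R))%:~R) +
   (boltzmann_mean r m - (d%:R / lambda) ^+ 2 * debye_int lambda).
  by rewrite /c /gamma; move: (_%:~R : R) (boltzmann_mean r m) => ce bm; field.
apply: (le_trans (ler_normD _ _)); apply: (le_trans (lerD cE mA)).
rewrite le_eqVlt; apply/orP; left; apply/eqP; rewrite /s.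
by field; rewrite ?l_neq0 ?rt_neq0.
Qed.

Lemma partition_mean_error L : (1 < L <= m)%N ->
  `|scaled_weight * (\sum_(k \in partitions n d)
      q ^+ first_part k * h (scaled_first_part gamma n k))
     - gauss (Num.sqrt var) h 0|
  <= partition_error + decouple_error L + clt_error + limit_error.
Proof.
move=> Lm; have m0 : (0 < m)%N by case/andP: Lm => L1; apply: leq_trans; exact: ltnW.
have -> : \sum_(k \in partitions n d) q ^+ first_part k * h (scaled_first_part gamma n k) =
    \sum_(k \in partitions n d) q ^+ first_part k * H (deficit n k).
  by apply: eq_fsbigr => k /set_mem kP; rewrite scaled_first_part_deficit.
have := partition_error_le m0; have := decouple_error_le Lm.
have := clt_error_le; have := limit_error_le.
move: (scaled_weight * _) (d%:R * boltzmann r m _ 0) (boltzmann r m H 0) => x1 x2 x3.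
move: (gauss _ h (_ / _)) (gauss _ h 0) => x4 x5 e1 e2 e3 e4.
rewrite (_ : x1 - x5 = (x1 - x2) + (x2 - x3) + (x3 - x4) + (x4 - x5)); last by ring.
apply: (le_trans (ler_normD _ _)); apply: lerD => //.
apply: (le_trans (ler_normD _ _)); apply: lerD => //.
by apply: (le_trans (ler_normD _ _)); apply: lerD.
Qed.

End error_bound.

(** * Consequences of the growth conditions on [m] *)

Section growth.
Context {R : realType}.
Variables (m : nat -> nat).
Hypothesis m_oo : m n @[n --> \oo] --> \oo.
Hypothesis m_o :
  (fun n => (m n)%:R : R^o) =o_\oo (fun n => n%:R `^ (3^-1) : R^o).

Lemma inv_sqrt_small (e : R) : 0 < e ->
  \forall n \near \oo, (Num.sqrt (m n)%:R)^-1 <= e.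
Proof.
move=> e0; pose k := (Num.truncn (e^-1 ^+ 2)).+1.
have near_k : \forall n \near \oo, (k <= m n)%N := m_oo (nbhs_infty_ge k).
apply: filterS near_k => n kn.
have i0 : 0 < e^-1 by rewrite invr_gt0.
have ie : e^-1 <= Num.sqrt (m n)%:R.
  rewrite -[leLHS](ger0_norm (ltW i0)) -sqrtr_sqr ler_wsqrtr//.
  by apply: (@le_trans _ _ k%:R); [exact/ltW/truncnS_gt|rewrite ler_nat].
by rewrite -[leRHS]invrK lef_pV2 ?posrE// (lt_le_trans i0).
Qed.

Lemma cube_ratio_small (e : R) : 0 < e ->
  \forall n \near \oo, (m n)%:R ^+ 3 / n%:R <= e.
Proof.
(* With [t <= 1] one has [t ^ 3 <= t <= e], so the little-o bound can be cubed. *)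
move=> e0; pose t := Num.min 1 e.
have t0 : 0 < t by rewrite lt_min ltr01.
have t1 : t <= 1 by rewrite ge_min lexx.
have te : t <= e by rewrite ge_min lexx orbT.
have /eqoP/(_ t t0) H := m_o.
near=> n.
have n0 : 0 < n%:R :> R by rewrite ltr0n; near: n; exact: nbhs_infty_gt.
rewrite ler_pdivrMr//.
have : `|(m n)%:R : R^o| <= t * `|n%:R `^ (3^-1) : R^o| by near: n.
rewrite (ger0_norm (ler0n R _)) (ger0_norm (powR_ge0 _ _)) => h.
have := lerXn2r 3; move=> /(_ R) /(_ _ _ _ _ h).
rewrite !nnegrE ler0n mulr_ge0 ?powR_ge0 ?(ltW t0)// => /(_ isT isT) h3.
apply: (le_trans h3); rewrite exprMn -(powR_mulrn 3 (powR_ge0 _ _)) -powRrM mulVf// powRr1//.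
rewrite ler_pM2r// (le_trans _ te)// exprS ger_pMr//.
by rewrite exprn_ile1// ltW.
Unshelve. all: by end_near. Qed.

End growth.

(** * Passage to the limit *)

Section limit.
Context {R : realType}.
Variables (q lambda : R).
Hypotheses (q_gt0 : 0 < q) (q_lt1 : q < 1) (lambda_gt0 : 0 < lambda).
Hypothesis lambdaE : expR (- lambda) = q.
Variables (m : nat -> nat).
Hypothesis m_oo : m n @[n --> \oo] --> \oo.
Hypothesis m_o :
  (fun n => (m n)%:R : R^o) =o_\oo (fun n => n%:R `^ (3^-1) : R^o).

Let gamma := (lambda ^+ 2)^-1 * debye_int lambda.
Let sigma := Num.sqrt (debye2_int lambda / lambda ^+ 3).
Let weighted_sum (h : R -> R) n := scaled_weight lambda n (m n).-1 *
  \sum_(k \in partitions n (m n)) q ^+ first_part k * h (scaled_first_part gamma n k).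

Let sigma_gt0 : 0 < sigma.
Proof. by rewrite sqrtr_gt0 divr_gt0 ?debye2_int_gt0 ?exprn_gt0. Qed.

Lemma smooth_test_bounds (h h1 h2 : R -> R) B Lip K : smooth_test h h1 h2 B Lip K ->
  [/\ 0 <= B, 0 <= Lip & 0 <= K].
Proof.
move=> [_ [hB _ _] hL hK]; split.
- exact: le_trans (normr_ge0 _) (hB 0).
- by have := hL 1 0; rewrite subr0 normr1 mulr1; exact: le_trans.
- by have := hK 0 1; rewrite normr1 !expr1n !mulr1; exact: le_trans.
Qed.

(** [Z] may depend on [L] but not on [n], [d] or [t]: for fixed [L] all errors vanish with [t]
    except the contraction term, which is made small by the prior choice of [L]. *)
Lemma partition_mean_error_uniform (h h1 h2 : R -> R) B Lip K L :
  smooth_test h h1 h2 B Lip K -> (1 < L)%N ->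
  exists2 Z, 0 <= Z & forall n d t, (0 < n)%N -> (L < d)%N ->
    d%:R ^+ 3 / n%:R <= t -> (Num.sqrt d%:R)^-1 <= t ->
  `|scaled_weight lambda n d.-1 * (\sum_(k \in partitions n d)
      q ^+ first_part k * h (scaled_first_part gamma n k)) - gauss sigma h 0|
   <= B * ((1 - contraction q) ^+ (L - 2) / q) + Z * t.
Proof.
move=> test L1; have [B0 Lip0 K0] := smooth_test_bounds test.
have q1 : 0 < 1 - q by rewrite subr_gt0.
have ga := @gauss_abs_ge0 R; have gc := @gauss_cube_ge0 R.
pose Z1 := 2 * B * ((q * (1 - q))^-1 * ((1 - q)^-1 + 1)).
pose Z2 := B * (L%:R ^+ 2 * (6 * (1 - q) ^+ 2 / q ^+ 3)).
pose Z3 := Lip * L%:R * decoupling_const q.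
pose Z4 := K * (7 + gauss_cube) / (q * (1 - q)) ^+ 3.
pose Z5 := 1 + 2 / lambda.
pose Z6 := (2 + expR lambda) / lambda ^+ 2 / sigma * gauss_abs.
have i1 : 0 <= (1 - q)^-1 by rewrite invr_ge0 ltW.
have i2 : 0 <= (q * (1 - q))^-1 by rewrite invr_ge0 ltW ?mulr_gt0.
have Z10 : 0 <= Z1 by rewrite !mulr_ge0 ?addr_ge0.
have Z20 : 0 <= Z2.
  by rewrite mulr_ge0// mulr_ge0 ?exprn_ge0// divr_ge0 ?mulr_ge0 ?exprn_ge0// ltW.
have Z30 : 0 <= Z3.
  by rewrite mulr_ge0 ?mulr_ge0// /decoupling_const addr_ge0 ?mulr_ge0 ?addr_ge0.
have Z40 : 0 <= Z4.
  apply: divr_ge0; first by rewrite mulr_ge0 ?addr_ge0.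
  by rewrite exprn_ge0// ltW ?mulr_gt0.
have Z50 : 0 <= Z5 by rewrite addr_ge0// divr_ge0// ltW.
have Z60 : 0 <= Z6.
  by rewrite mulr_ge0// divr_ge0 ?divr_ge0 ?addr_ge0 ?expR_ge0 ?exprn_ge0// ltW.
exists (Z1 + (Z2 + Z3) + Z4 + Lip * (Z5 + Z6)).
  by rewrite !addr_ge0// mulr_ge0// addr_ge0.
move=> n [//|d] t n0 Ld dn dt; rewrite -[d.+1.-1]/d.
have Lm : (1 < L <= d)%N by rewrite L1.
have := partition_mean_error q_gt0 q_lt1 lambda_gt0 lambdaE test n0 Lm.
rewrite -/gamma -/sigma => /le_trans; apply.
have dt' : (d.+1%:R)^-1 <= t.
  apply: le_trans dt; rewrite lef_pV2 ?posrE ?sqrtr_gt0 ?ltr0n//.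
  have : Num.sqrt 1 <= Num.sqrt d.+1%:R :> R by rewrite ler_wsqrtr// ler1n.
  rewrite sqrtr1 => sq1; rewrite -[leRHS](sqr_sqrtr (ler0n R d.+1)) expr2.
  by rewrite ler_peMr ?sqrtr_ge0.
have D0 : d.+1%:R != 0 :> R by rewrite pnatr_eq0.
have e1 := ler_wpM2l Z10 dn.
have e2 := ler_wpM2l Z20 dt'.
have e3 := ler_wpM2l Z30 dt.
have e4 := ler_wpM2l Z40 dt.
have e5 := ler_wpM2l Z50 dt.
have e6 := ler_wpM2l Z60 dt'.
have e7 := ler_wpM2l Lip0 (lerD e5 e6); clear e5 e6.
rewrite -/Z1 -/Z3 -/Z4 -/Z5.
rewrite (_ : B * residue_error q d L =
  B * ((1 - contraction q) ^+ (L - 2) / q) + Z2 / d.+1%:R); last first.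
  by rewrite /residue_error /Z2; move: (_ / q) => x; ring.
rewrite (_ : _ / sigma * gauss_abs = Z6 / d.+1%:R); last first.
  by rewrite /Z6 invfM; ring.
move: e1 e2 e3 e4 e7; move: (Z1 * _) (Z2 / _) (Z3 / _) (Z4 / _) (Lip * (_ + _ / d.+1%:R)).
move: (B * _) => b x1 x2 x3 x4 x5 e1 e2 e3 e4 e5.
rewrite [leRHS](_ : _ = Z1 * t + (b + Z2 * t + Z3 * t) + Z4 * t + Lip * (Z5 * t + Z6 * t)); last by ring.
by apply: lerD => //; apply: lerD => //; apply: lerD => //; apply: lerD => //; exact: lerD.
Qed.

Lemma contraction_small (B e : R) : 0 <= B -> 0 < e ->
  exists2 L, (1 < L)%N & B * ((1 - contraction q) ^+ (L - 2) / q) <= e.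
Proof.
move=> B0 e0; have q01 : 0 < q < 1 by rewrite q_gt0.
have /andP[c0 c1] : 0 < contraction q < 1.
  rewrite /contraction mulr_gt0 ?exprn_gt0 ?subr_gt0//= (@le_lt_trans _ _ (1 - q))//.
    by rewrite ler_piMl ?subr_ge0 ?exprn_ile1// ltW.
  by rewrite ltrBlDr ltrDl.
have e1 : 0 < e * q / (B + 1) by rewrite divr_gt0 ?mulr_gt0// ltr_wpDl.
have x1 : `|1 - contraction q| < 1.
  by rewrite ger0_norm ?subr_ge0 ?ltW// ltrBlDr ltrDl.
have /cvgr0Pnorm_le/(_ _ e1)[k _ /(_ k (leqnn k)) H] := cvg_expr x1.
(* The shift by two accounts for the two terms spent on the Lipschitz bound. *)
exists k.+2 => //; rewrite -addn2 addnK mulrA ler_pdivrMr//.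
move: H; rewrite ger0_norm ?exprn_ge0 ?subr_ge0 ?(ltW c1)// => H.
apply: (le_trans (ler_wpM2l B0 H)); rewrite mulrA ler_pdivrMr ?ltr_wpDl//.
have := mulr_gt0 e0 q_gt0; move: (e * q) => y y0; nra.
Qed.

Lemma weighted_sum_cvg (h h1 h2 : R -> R) B Lip K : smooth_test h h1 h2 B Lip K ->
  weighted_sum h n @[n --> \oo] --> gauss sigma h 0.
Proof.
move=> test; have [B0 Lip0 K0] := smooth_test_bounds test.
apply/cvgrPdist_le => e e0; have e20 : 0 < e / 2 by rewrite divr_gt0.
have [L L1 HL] := contraction_small B0 e20.
have [Z Z0 HZ] := partition_mean_error_uniform test L1.
pose t := e / 2 / (Z + 1).
have Z1 : 0 < Z + 1 by rewrite ltr_wpDl.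
have t0 : 0 < t by rewrite divr_gt0.
have Zt : Z * t <= e / 2.
  by rewrite /t mulrA ler_pdivrMr// mulrC ler_wpM2l ?(ltW e20)// lerDl.
near=> n; rewrite distrC.
apply: le_trans (HZ n (m n) t _ _ _ _) _.
- by near: n; exact: nbhs_infty_gt.
- by near: n; exact: (m_oo (nbhs_infty_gt L)).
- by near: n; exact: cube_ratio_small.
- by near: n; exact: inv_sqrt_small.
by rewrite [leRHS](splitr e); exact: lerD.
Unshelve. all: by end_near. Qed.

(** The test function [1] turns the weighted sum into the scaled normalizing sum, which therefore
    tends to [1]; the mean is the quotient of two weighted sums. *)
Lemma smooth_test_cst1 : @smooth_test R (cst 1) (cst 0) (cst 0) 1 0 0.
Proof.
split; first by split; move=> x; exact: cvg_cst.
- by split=> x /=; rewrite ?normr1 ?normr0.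
- by move=> x y /=; rewrite subrr normr0 mul0r.
- by move=> x y /=; rewrite !mulr0 !subr0 subrr normr0 mul0r.
Qed.

Lemma mean_cvg (h h1 h2 : R -> R) B Lip K : (forall n, (0 < n)%N -> (0 < m n)%N) ->
  smooth_test h h1 h2 B Lip K ->
  \int[distribution (partition_prob q n (m n)) (@scaled_first_part R gamma n (m n))]_x h x
    @[n --> \oo] --> \int[normal_prob 0 sigma]_x h x.
Proof.
move=> m_gt0 test; have [[ch _ _] [hB _ _] _ _] := test.
rewrite (mean_normal_prob sigma_gt0 ch hB).
have c1 := weighted_sum_cvg smooth_test_cst1.
have g1 : gauss sigma (cst 1) 0 = 1 by rewrite /gauss/= gauss_mean_cst.
rewrite g1 in c1.
have := cvgM (weighted_sum_cvg test) (cvgV (oner_neq0 R) c1).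
rewrite invr1 mulr1 => c2.
apply: cvg_trans (c2 _ _); apply: near_eq_cvg.
near=> n; have n0 : (0 < n)%N by near: n; exact: nbhs_infty_gt.
rewrite (integral_partition_distribution _ q_gt0 (m_gt0 n n0) _ ch hB).
rewrite -[LHS]/(weighted_sum h n / weighted_sum (cst 1) n) /weighted_sum -mulf_div divff ?mul1r; last first.
  by rewrite gt_eqF// scaled_weight_gt0.
by congr (_ / _); apply: eq_fsbigr => k _ /=; rewrite mulr1.
Unshelve. all: by end_near. Qed.

(** Markov's inequality in the form [1 - cutoff A x <= |x| / A], with [A] above the first absolute
    moment divided by [e]. *)
Lemma normal_prob_tight e : 0 < e ->
  exists A, \int[normal_prob 0 sigma]_x (1 - cutoff A x) <= e.
Proof.
move=> e0; pose A := sigma * gauss_abs / e + 1; exists A.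
have A0 : 0 < A by rewrite ltr_wpDl// divr_ge0 ?mulr_ge0 ?gauss_abs_ge0 ?(ltW e0)// ltW.
have bc x : `|1 - cutoff A x| <= 1.
  by have /andP[a b] := cutoff_itv A x; rewrite ger0_norm ?subr_ge0// lerBlDr lerDl.
have cc : continuous (fun x => 1 - cutoff A x).
  by move=> x; apply: cvgB; [exact: cvg_cst|exact: continuous_cutoff].
rewrite (mean_normal_prob sigma_gt0 cc bc).
apply: (@le_trans _ _ (A^-1 * (sigma * gauss_abs))); last first.
  rewrite mulrC ler_pdivrMr// /A mulrDr mulr1 (mulrC e) divfK ?gt_eqF//.
  by rewrite lerDl ltW.
rewrite -gauss_meanZ; last exact: gauss_tame_norm.
rewrite -gauss_meanZ; last by apply: gauss_tameZ; exact: gauss_tame_norm.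
apply: gauss_mean_le.
- exact: (gauss_tame_affine 0 sigma cc bc).
- by do 2 apply: gauss_tameZ; exact: gauss_tame_norm.
move=> z; rewrite add0r -(gtr0_norm sigma_gt0) -normrM gtr0_norm//.
move: (sigma * z : R) => x; rewrite mulrC ler_pdivlMr//.
have /andP[k0 k1] := cutoff_itv A x.
have [xA|/ltW xA] := leP `|x| A.
  rewrite (_ : cutoff A x = 1) ?subrr ?mul0r//.
  apply: le_anti; apply/andP; split=> //; rewrite /cutoff le_max; apply/orP; right.
  by rewrite le_min lexx/= lerBrDr addrC lerD2r.
by apply: le_trans xA; rewrite ler_piMl ?(ltW A0)// lerBlDr lerDl.
Qed.

End limit.

Theorem theorem2 (R : realType) (q : R) (q_gt0 : 0 < q) (q_lt1 : q < 1)
    (m : nat -> nat) (m_gt0 : forall n, (0 < n)%N -> (0 < m n)%N)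
    (m_oo : m n @[n --> \oo] --> \oo)
    (m_o : (fun n => (m n)%:R : R^o) =o_\oo (fun n => n%:R `^ (3^-1) : R^o)) :
  let lambda := - ln q in
  let I := \int[lebesgue_measure]_(t in `[0, lambda]) (t / (expR t - 1)) in
  let gamma := (lambda ^+ 2)^-1 * I in
  let sigma2 := 2 / lambda ^+ 3 * I - (lambda * (expR lambda - 1))^-1 in
  0 < sigma2 /\
  weak_cvg
    (fun n => distribution (partition_prob q n (m n))
                           (@scaled_first_part R gamma n (m n)))
    (normal_prob 0 (Num.sqrt sigma2)).
Proof.
move=> lambda I gamma sigma2.
have l0 : 0 < lambda by rewrite oppr_gt0 ln_lt0// q_gt0.
have lE : expR (- lambda) = q by rewrite opprK lnK// posrE.
have e1 : expR lambda - 1 != 0 by rewrite gt_eqF// subr_gt0 expR_gt1.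
have IE : I = debye_int lambda by [].
(* The stated variance is [debye2_int lambda / lambda ^+ 3], the limit of the Riemann sums; its
   positivity comes from that of [debye2]. *)
have sE : sigma2 = debye2_int lambda / lambda ^+ 3.
  rewrite /sigma2 IE /debye2_int; move: (debye_int lambda) => J.
  by field; rewrite e1 gt_eqF.
split; first by rewrite sE divr_gt0 ?debye2_int_gt0 ?exprn_gt0.
rewrite sE; apply: weak_cvg_smooth.
  move=> h h1 h2 B L K test.
  exact: (mean_cvg q_gt0 q_lt1 l0 lE m_oo m_o m_gt0 test).
by move=> e; exact: normal_prob_tight.
Qed.
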